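(* Let $n\geq 1$. Let $R$ be an automorphism of a standard probability Borel space which is a non-zero root of an automorphism with the JP($n$) property, i.e. $R^m$ has the JP($n$) property for some non-zero integer $m$. Then $R$ is disjoint from every automorphism arising from an infinitely divisible (ID) stationary process.
   Context: An automorphism is an invertible measure-preserving transformation of a standard probability Borel space. For automorphisms $T$ of $(X,\mathcal{B},\mu)$ and $S$ of $(Y,\mathcal{C},\nu)$, $J(T,S)$ is the set of $T\times S$-invariant probability measures on $X\times Y$ with marginals $\mu$ and $\nu$, and $J^e(T,S)$ is the subset of ergodic ones. $T$ and $S$ are disjoint if $J(T,S)=\{\mu\otimes\nu\}$. JP($n$) (joining primeness of order $n\ge 1$): an ergodic automorphism $T$ of $(X,\mathcal{B},\mu)$ has the JP($n$) property if for any $k\geq n+1$, any weakly mixing automorphisms $S_i$ of standard probability Borel spaces $(Y_i,\mathcal{C}_i,\nu_i)$, $1\leq i\leq k$, and every $\lambda\in J^e(T,S_1\times\dots\times S_k)$, there exist indices $i_1,\dots,i_n\in\{1,\dots,k\}$ such that $\lambda=\lambda_{X,Y_{i_1},\dots,Y_{i_n}}\otimes\bigotimes_{j\notin\{i_1,\dots,i_n\}}\nu_j$, where $\lambda_{X,Y_{i_1},\dots,Y_{i_n}}$ is the projection of $\lambda$ on the product of the corresponding coordinate spaces. ID processes: an ergodic stationary real-valued process $(X_n)_{n\in\mathbb{Z}}$ is infinitely divisible (ID) if its distribution $P$ on $\mathbb{R}^{\mathbb{Z}}$ (with the product Borel $\sigma$-algebra) is such that for every $k\geq 1$ there is a probability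 measure $P_k$ on $\mathbb{R}^{\mathbb{Z}}$ with $P=P_k^{\ast k}$ ($k$-th convolution power in the additive group $\mathbb{R}^{\mathbb{Z}}$). The automorphism arising from the process is the shift on $(\mathbb{R}^{\mathbb{Z}},P)$. *)

(* Defs.v *)
From HB Require Import structures.
From mathcomp Require Import all_boot all_order all_algebra.
From mathcomp Require Import all_classical all_reals all_analysis.
From mathcomp Require Import measurable_realfun.

Set Implicit Arguments.
Unset Strict Implicit.
Unset Printing Implicit Defensive.
Import Order.TTheory GRing.Theory Num.Theory.

Local Open Scope classical_set_scope.
Local Open Scope ring_scope.

(* MathComp-Analysis measures are functions on all subsets, so two measures   *)
(* are identified when they agree on the measurable sets.                     *)
Definition eq_meas d (X : measurableType d) (R : realType)
    (m1 m2 : set X -> \bar R) : Prop :=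
  forall A, measurable A -> m1 A = m2 A.

(* (X, measurable) is isomorphic, as a measurable space, to a Polish space    *)
(* with its Borel sigma-algebra; <<s _ >> is the generated sigma-algebra.     *)
Definition standard_borel (R : realType) d (X : measurableType d) : Prop :=
  exists (M : completePseudoMetricType R) (f : X -> M),
    [/\ hausdorff_space M,
        exists D : set M, countable D /\ dense D,
        bijective f &
        forall A : set X, measurable A <-> <<s (@open M) >> (f @` A)].

Definition dprod_display (I : Type) :
  (I -> measure_display) -> measure_display.
Proof. by move=> _; exact: default_measure_display. Qed.

Definition dprod (I : Type) (d : I -> measure_display)
  (Y : forall i, measurableType (d i)) : Type := forall i, Y i.

Section dprod_measurable.
Context (I : Type) (d : I -> measure_display)
  (Y : forall i, measurableType (d i)).

Definition cylinder : set (set (dprod Y)) :=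
  [set A | exists (i : I) (B : set (Y i)),
    measurable B /\ A = [set x : dprod Y | B (x i)]].

HB.instance Definition _ := Pointed.copy (dprod Y) (forall i, Y i).

Let dprod0 : <<s cylinder >> set0.
Proof. exact: sigma_algebra0. Qed.

Let dprodC A : <<s cylinder >> A -> <<s cylinder >> (~` A).
Proof. by move=> ?; rewrite -setTD; exact: sigma_algebraCD. Qed.

Let dprodU (F : (set (dprod Y))^nat) :
  (forall i, <<s cylinder >> (F i)) -> <<s cylinder >> (\bigcup_i F i).
Proof. exact: sigma_algebra_bigcup. Qed.

HB.instance Definition _ := @isMeasurable.Build (dprod_display d)
  (dprod Y) <<s cylinder >> dprod0 dprodC dprodU.

Lemma measurable_coord i :
  measurable_fun [set: dprod Y] (fun x : dprod Y => x i).
Proof.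
move=> _ B mB; rewrite setTI; apply: sub_sigma_algebra.
by exists i, B.
Qed.

Lemma measurable_fun_dprod d' (T : measurableType d') (f : T -> dprod Y) :
  (forall i, measurable_fun [set: T] (fun t => f t i)) ->
  measurable_fun [set: T] f.
Proof.
move=> mf; apply: (@measurability _ _ _ _ _ _ cylinder) => //.
by move=> _ [_ [i [B [mB ->]]] <-]; exact: mf.
Qed.

End dprod_measurable.

Section dprod_measure.
Context (R : realType) (I : finType) (d : I -> measure_display)
  (Y : forall i, measurableType (d i)) (nu : forall i, probability (Y i) R).

Definition dupdate (i : I) (p : Y i * dprod Y) : dprod Y := dfwith p.2 i p.1.

Lemma measurable_dupdate i : measurable_fun setT (@dupdate i).
Proof.
apply: measurable_fun_dprod => j; rewrite /dupdate.
have [ij|ij] := eqVneq i j.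
  subst j; rewrite (_ : (fun _ => _) = fst) //.
  by apply/funext => p; rewrite dfwithin.
rewrite (_ : (fun _ => _) = (fun x : dprod Y => x j) \o snd); last first.
  by apply/funext => p; rewrite dfwithout.
by apply: measurableT_comp => //; exact: measurable_coord.
Qed.

HB.instance Definition _ i :=
  isMeasurableFun.Build _ _ _ _ (@dupdate i) (@measurable_dupdate i).

(* Law of the family whose coordinates indexed by s are independent with laws *)
(* nu i, the other coordinates being frozen at the base point. For s = enum I *)
(* nothing is frozen and this is the product measure: dprod_measure_box.      *)
Fixpoint seq_prod_measure (s : seq I) : probability (dprod Y) R :=
  if s is i :: s' then distribution (nu i \x seq_prod_measure s')%E (@dupdate i)
  else dirac (point : dprod Y).

Definition dprod_measure : probability (dprod Y) R :=
  seq_prod_measure (enum I).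


Definition box (B : forall i, set (Y i)) : set (dprod Y) :=
  [set x : dprod Y | forall i, B i (x i)].

Lemma measurable_box (B : forall i, set (Y i)) :
  (forall i, measurable (B i)) -> measurable (box B).
Proof.
move=> mB; rewrite (_ : box B =
    \bigcap_(i in [set: I]) ((fun x : dprod Y => x i) @^-1` B i)).
  apply: fin_bigcap_measurable => // i _.
  by rewrite -[X in measurable X]setTI; exact: measurable_coord.
by apply/seteqP; split => x /= h i; [move=> _|]; exact: h.
Qed.

Lemma seq_prod_measure_box (s : seq I) (B : forall i, set (Y i)) :
  uniq s -> (forall i, measurable (B i)) -> (forall i, i \notin s -> B i = setT) ->
  seq_prod_measure s (box B) = (\prod_(i <- s) fine (nu i (B i)))%:E.
Proof.
elim: s B => [|i s IH] B /=.
  move=> _ mB BT; rewrite big_nil (_ : box B = setT) ?probability_setT//.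
  by apply/seteqP; split => // x _ j; rewrite BT.
move=> /andP[nis us] mB BT.
pose B' := dfwith B i setT.
have mB' j : measurable (B' j).
  rewrite /B'; have [<-|ij] := eqVneq i j; first by rewrite dfwithin.
  by rewrite dfwithout.
rewrite /distribution/= /pushforward.
rewrite (_ : _ @^-1` _ = B i `*` box B'); last first.
  apply/seteqP; split => [[y x]|[y x]] /=; rewrite /dupdate/=.
    move=> h; split; first by have := h i; rewrite dfwithin.
    move=> j; rewrite /B'; have [<-|ij] := eqVneq i j; first by rewrite dfwithin.
    by rewrite dfwithout//; have := h j; rewrite dfwithout.
  move=> [By Bx] j; have [<-|ij] := eqVneq i j; first by rewrite dfwithin.
  by rewrite dfwithout//; have := Bx j; rewrite /B' dfwithout.
rewrite product_measure1E//; last exact: measurable_box.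
rewrite [X in (_ * X)%E]IH//; last first.
  move=> j js; rewrite /B'; have [<-|ij] := eqVneq i j; first by rewrite dfwithin.
  by rewrite dfwithout// BT// inE negb_or js andbT eq_sym.
rewrite big_cons EFinM fineK ?fin_num_measure//; congr (_ * (_)%:E)%E.
rewrite big_seq [RHS]big_seq; apply: eq_bigr => j js.
by rewrite /B' dfwithout//; apply: contraNneq nis => ->.
Qed.

Lemma dprod_measure_box (B : forall i, set (Y i)) :
  (forall i, measurable (B i)) ->
  dprod_measure (box B) = (\prod_i fine (nu i (B i)))%:E.
Proof.
move=> mB; rewrite [LHS]seq_prod_measure_box ?enum_uniq ?big_enum//.
by move=> i; rewrite mem_enum.
Qed.

Lemma dprod_measure_unique (m : probability (dprod Y) R) :
  (forall B : forall i, set (Y i), (forall i, measurable (B i)) ->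
    m (box B) = (\prod_i fine (nu i (B i)))%:E) ->
  eq_meas m dprod_measure.
Proof.
move=> mE A mA.
pose G := [set A : set (dprod Y) | exists2 B : forall i, set (Y i),
  (forall i, measurable (B i)) & A = box B].
have GT : G setT.
  by exists (fun=> setT) => //; apply/seteqP; split.
apply: (@measure_unique _ _ _ G (fun=> setT)) => //.
- apply/seteqP; split.
    apply: smallest_sub; first exact: smallest_sigma_algebra.
    move=> _ [i [B [mB ->]]]; apply: sub_sigma_algebra.
    exists (dfwith (fun=> setT) i B).
      move=> j; have [<-|ij] := eqVneq i j; first by rewrite dfwithin.
      by rewrite dfwithout.
    apply/seteqP; split => [x /= Bx j|x /=].
      have [<-|ij] := eqVneq i j; first by rewrite dfwithin.
      by rewrite dfwithout.
    by move=> /(_ i); rewrite dfwithin.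
  apply: smallest_sub; first exact: sigma_algebra_measurable.
  by move=> _ [B mB ->]; exact: measurable_box.
- move=> _ _ [B mB ->] [C mC ->]; exists (fun i => B i `&` C i).
    by move=> i; exact: measurableI.
  by apply/seteqP; split => [x [/= h1 h2] i|x /= h]; split => // i;
    have [] := h i.
- by rewrite bigcup_const//; exists 0%N.
- by move=> _ [B mB ->]; exact: etrans (mE B mB) (esym (dprod_measure_box mB)).
- by move=> _; rewrite [X in (X < _)%E]probability_setT ltry.
Qed.

End dprod_measure.

Record automorphism d (X : measurableType d) (R : realType)
    (mu : probability X R) := Automorphism {
  aut_fun :> X -> X;
  aut_inv : X -> X;
  aut_funK : cancel aut_fun aut_inv;
  aut_invK : cancel aut_inv aut_fun;
  measurable_aut_fun : measurable_fun [set: X] aut_fun;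
  measurable_aut_inv : measurable_fun [set: X] aut_inv;
  aut_preserving : eq_meas (pushforward mu aut_fun) mu
}.

Section automorphism_power.
Context d (X : measurableType d) (R : realType) (mu : probability X R).

Definition aut_id : automorphism mu :=
  @Automorphism _ _ _ mu idfun idfun (fun=> erefl) (fun=> erefl)
    (@measurable_id _ _ _) (@measurable_id _ _ _) (fun _ _ => erefl).

Program Definition aut_comp (T S : automorphism mu) : automorphism mu :=
  @Automorphism _ _ _ mu (T \o S) (aut_inv S \o aut_inv T) _ _ _ _ _.
Next Obligation. by move=> T S x /=; rewrite !aut_funK. Qed.
Next Obligation. by move=> T S x /=; rewrite !aut_invK. Qed.
Next Obligation.
by move=> T S; apply: measurableT_comp; exact: measurable_aut_fun.
Qed.
Next Obligation.
by move=> T S; apply: measurableT_comp; exact: measurable_aut_inv.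
Qed.
Next Obligation.
move=> T S A mA; rewrite -[RHS](aut_preserving T)// -[RHS](aut_preserving S)//.
by rewrite -[X in measurable X]setTI; exact: measurable_aut_fun.
Qed.

Program Definition aut_V (T : automorphism mu) : automorphism mu :=
  @Automorphism _ _ _ mu (aut_inv T) T (aut_invK T) (aut_funK T)
    (measurable_aut_inv T) (measurable_aut_fun T) _.
Next Obligation.
move=> T A mA; rewrite -[LHS](aut_preserving T); last first.
  by rewrite -[X in measurable X]setTI; exact: measurable_aut_inv.
by congr (mu _); apply/seteqP; split => x /=; rewrite aut_funK.
Qed.

Fixpoint aut_exp (T : automorphism mu) (n : nat) : automorphism mu :=
  if n is n'.+1 then aut_comp T (aut_exp T n') else aut_id.

Definition aut_expz (T : automorphism mu) (m : int) : automorphism mu :=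
  match m with
  | Posz n => aut_exp T n
  | Negz n => aut_exp (aut_V T) n.+1
  end.

End automorphism_power.

Definition ergodic d (X : measurableType d) (R : realType)
    (mu : probability X R) (T : X -> X) : Prop :=
  forall A, measurable A -> T @^-1` A = A -> mu A = 0%E \/ mu A = 1%E.

Definition pair_map (X Y : Type) (T : X -> X) (S : Y -> Y) (p : X * Y) : X * Y :=
  (T p.1, S p.2).

Definition weakly_mixing d (X : measurableType d) (R : realType)
    (mu : probability X R) (T : automorphism mu) : Prop :=
  ergodic (mu \x mu)%E (pair_map T T).

Section joinings.
Context d d' (X : measurableType d) (Y : measurableType d') (R : realType)
  (mu : probability X R) (nu : probability Y R).
Implicit Types (T : automorphism mu) (S : automorphism nu)
  (lambda : probability (X * Y)%type R).

Definition joining T S lambda : Prop :=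
  [/\ eq_meas (pushforward lambda fst) mu,
      eq_meas (pushforward lambda snd) nu &
      eq_meas (pushforward lambda (pair_map T S)) lambda].

Definition ergodic_joining T S lambda : Prop :=
  joining T S lambda /\ ergodic lambda (pair_map T S).

Definition disjoint_aut T S : Prop :=
  forall lambda, joining T S lambda <-> eq_meas lambda (mu \x nu)%E.

End joinings.

Section product_automorphism.
Context (R : realType) (I : finType) (d : I -> measure_display)
  (Y : forall i, measurableType (d i)) (nu : forall i, probability (Y i) R)
  (S : forall i, automorphism (nu i)).

Definition dprod_map (f : forall i, Y i -> Y i) (y : dprod Y) : dprod Y :=
  fun i => f i (y i).

Lemma measurable_dprod_map (f : forall i, Y i -> Y i) :
  (forall i, measurable_fun setT (f i)) -> measurable_fun setT (dprod_map f).
Proof.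
move=> mf; apply: measurable_fun_dprod => i.
by apply: (measurableT_comp (mf i)); exact: measurable_coord.
Qed.

Let prodS_measurable : measurable_fun setT (dprod_map S).
Proof. by apply: measurable_dprod_map => i; exact: measurable_aut_fun. Qed.

HB.instance Definition _ :=
  isMeasurableFun.Build _ _ _ _ (dprod_map S) prodS_measurable.

Let prodS_inv_measurable :
  measurable_fun setT (dprod_map (fun i => aut_inv (S i))).
Proof. by apply: measurable_dprod_map => i; exact: measurable_aut_inv. Qed.

Let prodS_funK :
  cancel (dprod_map S) (dprod_map (fun i => aut_inv (S i))).
Proof.
by move=> y; apply: functional_extensionality_dep => i; exact: aut_funK.
Qed.

Let prodS_invK :
  cancel (dprod_map (fun i => aut_inv (S i))) (dprod_map S).
Proof.
by move=> y; apply: functional_extensionality_dep => i; exact: aut_invK.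
Qed.

Let prodS_preserving :
  eq_meas (pushforward (dprod_measure nu) (dprod_map S)) (dprod_measure nu).
Proof.
apply: (@dprod_measure_unique _ _ _ _ nu
  (distribution (dprod_measure nu) (dprod_map S))) => B mB.
rewrite [LHS](@dprod_measure_box _ _ _ _ nu (fun i => S i @^-1` B i)).
  congr (_%:E); apply: eq_bigr => i _; congr fine.
  exact: (aut_preserving (S i)).
by move=> i; rewrite -[X in measurable X]setTI; exact: measurable_aut_fun.
Qed.

Definition dprod_aut : automorphism (dprod_measure nu) :=
  Automorphism prodS_funK prodS_invK prodS_measurable prodS_inv_measurable
    prodS_preserving.

End product_automorphism.

Section marginal.
Context dX (X : measurableType dX) (I : finType) (d : I -> measure_display)
  (Y : forall i, measurableType (d i)) (J : {set I}).

Definition marginal (p : X * dprod Y) :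
    X * dprod (fun i : {i | i \in J} => Y (val i)) :=
  (p.1, fun i => p.2 (val i)).

Definition complement (p : X * dprod Y) :
    dprod (fun i : {i | i \notin J} => Y (val i)) :=
  fun i => p.2 (val i).

Lemma measurable_marginal : measurable_fun setT marginal.
Proof.
apply: measurable_fun_pair => //; apply: measurable_fun_dprod => i.
have := measurableT_comp (@measurable_coord _ _ Y (val i))
  (@measurable_snd _ _ X (dprod Y)).
exact.
Qed.

HB.instance Definition _ :=
  isMeasurableFun.Build _ _ _ _ marginal measurable_marginal.

End marginal.
Arguments marginal {dX X I d Y} J p.
Arguments complement {dX X I d Y} J p.

(* The measure lambda_{X, Y_J} \otimes \bigotimes_(j \notin J) nu_j lives on  *)
(* (X * prod_(i in J) Y_i) * prod_(j notin J) Y_j, hence lambda is            *)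
(* transported there by regrouping the coordinates.                           *)
Definition JP (n : nat) dX (X : measurableType dX) (R : realType)
    (mu : probability X R) (T : automorphism mu) : Prop :=
  ergodic mu T /\
  forall (k : nat), (n.+1 <= k)%N ->
  forall (d : 'I_k -> measure_display) (Y : forall i, measurableType (d i))
    (nu : forall i, probability (Y i) R) (S : forall i, automorphism (nu i)),
  (forall i, standard_borel R (Y i)) ->
  (forall i, weakly_mixing (S i)) ->
  forall lambda : probability (X * dprod Y)%type R,
  ergodic_joining T (dprod_aut S) lambda ->
  exists2 J : {set 'I_k}, #|J| = n &
    eq_meas (pushforward lambda (fun p => (marginal J p, complement J p)))
      (distribution lambda (marginal J) \x
       dprod_measure (fun j : {j | j \notin J} => nu (val j)))%E.

Section processes.
Context (R : realType).

Definition Zseq : measurableType _ :=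
  dprod (fun _ : int => (R : measurableType _)).

Definition Zshift (x : Zseq) : Zseq := fun n : int => x (n + 1).

Definition Zunshift (x : Zseq) : Zseq := fun n : int => x (n - 1).

Definition Zseq_add (p : Zseq * Zseq) : Zseq := fun n => p.1 n + p.2 n.

Let coord n : measurable_fun setT (fun x : Zseq => x n).
Proof. exact: measurable_coord. Qed.

Lemma measurable_Zshift : measurable_fun setT Zshift.
Proof. by apply: measurable_fun_dprod => n; exact: coord. Qed.

Lemma measurable_Zunshift : measurable_fun setT Zunshift.
Proof. by apply: measurable_fun_dprod => n; exact: coord. Qed.

Lemma measurable_Zseq_add : measurable_fun setT Zseq_add.
Proof.
apply: measurable_fun_dprod => n.
by apply: measurable_funD;
  [exact: (measurableT_comp (coord n)) | exact: (measurableT_comp (coord n))].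
Qed.

HB.instance Definition _ :=
  isMeasurableFun.Build _ _ _ _ Zseq_add measurable_Zseq_add.

Definition convolution (P Q : probability Zseq R) : probability Zseq R :=
  distribution (P \x Q)%E Zseq_add.

Fixpoint convolution_power (P : probability Zseq R) (k : nat) :
    probability Zseq R :=
  if k is k'.+1 then convolution P (convolution_power P k')
  else dirac ((fun=> 0) : Zseq).

Definition infinitely_divisible (P : probability Zseq R) : Prop :=
  forall k : nat, (1 <= k)%N ->
    exists Pk : probability Zseq R, eq_meas P (convolution_power Pk k).

Definition stationary (P : probability Zseq R) : Prop :=
  eq_meas (pushforward P Zshift) P.

Program Definition shift_aut (P : probability Zseq R) (stP : stationary P) :
    automorphism P :=
  @Automorphism _ _ _ P Zshift Zunshift _ _ measurable_Zshift measurable_Zunshift stP.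
Next Obligation.
move=> P stP x; apply: functional_extensionality_dep => n.
by rewrite /Zunshift /Zshift subrK.
Qed.
Next Obligation.
move=> P stP x; apply: functional_extensionality_dep => n.
by rewrite /Zunshift /Zshift addrK.
Qed.

End processes.

(* Main.v *)
(* Let lam be a joining of T with the shift S of the process, and write      *)
(* P = Q^{*k}. The characteristic functional phi of P vanishes nowhere, since *)
(* 1 - |phi_Q(2a)|^2 <= 4 (1 - |phi_Q(a)|^2) for its roots Q; hence roots are *)
(* unique, and so stationary. They are weakly mixing: if Q = Q0^{*l} and      *)
(* eps = |phi_Q0(a)|^-2 - 1 = O(1/l), the ergodicity of P forces the mean     *)
(* square deviation of the correlations of exp(i a) under Q0 to be O(eps^3),  *)
(* so that it is O(l^2 eps^3) = O(1/l) under Q, for every l. Therefore S^m    *)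
(* acts ergodically on Q^k, and the sum of the coordinates is a factor map    *)
(* onto (P, S^m). The joining lam of T^m and S^m lifts to a joining of T^m    *)
(* with S^m on Q^k, and maximizing a linear form over the compact convex set  *)
(* of such joinings yields an ergodic one L with E_L[1_A cos(a(sum) + r)] >=  *)
(* E_lam[1_A cos(a + r)] - delta. By JP(n), under L the first coordinate is   *)
(* independent of all but n of the k coordinates, and those n change the      *)
(* expectation by at most O(n sqrt(1 - |phi_Q(a)|)), which tends to 0 as k    *)
(* grows. Hence E_lam[1_A cos(a + r)] = mu(A) E_P[cos(a + r)] for all A, a    *)
(* and r, i.e. lam is the product of mu and P.                                *)
From HB Require Import structures.
Require Import Defs.
From mathcomp Require Import all_boot all_order all_algebra.
From mathcomp Require Import all_classical all_reals all_analysis.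
From mathcomp Require Import measurable_realfun ring lra complex.

Set Implicit Arguments.
Unset Strict Implicit.
Unset Printing Implicit Defensive.
Import Order.TTheory GRing.Theory Num.Theory.
Import numFieldNormedType.Exports.

Local Open Scope classical_set_scope.
Local Open Scope ring_scope.

(** * Integrals of bounded measurable functions *)

(** An infinitely divisible law is the law of a sum of [k] independent copies of a root [Q], for
    every [k], whereas joining primeness lets the other automorphism depend on at most [n] of these
    copies. Any fixed number of copies has a vanishing influence on the sum as [k] grows, so the
    coordinate in [X] must be independent of the sum itself. Two obstacles separate this from a
    proof.

    First, the JP property concerns weakly mixing automorphisms. The characteristic functional of
    [P] has no zeros ([ID_charfun_neq0]), hence its roots are unique and stationary
    ([charfun_root_unique], [root_stationary]). They are weakly mixing by a bootstrap ([root_wmix]):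
    for a root with [eps = |phi|^-2 - 1], ergodicity of [P] forces the mean square deviation of the
    normalized correlations to be of order [eps^3] ([correlation_bound]), one power better than the
    trivial bound. The l-th convolution power multiplies this by about [l^2], and [eps = O(1/l)], so
    that [O(1/l)] remains for arbitrary [l]. Products and non-zero powers follow
    ([wmix_weakly_mixing], [dprod_ergodic]).

    Second, the JP property concerns ergodic joinings with a product. A joining with [P] is lifted
    to the product of the roots ([joining_lift]) and then replaced by an ergodic joining that does
    not decrease a chosen linear form ([ergodic_joining_above]); extreme points take the place of an
    ergodic decomposition. Both constructions prescribe the values on rectangles and rely on
    [bimeasure_extension]. The bound [partial_independence_estimate] then yields the inequality
    [joining_cos_le] for every phase; shifting the phase by [pi] turns it into an equality, and
    [charfun_unique_weighted] identifies the joining. *)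

Section bounded_measurable.
Context {R : realType}.

(** This class is stable under all the operations used below and integrable for every probability,
    so real-valued integrals can be manipulated with one kind of side condition. *)
Definition bmf d (W : measurableType d) (f : W -> R) : Prop :=
  measurable_fun setT f /\ exists M, forall x, `|f x| <= M.

Section closure.
Context d (W : measurableType d).
Implicit Types f g : W -> R.

Lemma bmfM_pos f : bmf f -> exists2 M, 0 < M & forall x, `|f x| <= M.
Proof.
move=> [_ [M hM]]; exists (Num.max M 1); first by rewrite lt_max ltr01 orbT.
by move=> x; rewrite le_max hM.
Qed.

Lemma bmf_cst (c : R) : bmf (fun _ : W => c).
Proof. by split; [exact: measurable_cst|exists `|c|]. Qed.

Lemma bmfD f g : bmf f -> bmf g -> bmf (fun x => f x + g x).
Proof.
move=> [mf [M hM]] [mg [N hN]]; split; first exact: measurable_funD.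
exists (M + N) => x; rewrite (le_trans (ler_normD _ _))//.
exact: lerD.
Qed.

Lemma bmfN f : bmf f -> bmf (fun x => - f x).
Proof.
move=> [mf [M hM]]; split; first exact: measurableT_comp.
by exists M => x; rewrite normrN.
Qed.

Lemma bmfB f g : bmf f -> bmf g -> bmf (fun x => f x - g x).
Proof. by move=> hf hg; apply: bmfD => //; exact: bmfN. Qed.

Lemma bmfM f g : bmf f -> bmf g -> bmf (fun x => f x * g x).
Proof.
move=> [mf [M hM]] [mg [N hN]]; split; first exact: measurable_funM.
by exists (M * N) => x; rewrite normrM ler_pM.
Qed.

Lemma bmfZ c f : bmf f -> bmf (fun x => c * f x).
Proof. by move=> hf; apply: bmfM => //; exact: bmf_cst. Qed.

Lemma bmfX f n : bmf f -> bmf (fun x => f x ^+ n).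
Proof.
move=> hf; elim: n => [|n ih]; first exact: bmf_cst.
by under eq_fun do rewrite exprS; exact: bmfM.
Qed.

Lemma bmf_norm f : bmf f -> bmf (fun x => `|f x|).
Proof.
move=> [mf [M hM]]; split; first exact: measurableT_comp.
by exists M => x; rewrite normr_id.
Qed.

Lemma bmf_sum (I : Type) (s : seq I) (F : I -> W -> R) :
  (forall i, bmf (F i)) -> bmf (fun x => \sum_(i <- s) F i x).
Proof.
move=> hF; elim: s => [|i s ih].
  by under eq_fun do rewrite big_nil; exact: bmf_cst.
by under eq_fun do rewrite big_cons; exact: bmfD.
Qed.

Lemma bmf_cos f : measurable_fun setT f -> bmf (fun x => cos (f x)).
Proof.
move=> mf; split; last by exists 1 => x; rewrite ler_norml cos_geN1 cos_le1.
by apply: measurableT_comp => //; apply: continuous_measurable_fun;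
  exact: continuous_cos.
Qed.

Lemma bmf_sin f : measurable_fun setT f -> bmf (fun x => sin (f x)).
Proof.
move=> mf; split; last by exists 1 => x; rewrite ler_norml sin_geN1 sin_le1.
by apply: measurableT_comp => //; apply: continuous_measurable_fun;
  exact: continuous_sin.
Qed.

Lemma bmf_indic (A : set W) : measurable A -> bmf (\1_A : W -> R).
Proof.
move=> mA; split; first exact: measurable_indic.
by exists 1 => x; rewrite indicE; case: (_ \in _); rewrite ?normr1// normr0.
Qed.

Lemma bmf_comp d' (V : measurableType d') (h : V -> W) f :
  measurable_fun setT h -> bmf f -> bmf (fun x => f (h x)).
Proof.
by move=> mh [mf [M hM]]; split; [exact: measurableT_comp|exists M].
Qed.

End closure.

Section integral.
Context d (W : measurableType d) (P : probability W R).
Implicit Types f g : W -> R.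

Lemma bmf_integrable f : bmf f -> P.-integrable setT (EFin \o f).
Proof.
move=> [mf [M hM]]; apply: measurable_bounded_integrable => //.
  by rewrite [X in (X < _)%E]probability_setT ltry.
exists M; split; first by rewrite num_real.
by move=> N MN x _; exact: le_trans (hM x) (ltW MN).
Qed.

Lemma eq_Rint f g : (forall x, f x = g x) -> \int[P]_x f x = \int[P]_x g x.
Proof. by move=> fg; apply: eq_Rintegral => x _. Qed.

Lemma Rint_cst (c : R) : \int[P]_x c = c.
Proof.
rewrite (@Rintegral_cst _ _ _ P setT)//.
by rewrite [X in fine X]probability_setT/= mulr1.
Qed.

Lemma RintD f g : bmf f -> bmf g ->
  \int[P]_x (f x + g x) = \int[P]_x f x + \int[P]_x g x.
Proof. by move=> hf hg; apply: RintegralD => //; exact: bmf_integrable. Qed.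

Lemma RintB f g : bmf f -> bmf g ->
  \int[P]_x (f x - g x) = \int[P]_x f x - \int[P]_x g x.
Proof. by move=> hf hg; apply: RintegralB => //; exact: bmf_integrable. Qed.

Lemma RintZ c f : bmf f -> \int[P]_x (c * f x) = c * \int[P]_x f x.
Proof. by move=> hf; apply: RintegralZl => //; exact: bmf_integrable. Qed.

Lemma RintN f : bmf f -> \int[P]_x (- f x) = - \int[P]_x f x.
Proof.
move=> hf; under eq_Rintegral do rewrite -mulN1r.
by rewrite RintZ// mulN1r.
Qed.

Lemma Rint_sum (I : Type) (s : seq I) (F : I -> W -> R) :
  (forall i, bmf (F i)) ->
  \int[P]_x (\sum_(i <- s) F i x) = \sum_(i <- s) \int[P]_x F i x.
Proof.
move=> hF; elim: s => [|i s ih].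
  by under eq_Rintegral do rewrite big_nil; rewrite Rint_cst big_nil.
under eq_Rintegral do rewrite big_cons.
by rewrite RintD// ?big_cons ?ih//; exact: bmf_sum.
Qed.

Lemma le_Rint f g : bmf f -> bmf g -> (forall x, f x <= g x) ->
  \int[P]_x f x <= \int[P]_x g x.
Proof. by move=> hf hg fg; apply: le_Rintegral => //; exact: bmf_integrable. Qed.

Lemma Rint_ge0 f : (forall x, 0 <= f x) -> 0 <= \int[P]_x f x.
Proof. by move=> f0; apply: Rintegral_ge0. Qed.

Lemma norm_Rint f : bmf f -> `|\int[P]_x f x| <= \int[P]_x `|f x|.
Proof. by move=> hf; apply: le_normr_Rintegral => //; exact: bmf_integrable. Qed.

Lemma Rint_indic A : measurable A -> \int[P]_x \1_A x = fine (P A).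
Proof. by move=> mA; rewrite /Rintegral integral_indic// setIT. Qed.

Lemma bmf_le1 f M : bmf f -> (forall x, `|f x| <= M) -> `|\int[P]_x f x| <= M.
Proof.
move=> hf hM; rewrite (le_trans (norm_Rint hf))//.
rewrite -[leRHS]Rint_cst; apply: le_Rint => //; [exact: bmf_norm|exact: bmf_cst].
Qed.

Lemma Rint_bcvg (F : nat -> W -> R) f M :
  (forall n, measurable_fun setT (F n)) -> (forall n x, `|F n x| <= M) ->
  measurable_fun setT f ->
  {ae P, forall x, F ^~ x @ \oo --> f x} ->
  \int[P]_x F n x @[n --> \oo] --> \int[P]_x f x.
Proof.
move=> mF hM mf Ff.
have iM : P.-integrable setT (EFin \o (fun _ : W => M)).
  exact/bmf_integrable/bmf_cst.
have [] := @dominated_convergence _ W R P setT measurableT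
  (fun n => EFin \o F n) (EFin \o f) (EFin \o fun=> M) _ _ _ iM.
- by move=> n; exact/measurable_EFinP.
- exact/measurable_EFinP.
- by apply: filterS Ff => x Fx _; apply: cvg_EFin => //; exact: nearW.
- by apply/aeW => x n _ /=; rewrite lee_fin.
move=> intf _ h.
rewrite /Rintegral; apply: fine_cvg.
rewrite fineK; first exact: h.
exact: integrable_fin_num.
Qed.

Lemma Rint_ae f g : measurable_fun setT f -> measurable_fun setT g ->
  {ae P, forall x, f x = g x} -> \int[P]_x f x = \int[P]_x g x.
Proof.
move=> mf mg fg; congr fine; apply: ae_eq_integral => //.
- exact/measurable_EFinP.
- exact/measurable_EFinP.
- by apply: filterS fg => x + _ => ->.
Qed.

Lemma Rint_eq0_ae f : bmf f -> (forall x, 0 <= f x) -> \int[P]_x f x = 0 ->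
  {ae P, forall x, f x = 0}.
Proof.
move=> hf f0 h.
have mf : measurable_fun setT (EFin \o f) by apply/measurable_EFinP; case: hf.
have := @ae_eq_integral_abs _ _ R P setT measurableT (EFin \o f) mf.
have -> : (\int[P]_x `|(EFin \o f) x| = 0)%E.
  under eq_integral do rewrite /= ger0_norm//.
  rewrite -[LHS]fineK; first by congr (_%:E).
  by apply: integrable_fin_num => //; exact: bmf_integrable.
move=> [+ _] => /(_ erefl); apply: filterS => x /(_ I) /= [].
by [].
Qed.

Lemma Rint_CS f g : bmf f -> bmf g ->
  (\int[P]_x (f x * g x)) ^+ 2 <= \int[P]_x (f x ^+ 2) * \int[P]_x (g x ^+ 2).
Proof.
move=> hf hg.
set a := \int[P]_x (f x ^+ 2); set b := \int[P]_x (f x * g x).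
set c := \int[P]_x (g x ^+ 2).
have hff := bmfX 2 hf; have hgg := bmfX 2 hg; have hfg := bmfM hf hg.
have key s t : 0 <= s ^+ 2 * a + 2 * s * t * b + t ^+ 2 * c.
  have : 0 <= \int[P]_x ((s * f x + t * g x) ^+ 2).
    by apply: Rint_ge0 => x; exact: sqr_ge0.
  rewrite (@eq_Rint _ (fun x => s ^+ 2 * f x ^+ 2 +
    2 * s * t * (f x * g x) + t ^+ 2 * g x ^+ 2)); last by move=> x; ring.
  rewrite RintD ?RintD ?RintZ//; try exact: bmfZ.
  by apply: bmfD; exact: bmfZ.
have c0 : 0 <= c by apply: Rint_ge0 => x; exact: sqr_ge0.
have a0 : 0 <= a by apply: Rint_ge0 => x; exact: sqr_ge0.
have [c00|cn0] := eqVneq c 0.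
  have [->|bn0] := eqVneq b 0; first by rewrite expr0n/= mulr_ge0.
  (* For [c = 0] the quadratic form is affine in [t]; this value of [t] makes it equal to -1. *)
  have := key 1 (- (a + 1) / (2 * b)).
  rewrite c00 (_ : _ + _ + _ = -1); first by rewrite oppr_ge0 ler10.
  by field.
have := key c (- b).
rewrite (_ : _ + _ + _ = c * (a * c - b ^+ 2)); last by ring.
by rewrite pmulr_rge0 ?subr_ge0// lt_neqAle eq_sym cn0.
Qed.

Lemma Rint_sqr_le f : bmf f -> (\int[P]_x f x) ^+ 2 <= \int[P]_x (f x ^+ 2).
Proof.
move=> hf; have := Rint_CS hf (bmf_cst W 1).
by under eq_Rintegral do rewrite mulr1; rewrite expr1n Rint_cst mulr1.
Qed.

End integral.

Lemma eq_meas_Rint d (W : measurableType d) (P Q : probability W R) (f : W -> R) :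
  eq_meas P Q -> \int[P]_x f x = \int[Q]_x f x.
Proof.
by move=> PQ; congr fine; apply: eq_measure_integral => A mA _; exact: PQ.
Qed.

Lemma Rint_distribution d d' (W : measurableType d) (V : measurableType d')
  (P : probability W R) (h : {mfun W >-> V}) (f : V -> R) : bmf f ->
  \int[distribution P h]_x f x = \int[P]_x f (h x).
Proof.
move=> hf; congr fine; rewrite integral_distribution//.
- by apply/measurable_EFinP; case: hf.
- apply: (@bmf_integrable _ _ P (fun x => f (h x))).
  apply: bmf_comp hf; exact: measurable_funPT.
Qed.

Lemma Rint_pushforward d d' (W : measurableType d) (V : measurableType d')
  (P : probability W R) (Q : probability V R) (h : W -> V) (f : V -> R) :
  measurable_fun setT h -> eq_meas (pushforward P h) Q -> bmf f ->
  \int[P]_x f (h x) = \int[Q]_x f x.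
Proof.
move=> mh hPQ hf.
pose H : {mfun W >-> V} := HB.pack h (isMeasurableFun.Build _ _ _ _ h mh).
rewrite -(@Rint_distribution _ _ _ _ P H)//; apply: eq_meas_Rint.
exact: hPQ.
Qed.

Section product.
Context d d' (W : measurableType d) (V : measurableType d').
Context (P : probability W R) (Q : probability V R).

Lemma bmf_Rint2 (f : W * V -> R) : bmf f -> bmf (fun x => \int[Q]_y f (x, y)).
Proof.
move=> hf; have [mf [M hM]] := hf; split; last first.
  exists M => x; apply: bmf_le1 => // .
  by apply: bmf_comp hf; exact: pair1_measurable.
have := @measurable_fubini_F _ _ W V R P Q (EFin \o f).
move=> /(_ (@bmf_integrable _ _ (P \x Q)%E _ hf)) h.
have := measurableT_comp (@fine_measurable R setT measurableT) h.
exact.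
Qed.

Lemma Rint_fubini (f : W * V -> R) : bmf f ->
  \int[(P \x Q)%E]_z f z = \int[P]_x \int[Q]_y f (x, y).
Proof.
move=> hf; rewrite /Rintegral.
rewrite -integral12_prod_meas1; last exact: (@bmf_integrable _ _ (P \x Q)%E _ hf).
congr fine; apply: eq_integral => x _ /=; rewrite fineK//.
apply: integrable_fin_num => //.
apply: (@bmf_integrable _ _ Q (fun y => f (x, y))).
by apply: bmf_comp hf; exact: pair1_measurable.
Qed.

Lemma Rint_prodM (f : W -> R) (g : V -> R) : bmf f -> bmf g ->
  \int[(P \x Q)%E]_z (f z.1 * g z.2) = \int[P]_x f x * \int[Q]_y g y.
Proof.
move=> hf hg; rewrite Rint_fubini/=; last first.
  by apply: bmfM; [apply: bmf_comp hf|apply: bmf_comp hg].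
under eq_Rintegral do rewrite RintZ// mulrC.
by rewrite RintZ// mulrC.
Qed.

End product.

End bounded_measurable.

(** * Uniqueness of characteristic functionals *)

Section sign_approximation.
Context {R : realType}.
Implicit Types s x : R.

Lemma bernoulli_ineq (x : R) n : -1 <= x -> 1 + x *+ n <= (1 + x) ^+ n.
Proof.
move=> x1; elim: n => [|n ih]; first by rewrite mulr0n addr0 expr0.
rewrite exprS (le_trans _ (ler_wpM2l _ ih))//; last by rewrite -lerBlDl sub0r.
rewrite mulrS mulrDl mul1r mulrDr mulr1 -!addrA lerD2l addrCA lerD2l lerDl.
by rewrite mulrnAr mulrn_wge0// -expr2 sqr_ge0.
Qed.

(** Polynomials bounded by 1 on [-1, 1] that approach the indicator of [s > 0] away from 0: with
    [v = ((1 + s) / 2)^n], the product of [v] and the exponent [2^n] is [(1 + s)^n], which tends to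
    0 or to infinity according to the sign of [s]. *)
Definition sgn_poly n (s : R) : R := 1 - (1 - ((1 + s) / 2) ^+ n) ^+ (2 ^ n).

Lemma sgn_poly_bounded n s : -1 <= s <= 1 -> `|sgn_poly n s| <= 1.
Proof.
move=> /andP[s0 s1]; rewrite /sgn_poly.
have u0 : 0 <= (1 + s) / 2 by lra.
have u1 : (1 + s) / 2 <= 1 by lra.
have v0 : 0 <= ((1 + s) / 2) ^+ n by rewrite exprn_ge0.
have v1 : ((1 + s) / 2) ^+ n <= 1 by rewrite exprn_ile1.
have w0 : 0 <= (1 - ((1 + s) / 2) ^+ n) ^+ (2 ^ n) by rewrite exprn_ge0// subr_ge0.
have w1 : (1 - ((1 + s) / 2) ^+ n) ^+ (2 ^ n) <= 1.
  by rewrite exprn_ile1// ?subr_ge0// gerBl.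
by rewrite ler_norml; apply/andP; split; lra.
Qed.

Lemma sgn_poly_cvg_neg s : -1 <= s < 0 -> sgn_poly n s @[n --> \oo] --> (0 : R).
Proof.
move=> /andP[s1 s0]; have h : (1 + s) ^+ n @[n --> \oo] --> (0 : R).
  by apply: cvg_expr; rewrite ger0_norm; lra.
apply: squeeze_cvgr (cvg_cst 0) h; apply: nearW => n; rewrite /sgn_poly.
have u0 : 0 <= (1 + s) / 2 by lra.
have u1 : (1 + s) / 2 <= 1 by lra.
have v1 : ((1 + s) / 2) ^+ n <= 1 by rewrite exprn_ile1.
have v0 : 0 <= ((1 + s) / 2) ^+ n by rewrite exprn_ge0.
apply/andP; split.
  by rewrite subr_ge0 exprn_ile1// ?subr_ge0// gerBl.
rewrite lerBlDr addrC -lerBlDr.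
have := @bernoulli_ineq (- ((1 + s) / 2) ^+ n) (2 ^ n).
rewrite lerN2 => /(_ v1); apply: le_trans.
rewrite lerD2l mulNrn lerN2 -(mulr_natr (_ ^+ _)) natrX expr_div_n.
by rewrite divfK// expf_neq0.
Qed.

(** Since [(1 - v)(1 + v) <= 1], the error [(1 - v)^(2^n)] is at most the inverse of
    [(1 + v)^(2^n)], which Bernoulli bounds below by [(1 + s)^n]. *)
Lemma sgn_poly_cvg_pos s : 0 < s <= 1 -> sgn_poly n s @[n --> \oo] --> (1 : R).
Proof.
move=> /andP[s0 s1].
have h : 1 - ((1 + s)^-1) ^+ n @[n --> \oo] --> (1 : R).
  rewrite -[X in _ --> X]subr0; apply: cvgB; first exact: cvg_cst.
  apply: cvg_expr; rewrite ger0_norm ?invr_ge0; last lra.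
  by rewrite invf_lt1; lra.
apply: (squeeze_cvgr _ h (cvg_cst _)).
apply: nearW => n; rewrite /sgn_poly.
have u0 : 0 <= (1 + s) / 2 by lra.
have u1 : (1 + s) / 2 <= 1 by lra.
have v1 : ((1 + s) / 2) ^+ n <= 1 by rewrite exprn_ile1.
have v0 : 0 <= ((1 + s) / 2) ^+ n by rewrite exprn_ge0.
set v := ((1 + s) / 2) ^+ n in v0 v1 *.
apply/andP; split; last by rewrite gerBl exprn_ge0// subr_ge0.
rewrite lerD2l lerN2 exprVn -[X in _ <= X]mulr1.
rewrite ler_pdivlMl ?exprn_gt0//; last lra.
have e1 : (1 + s) ^+ n <= (1 + v) ^+ (2 ^ n).
  apply: le_trans (@bernoulli_ineq v (2 ^ n) _); last lra.
  by rewrite -(mulr_natr v) natrX /v expr_div_n divfK ?expf_neq0// lerDr.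
have w0 : 0 <= (1 - v) ^+ (2 ^ n) by rewrite exprn_ge0// subr_ge0.
rewrite (le_trans (ler_wpM2r w0 e1))// -exprMn exprn_ile1//.
  by rewrite mulr_ge0; lra.
by nra.
Qed.

End sign_approximation.

Section charfun_unique.
Context {R : realType} d (W : measurableType d).
Context d1 (O1 : measurableType d1) (m1 : probability O1 R) (h1 : O1 -> R)
  (p1 : O1 -> W).
Context d2 (O2 : measurableType d2) (m2 : probability O2 R) (h2 : O2 -> R)
  (p2 : O2 -> W).
Hypotheses (bh1 : bmf h1) (bh2 : bmf h2)
  (mp1 : measurable_fun setT p1) (mp2 : measurable_fun setT p2).
Variable L : set (W -> R).
Hypotheses (L0 : L (fun=> 0)) (LD : forall a b, L a -> L b -> L (fun x => a x + b x))
  (LZ : forall c a, L a -> L (fun x => c * a x))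
  (Lm : forall a, L a -> measurable_fun setT a).
Hypothesis L_gen : measurable `<=`
  <<s [set A | exists (a : W -> R) (B : set R), [/\ L a, measurable B &
        A = a @^-1` B]] >>.
Hypothesis same_cos : forall a r, L a ->
  \int[m1]_x (h1 x * cos (a (p1 x) + r)) =
  \int[m2]_x (h2 x * cos (a (p2 x) + r)).

Let same (f : W -> R) : Prop :=
  \int[m1]_x (h1 x * f (p1 x)) = \int[m2]_x (h2 x * f (p2 x)).

Let bmf1 f : bmf f -> bmf (fun x => h1 x * f (p1 x)).
Proof. by move=> bf; apply: bmfM => //; exact: bmf_comp bf. Qed.

Let bmf2 f : bmf f -> bmf (fun x => h2 x * f (p2 x)).
Proof. by move=> bf; apply: bmfM => //; exact: bmf_comp bf. Qed.

Let sameD f g : bmf f -> bmf g -> same f -> same g -> same (fun x => f x + g x).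
Proof.
move=> bf bg ff gg; rewrite /same.
rewrite (@eq_Rint _ _ _ m1 _ (fun x => h1 x * f (p1 x) + h1 x * g (p1 x))); last first.
  by move=> x; rewrite mulrDr.
rewrite (@eq_Rint _ _ _ m2 _ (fun x => h2 x * f (p2 x) + h2 x * g (p2 x))); last first.
  by move=> x; rewrite mulrDr.
by rewrite !RintD; [rewrite ff gg|exact: bmf2|exact: bmf2|exact: bmf1|exact: bmf1].
Qed.

Let sameZ c f : bmf f -> same f -> same (fun x => c * f x).
Proof.
move=> bf ff; rewrite /same.
rewrite (@eq_Rint _ _ _ m1 _ (fun x => c * (h1 x * f (p1 x)))); last first.
  by move=> x; rewrite mulrCA.
rewrite (@eq_Rint _ _ _ m2 _ (fun x => c * (h2 x * f (p2 x)))); last first.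
  by move=> x; rewrite mulrCA.
by rewrite !RintZ; [rewrite ff|exact: bmf2|exact: bmf1].
Qed.

Let same_lim (F : nat -> W -> R) f (M : R) : (forall n, bmf (F n)) ->
  (forall n x, `|F n x| <= M) -> bmf f -> (forall x, F ^~ x @ \oo --> f x) ->
  (forall n, same (F n)) -> same f.
Proof.
move=> bF FM bf Ff sF.
have [N1 N1_0 hN1] := bmfM_pos bh1; have [N2 N2_0 hN2] := bmfM_pos bh2.
have c1 : \int[m1]_x (h1 x * F n (p1 x)) @[n --> \oo] -->
          \int[m1]_x (h1 x * f (p1 x)).
  apply: (@Rint_bcvg _ _ _ _ _ _ (N1 * M)).
  - by move=> n; case: (bmf1 (bF n)).
  - by move=> n x; rewrite normrM ler_pM.
  - by case: (bmf1 bf).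
  - by apply: aeW => x; apply: cvgM; [exact: cvg_cst|exact: Ff].
have c2 : \int[m2]_x (h2 x * F n (p2 x)) @[n --> \oo] -->
          \int[m2]_x (h2 x * f (p2 x)).
  apply: (@Rint_bcvg _ _ _ _ _ _ (N2 * M)).
  - by move=> n; case: (bmf2 (bF n)).
  - by move=> n x; rewrite normrM ler_pM.
  - by case: (bmf2 bf).
  - by apply: aeW => x; apply: cvgM; [exact: cvg_cst|exact: Ff].
rewrite (_ : (fun n => _) = fun n => \int[m2]_x (h2 x * F n (p2 x))) in c1.
  exact: (cvg_unique _ c1 c2).
by apply/funext => n; exact: sF.
Qed.

(* The bounded test functions h against which the two weighted laws agree,    *)
(* even after multiplication by any trigonometric function.                   *)
Let H (h : W -> R) : Prop :=
  bmf h /\ forall a r, L a -> same (fun x => h x * cos (a x + r)).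

Let bmf_cosL a r : L a -> bmf (fun x => cos (a x + r)).
Proof.
by move=> La; apply: bmf_cos; apply: measurable_funD => //; exact: Lm.
Qed.

(** Multipliers of [H] form an algebra closed under bounded pointwise limits, so indicators can be
    reached from cosines without a density theorem. *)
Let mult (f : W -> R) : Prop := bmf f /\ forall h, H h -> H (fun x => h x * f x).

Let mult_cst c : mult (fun=> c).
Proof.
split; first exact: bmf_cst; move=> h [bh hh]; split.
  by apply: bmfM => //; exact: bmf_cst.
move=> a r La; rewrite (_ : (fun _ => _) = fun x => c * (h x * cos (a x + r))).
  by apply: sameZ; [apply: bmfM => //; exact: bmf_cosL|exact: hh].
by apply/funext => x; rewrite mulrAC mulrC.
Qed.

Let multM f g : mult f -> mult g -> mult (fun x => f x * g x).
Proof.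
move=> [bf hf] [bg hg]; split; first exact: bmfM.
move=> h Hh; rewrite (_ : (fun _ => _) = fun x => h x * f x * g x).
  exact/hg/hf.
by apply/funext => x; rewrite mulrA.
Qed.

Let multD f g : mult f -> mult g -> mult (fun x => f x + g x).
Proof.
move=> [bf hf] [bg hg]; split; first exact: bmfD.
move=> h Hh; have [bhf hhf] := hf h Hh; have [bhg hhg] := hg h Hh.
rewrite (_ : (fun _ => _) = fun x => h x * f x + h x * g x); last first.
  by apply/funext => x; rewrite mulrDr.
split; first exact: bmfD.
move=> a r La.
rewrite (_ : (fun _ => _) = fun x => h x * f x * cos (a x + r) +
                             h x * g x * cos (a x + r)); last first.
  by apply/funext => x; rewrite mulrDl.
by apply: sameD; [apply: bmfM => //; exact: bmf_cosL|
  apply: bmfM => //; exact: bmf_cosL|exact: hhf|exact: hhg].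
Qed.

Let multN f : mult f -> mult (fun x => - f x).
Proof.
move=> mf; rewrite (_ : (fun _ => _) = fun x => -1 * f x).
  exact: (multM (mult_cst _)).
by apply/funext => x; rewrite mulN1r.
Qed.

Let multX f n : mult f -> mult (fun x => f x ^+ n).
Proof.
move=> mf; elim: n => [|n ih]; first exact: mult_cst.
by rewrite (_ : (fun _ => _) = fun x => f x * f x ^+ n);
  [exact: multM|apply/funext => x; rewrite exprS].
Qed.

Let mult_lim (F : nat -> W -> R) f (M : R) : (forall n, mult (F n)) ->
  (forall n x, `|F n x| <= M) -> bmf f -> (forall x, F ^~ x @ \oo --> f x) ->
  mult f.
Proof.
move=> mF FM bf Ff; split=> // h Hh; have [bh hh] := Hh.
split; first exact: bmfM.
move=> a r La; have [N N0 hN] := bmfM_pos bh.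
apply: (@same_lim (fun n x => h x * F n x * cos (a x + r)) _ (N * M * 1)).
- move=> n; apply: bmfM; last exact: bmf_cosL.
  by apply: bmfM => //; case: (mF n).
- by move=> n x; rewrite !normrM !ler_pM ?mulr_ge0//; exact: cos_max.
- by apply: bmfM; [exact: bmfM|exact: bmf_cosL].
- move=> x; apply: cvgM; last exact: cvg_cst.
  by apply: cvgM; [exact: cvg_cst|exact: Ff].
- by move=> n; have [_ hF] := mF n; case: (hF h Hh) => _; exact.
Qed.

(** A product of two cosines is half the sum of the cosines of the sum and of the difference, whose
    linear parts stay in [L]. *)
Let mult_cos b r : L b -> mult (fun x => cos (b x + r)).
Proof.
move=> Lb; split; first exact: bmf_cosL.
move=> h [bh hh]; split; first by apply: bmfM => //; exact: bmf_cosL.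
move=> a q La.
have Ls : L (fun x => a x + b x) by exact: LD.
have Ld : L (fun x => a x + -1 * b x) by apply: LD => //; exact: LZ.
rewrite (_ : (fun _ => _) =
  fun x => 2^-1 * (h x * cos ((a x + b x) + (q + r))) +
           2^-1 * (h x * cos ((a x + -1 * b x) + (q - r)))); last first.
  apply/funext => x.
  rewrite (_ : a x + b x + (q + r) = (a x + q) + (b x + r)); last by ring.
  rewrite (_ : a x + -1 * b x + (q - r) = (a x + q) - (b x + r)); last by ring.
  by move: (a x + q) (b x + r) => u v; rewrite cosD cosB; field.
have bs : bmf (fun x => h x * cos ((a x + b x) + (q + r))).
  by apply: bmfM => //; exact: bmf_cosL Ls.
have bd : bmf (fun x => h x * cos ((a x + -1 * b x) + (q - r))).
  by apply: bmfM => //; exact: bmf_cosL Ld.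
apply: sameD; [exact: bmfZ|exact: bmfZ| |].
- by apply: sameZ => //; exact: hh Ls.
- by apply: sameZ => //; exact: hh Ld.
Qed.

Let bmf_ind_gt (b : W -> R) (c : R) : measurable_fun setT b ->
  bmf (fun x => (c < b x)%R%:R : R).
Proof.
move=> mb; rewrite (_ : (fun _ => _) = \1_(b @^-1` `]c, +oo[)).
  by apply: bmf_indic; rewrite -[X in measurable X]setTI; exact: mb.
apply/funext => x; rewrite indicE; congr (_%:R : R).
by congr nat_of_bool; apply/idP/idP; rewrite inE/= in_itv/= andbT.
Qed.

Let mult_gt0 f : mult f -> (forall x, `|f x| <= 1) ->
  mult (fun x => (0 < f x)%R%:R).
Proof.
move=> mf f1.
have fi x : -1 <= f x <= 1 by rewrite -ler_norml.
(* [sgn_poly n] does not tend to 0 at 0; the second factor vanishes exactly where [f] does and tends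
   to 1 elsewhere. *)
pose G n x := sgn_poly n (f x) * (1 - (1 - f x ^+ 2) ^+ n).
apply: (@mult_lim G _ 1).
- move=> n; apply: multM.
    apply: multD; first exact: mult_cst.
    apply: multN; apply: multX; apply: multD; first exact: mult_cst.
    apply: multN; apply: multX; apply: multM; last exact: mult_cst.
    by apply: multD => //; exact: mult_cst.
  apply: multD; first exact: mult_cst.
  apply: multN; apply: multX; apply: multD; first exact: mult_cst.
  exact/multN/multX.
- move=> n x; rewrite normrM -[X in _ <= X]mulr1 ler_pM ?sgn_poly_bounded//.
  have q1 : f x ^+ 2 <= 1 by rewrite -real_normK ?num_real// exprn_ile1.
  have q0 := sqr_ge0 (f x).
  have w0 : 0 <= (1 - f x ^+ 2) ^+ n by rewrite exprn_ge0// subr_ge0.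
  have w1 : (1 - f x ^+ 2) ^+ n <= 1 by rewrite exprn_ile1// ?subr_ge0// gerBl.
  by rewrite ler_norml; apply/andP; split; lra.
- by apply: bmf_ind_gt; case: mf => -[].
- move=> x; rewrite /G.
  have z : f x != 0 -> 1 - (1 - f x ^+ 2) ^+ n @[n --> \oo] --> (1 : R).
    move=> fx0; rewrite -[X in _ --> X]subr0; apply: cvgB; first exact: cvg_cst.
    have q1 : f x ^+ 2 <= 1 by rewrite -real_normK ?num_real// exprn_ile1.
    have q0 : 0 < f x ^+ 2 by rewrite exprn_even_gt0.
    by apply: cvg_expr; rewrite ger0_norm; lra.
  have [x0|x0|x0] := ltgtP (f x) 0.
  + rewrite -[X in _ --> X](mul0r 1); apply: cvgM; last by apply: z; rewrite lt_eqF.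
    by apply: sgn_poly_cvg_neg; have /andP[-> _] := fi x.
  + rewrite -[X in _ --> X](mul1r 1); apply: cvgM; last by apply: z; rewrite gt_eqF.
    by apply: sgn_poly_cvg_pos; rewrite x0; have /andP[] := fi x.
  + rewrite x0 expr0n/= subr0.
    under eq_fun do rewrite expr1n subrr mulr0.
    exact: cvg_cst.
Qed.

(** The sine of [(b - c) / (n + 1)] has the sign of [b - c] as soon as its argument is below [pi] in
    absolute value, and a sine is a cosine with a shifted phase. *)
Let mult_gt b c : L b -> mult (fun x => (c < b x)%R%:R).
Proof.
move=> Lb.
apply: (@mult_lim (fun n x => (0 < sin ((b x - c) / n.+1%:R))%R%:R) _ 1).
- move=> n; rewrite (_ : (fun _ => _) =
    fun x => (0 < cos (n.+1%:R^-1 * b x + (- c / n.+1%:R - pi / 2)))%R%:R).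
    apply: mult_gt0; last by move=> x; exact: cos_max.
    exact/mult_cos/LZ.
  apply/funext => x; rewrite addrA cosBpihalf; congr (_ < sin _)%R%:R.
  by rewrite mulrBl mulNr mulrC.
- by move=> n x; case: (_ < _); rewrite ?normr1 ?normr0.
- exact/bmf_ind_gt/Lm.
- move=> x; set t := b x - c.
  rewrite (_ : c < b x = (0 < t)); last by rewrite subr_gt0.
  apply: cvg_near_cst; near=> n.
  have n0 : 0 < n.+1%:R :> R by rewrite ltr0n.
  have tn : `|t| / n.+1%:R < pi.
    rewrite ltr_pdivrMr//; rewrite (@lt_le_trans _ _ (n.+1%:R))//; last first.
      by rewrite ler_peMl//; have := @pi_ge2 R; lra.
    rewrite (@lt_trans _ _ n%:R) ?ltr_nat//.
    near: n; exact: nbhs_infty_gtr.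
  have [t0|t0|->] := ltgtP t 0.
  + have sn : 0 < sin (- (t / n.+1%:R)).
      rewrite sin_gt0_pi// oppr_gt0 pmulr_llt0 ?invr_gt0// t0/=.
      by move: tn; rewrite ltr0_norm// mulNr.
    by move: sn; rewrite sinN oppr_gt0 => /ltW; rewrite leNgt => /negbTE ->.
  + rewrite sin_gt0_pi// divr_gt0//=.
    by move: tn; rewrite gtr0_norm.
  + by rewrite mul0r sin0 ltxx.
Unshelve. all: by end_near. Qed.

Let mset : set (set W) := [set A | mult (\1_A : W -> R)].

(** Complements and finite intersections come from the algebra structure, countable unions from
    bounded pointwise limits. *)
Let mset_sigma : sigma_algebra setT mset.
Proof.
have msetC A : mset A -> mset (~` A).
  rewrite /mset/= => mA; rewrite (_ : \1_(~` A) = fun x => 1 - \1_A x).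
    by apply: multD; [exact: mult_cst|exact: multN].
  by apply/funext => x; rewrite !indicE in_setC; case: (_ \in A); rewrite ?subrr ?subr0.
split.
- rewrite /mset/= indic0; exact: mult_cst.
- by move=> A mA; rewrite setTD; exact: msetC.
- move=> F mF.
  have mfin n : mset (\bigcup_(i < n) F i).
    elim: n => [|n ih].
      by rewrite bigcup_mkord big_ord0 /mset/= indic0; exact: mult_cst.
    rewrite bigcup_mkord big_ord_recr/= -bigcup_mkord.
    move: ih; set B := \bigcup_(i < n) F i => mB.
    rewrite -(setCK (B `|` _)); apply: (msetC); rewrite setCU.
    rewrite /mset/= indicI; apply: multM; exact: msetC.
  apply: (@mult_lim (fun n => \1_(\bigcup_(i < n) F i)) _ 1) => //.
  + by move=> n x; rewrite indicE; case: (_ \in _); rewrite ?normr1// normr0.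
  + apply: bmf_indic; apply: bigcup_measurable => k _.
    have [[m _] _] := mF k.
    have := m measurableT [set 1]; rewrite setTI => /(_ (measurable_set1 _)).
    rewrite (_ : _ @^-1` _ = F k)//; apply/seteqP; split => x /=; rewrite indicE.
      by case: (boolP (x \in F k)) => [|_ /esym/eqP]; [rewrite inE|rewrite oner_eq0].
    by move=> xF; rewrite mem_set.
  + move=> x; have [[k _ Fkx]|nF] := pselect ((\bigcup_i F i) x).
      apply: cvg_near_cst; near=> n.
      rewrite !indicE !mem_set//; first by exists k.
      by exists k => //=; near: n; exact: nbhs_infty_gt.
    apply: cvg_near_cst; near=> n; rewrite !indicE !memNset//.
    by apply: contra_not nF => -[k _ Fkx]; exists k.
Unshelve. all: by end_near. Qed.

(** Uniqueness of Fourier transforms for the weighted laws [h1 m1] and [h2 m2] carried to [W]. The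
    sets with multiplier indicators form a sigma-algebra containing the half-spaces of [L], hence
    everything measurable; the constant 1 is in [H] by [same_cos], and the functional 0 with phase 0
    gives the conclusion. The weights serve to treat restrictions of a measure to an event. *)
Lemma charfun_unique_weighted (A : set W) : measurable A ->
  \int[m1]_x (h1 x * \1_A (p1 x)) = \int[m2]_x (h2 x * \1_A (p2 x)).
Proof.
move=> mA.
have : mset A.
  move: A mA; apply: subset_trans L_gen _.
  apply: smallest_sub; first exact: mset_sigma.
  move=> _ [a [B [La mB ->]]]; move: B mB.
  pose K : set (set R) := [set B | mset (a @^-1` B)].
  suff : (@RGenOInfty.G R).-sigma.-measurable `<=` K.
    by rewrite -RGenOInfty.measurableE; exact.
  apply: smallest_sub.
    have [s0 sD sU] := mset_sigma; split.
    + by rewrite /K/= preimage_set0.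
    + move=> B KB; rewrite /K/= setTD preimage_setC -setTD; exact: sD.
    + by move=> F KF; rewrite /K/= preimage_bigcup; exact: sU.
  move=> _ [c ->]; rewrite /K /mset/=.
  rewrite (_ : \1__ = fun x => (c < a x)%R%:R); first exact: mult_gt.
  apply/funext => x; rewrite indicE; congr (_%:R : R).
  by congr nat_of_bool; apply/idP/idP; rewrite inE/= in_itv/= andbT.
move=> [bA] /(_ (fun=> 1)) [].
  split; first exact: bmf_cst.
  move=> a r La; rewrite /same; under eq_Rint do rewrite mul1r.
  by under [RHS]eq_Rint do rewrite mul1r; exact: same_cos.
move=> _ /(_ _ 0 L0); rewrite /same.
by under eq_Rint do rewrite addr0 cos0 mulr1 mul1r;
  under [RHS]eq_Rint do rewrite addr0 cos0 mulr1 mul1r.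
Qed.

End charfun_unique.

(** * Birkhoff limits *)

Section limsup.
Context {R : realType}.
Implicit Types (u v : nat -> R) (M : R).

Let bounded_seq u M : (forall n, `|u n| <= M) -> bounded_fun u.
Proof.
move=> uM; exists M; split; first by rewrite num_real.
by move=> N MN x _; exact: le_trans (uM x) (ltW MN).
Qed.

Lemma limn_sup_freq u M : (forall n, `|u n| <= M) ->
  forall (e : R) N, 0 < e -> exists2 n, (N <= n)%N & limn_sup u - e < u n.
Proof.
move=> uM e N e0; have bu := bounded_seq uM.
have [lb ub] := (bounded_fun_has_lbound bu, bounded_fun_has_ubound bu).
have h : limn_sup u - e < sups u N.
  rewrite limn_supE// ltrBlDr; apply: le_lt_trans (_ : _ <= sups u N) _.
    apply: ge_inf; last by exists N.
    by apply: bounded_fun_has_lbound_sups.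
  by rewrite ltrDl.
have [|_ [n /= Nn <-] hn] := sup_gt _ h; first by exists (u N), N => /=.
by exists n.
Qed.

Lemma limn_sup_eventually u M : (forall n, `|u n| <= M) ->
  forall e : R, 0 < e -> exists N, forall n, (N <= n)%N -> u n < limn_sup u + e.
Proof.
move=> uM e e0; have bu := bounded_seq uM.
have [lb ub] := (bounded_fun_has_lbound bu, bounded_fun_has_ubound bu).
have hi : has_inf (range (sups u)).
  by split; [exists (sups u 0), 0%N|exact: bounded_fun_has_lbound_sups].
have [_ [N _ <-] hN] := inf_adherent e0 hi.
exists N => n Nn; rewrite limn_supE//; apply: le_lt_trans hN.
by apply: ub_le_sup; [exact: has_ubound_sdrop|exists n].
Qed.

Lemma limn_sup_le u v M : (forall n, `|u n| <= M) -> (forall n, `|v n| <= M) ->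
  u n - v n @[n --> \oo] --> 0 -> limn_sup u <= limn_sup v.
Proof.
move=> uM vM uv; rewrite leNgt; apply/negP => lt_vu.
pose e := (limn_sup u - limn_sup v) / 3.
have e0 : 0 < e by rewrite /e; lra.
have [N1 hN1] := limn_sup_eventually vM e0.
have /cvgr0Pnorm_lt/(_ e e0)[N2 _ hN2] := uv.
have [n Nn hn] := limn_sup_freq uM (maxn N1 N2) e0.
have := hN1 n (leq_trans (leq_maxl _ _) Nn).
have := hN2 n (leq_trans (leq_maxr _ _) Nn).
rewrite ltr_norml => /andP[_]; rewrite /e in hn *; lra.
Qed.

Lemma limn_sup_bounded u M : (forall n, `|u n| <= M) -> `|limn_sup u| <= M.
Proof.
move=> uM; rewrite ler_norml; apply/andP; split; rewrite leNgt; apply/negP => h.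
  have e0 : 0 < - M - limn_sup u by lra.
  have [N /(_ N (leqnn N))] := limn_sup_eventually uM e0.
  by have := uM N; rewrite ler_norml => /andP[+ _]; lra.
have e0 : 0 < limn_sup u - M by lra.
have [n _] := limn_sup_freq uM 0 e0.
by have := uM n; rewrite ler_norml => /andP[_ +]; lra.
Qed.

Lemma limn_sup_cvg u M : (forall n, `|u n| <= M) ->
  limn_sup u + limn_sup (fun n => - u n) <= 0 -> u n @[n --> \oo] --> limn_sup u.
Proof.
move=> uM h; have uM' n : `|- u n| <= M by rewrite normrN.
apply/cvgrPdist_lt => e e0.
have [N1 hN1] := limn_sup_eventually uM e0.
have [N2 hN2] := limn_sup_eventually uM' e0.
exists (maxn N1 N2) => // n /= Nn; rewrite ltr_norml.
have := hN1 n (leq_trans (leq_maxl _ _) Nn).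
have := hN2 n (leq_trans (leq_maxr _ _) Nn).
by move=> a b; apply/andP; split; lra.
Qed.

Lemma limn_supDN_ge0 u M : (forall n, `|u n| <= M) ->
  0 <= limn_sup u + limn_sup (fun n => - u n).
Proof.
move=> uM; rewrite leNgt; apply/negP => h.
have uM' n : `|- u n| <= M by rewrite normrN.
pose e := - (limn_sup u + limn_sup (fun n => - u n)) / 2.
have e0 : 0 < e by rewrite /e; lra.
have [N1 hN1] := limn_sup_eventually uM e0.
have [N2 hN2] := limn_sup_eventually uM' e0.
have := hN1 _ (leq_maxl N1 N2); have := hN2 _ (leq_maxr N1 N2).
by rewrite /e; lra.
Qed.

End limsup.

Section birkhoff.
Context {R : realType} d (W : measurableType d) (P : probability W R).
Variable tau : W -> W.
Hypotheses (mtau : measurable_fun setT tau)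
  (tau_P : eq_meas (pushforward P tau) P).
Implicit Types f g : W -> R.

Lemma measurable_iter n : measurable_fun setT (iter n tau).
Proof.
elim: n => [|n ih]; first exact: measurable_id.
exact: (measurableT_comp mtau ih).
Qed.

Lemma Rint_invariant f : bmf f -> \int[P]_x f (tau x) = \int[P]_x f x.
Proof. exact: Rint_pushforward. Qed.

Lemma bmf_iter n f : bmf f -> bmf (fun x => f (iter n tau x)).
Proof. by apply: bmf_comp; exact: measurable_iter. Qed.

Lemma Rint_iter n f : bmf f -> \int[P]_x f (iter n tau x) = \int[P]_x f x.
Proof.
move=> bf; elim: n => [|n ih]//=.
rewrite -[RHS]ih -(Rint_invariant (bmf_iter n bf)).
by apply: eq_Rint => x; rewrite -iterSr.
Qed.

Let bmf_max0 g : bmf g -> bmf (fun x => Num.max 0 (g x)).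
Proof.
move=> [mg [M hM]]; split; first exact: measurable_maxr.
exists M => x; rewrite ger0_norm ?le_max ?lexx//.
rewrite ge_max (le_trans _ (hM x))//=.
by rewrite (le_trans (ler_norm _)).
Qed.

(** The maximum of 0 and of the first [n] partial sums of [g] along the orbit, in the recursive form
    that the maximal inequality exploits. *)
Let gmax g n : W -> R :=
  iter n (fun (M : W -> R) x => Num.max 0 (g x + M (tau x))) (fun=> 0).

Let gmax_ge0 g n x : 0 <= gmax g n x.
Proof. by case: n => [|n]//; rewrite /gmax/= le_max lexx. Qed.

Let gmax_mono g n x : gmax g n x <= gmax g n.+1 x.
Proof.
elim: n x => [|n ih] x; first exact: (gmax_ge0 g 1).
by rewrite /gmax/= le_max2//; rewrite lerD2l; exact: ih.
Qed.

Let bmf_gmax g n : bmf g -> bmf (gmax g n).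
Proof.
move=> bg; elim: n => [|n ih]; first exact: bmf_cst.
by apply: bmf_max0; apply: bmfD => //; exact: bmf_comp ih.
Qed.

Let gmax_sum g n x : \sum_(i < n) g (iter i tau x) <= gmax g n x.
Proof.
elim: n x => [|n ih] x; first by rewrite big_ord0.
rewrite big_ord_recl/= /gmax/= le_max; apply/orP; right.
rewrite lerD2l (le_trans _ (ih (tau x)))// le_eqVlt; apply/orP; left.
by apply/eqP; apply: eq_bigr => i _; rewrite -iterSr.
Qed.

(* Garsia's maximal inequality: where gmax g n.+1 is positive it equals       *)
(* g + gmax g n \o tau, so that g integrates to at least                      *)
(* \int (gmax g n.+1 - gmax g n) over this set.                               *)
Lemma maximal_ergodic g : bmf g ->
  (forall x, exists n, 0 < \sum_(i < n) g (iter i tau x)) ->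
  0 <= \int[P]_x g x.
Proof.
move=> bg gpos.
pose A n : set W := [set x | 0 < gmax g n x].
have mA n : measurable (A n).
  have [m _] := bmf_gmax n bg.
  have := m measurableT `]0, +oo[%classic (measurable_itv _).
  rewrite setTI (_ : _ @^-1` _ = A n)//.
  by apply/seteqP; split => x /=; rewrite in_itv/= andbT.
have bA n : bmf (fun x => g x * \1_(A n) x) by apply: bmfM => //; exact: bmf_indic.
have [M M0 hM] := bmfM_pos bg.
have h n : 0 <= \int[P]_x (g x * \1_(A n.+1) x).
  apply: (@le_trans _ _ (\int[P]_x (gmax g n.+1 x - gmax g n (tau x)))).
    rewrite RintB; [|exact: bmf_gmax|apply: bmf_comp => //; exact: bmf_gmax].
    rewrite (Rint_invariant (bmf_gmax n bg)) subr_ge0.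
    by apply: le_Rint => //; [exact: bmf_gmax|exact: bmf_gmax].
  apply: le_Rint => //.
    apply: bmfB; first exact: bmf_gmax.
    by apply: bmf_comp => //; exact: bmf_gmax.
  move=> x; have := gmax_ge0 g n (tau x); rewrite indicE.
  have E : gmax g n.+1 x = Num.max 0 (g x + gmax g n (tau x)) by [].
  have [|] := boolP (x \in A n.+1).
    rewrite inE E /A [X in X -> _](_ : _ = (0 < gmax g n.+1 x) :> Prop)//.
    rewrite E lt_max ltxx orFb => gx _.
    by rewrite mulr1 max_r ?addrK// ltW.
  rewrite notin_setE /A/= => /negP; rewrite -leNgt => le0 h0.
  by rewrite mulr0; have := gmax_ge0 g n.+1 x; lra.
have cv : \int[P]_x (g x * \1_(A n.+1) x) @[n --> \oo] --> \int[P]_x g x.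
  apply: (@Rint_bcvg _ _ _ _ _ _ M).
  - by move=> n; case: (bA n.+1).
  - move=> n x; rewrite normrM indicE -[leRHS]mulr1 ler_pM//.
    by case: (_ \in _); rewrite ?normr1 ?normr0.
  - by case: bg.
  - apply: aeW => x; apply: cvg_near_cst; have [k hk] := gpos x.
    exists k => // n /= kn; rewrite indicE mem_set ?mulr1// /A/=.
    have : 0 < gmax g k x by exact: lt_le_trans hk (gmax_sum g k x).
    have mono : {homo (gmax g ^~ x) : i j / (i <= j)%N >-> i <= j}.
      by apply: homo_leq => [y|y z t|i]; [exact: lexx|exact: le_trans|exact: gmax_mono].
    by move=> /lt_le_trans; apply; exact: mono (leqW kn).
by rewrite -(cvg_lim _ cv)//; apply: limr_ge; [exact: cvgP cv|exact: nearW].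
Qed.

Definition ergodic_avg f N x : R := (\sum_(i < N) f (iter i tau x)) / N%:R.

Lemma bmf_ergodic_avg f N : bmf f -> bmf (ergodic_avg f N).
Proof.
move=> bf; apply: bmfM; last exact: bmf_cst.
by apply: (bmf_sum (index_enum _)) => i; exact: bmf_iter.
Qed.

Lemma ergodic_avg_bounded f M : (forall x, `|f x| <= M) ->
  forall N x, `|ergodic_avg f N x| <= M.
Proof.
move=> fM N x; have M0 : 0 <= M by exact: le_trans (fM x).
rewrite /ergodic_avg normrM normfV normr_nat.
case: N => [|N]; first by rewrite big_ord0 normr0 mul0r.
rewrite ler_pdivrMr ?ltr0n// (le_trans (ler_norm_sum _ _ _))//.
rewrite (le_trans (ler_sum _ (fun (i : 'I_N.+1) _ => fM (iter i tau x))))//.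
by rewrite sumr_const card_ord mulr_natr.
Qed.

Lemma Rint_ergodic_avg f N : bmf f ->
  \int[P]_x ergodic_avg f N.+1 x = \int[P]_x f x.
Proof.
move=> bf; rewrite /ergodic_avg.
under eq_Rint do rewrite mulrC.
have bi i : bmf (fun x => f (iter i tau x)) by exact: bmf_iter.
rewrite RintZ; last by apply: (bmf_sum (index_enum _)) => i.
rewrite (Rint_sum P (index_enum _))//.
rewrite (eq_bigr (fun=> \int[P]_x f x)); last by move=> i _; exact: Rint_iter.
by rewrite sumr_const card_ord -[X in _ * X]mulr_natl mulrA mulVf ?mul1r// pnatr_eq0.
Qed.

(** An upper limit is defined at every point and, for bounded [f], invariant at every point, not
    merely almost everywhere. *)
Definition birkhoff_limit f x : R := limn_sup (fun N => ergodic_avg f N x).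

Lemma birkhoff_limit_invariant f x : bmf f ->
  birkhoff_limit f (tau x) = birkhoff_limit f x.
Proof.
move=> bf; have [M M0 fM] := bmfM_pos bf.
have key : ergodic_avg f N (tau x) - ergodic_avg f N x @[N --> \oo] --> 0.
  have h : (2 * M) / N%:R @[N --> \oo] --> (0 : R).
    rewrite -[X in _ --> X](mulr0 (2 * M)).
    apply: cvgM; first exact: cvg_cst.
    by rewrite -cvg_shiftS; exact: cvg_harmonic.
  apply/norm_cvg0P; apply: squeeze_cvgr (cvg_cst 0) h; apply: nearW => N.
  rewrite normr_ge0/= -mulrBl normrM normfV normr_nat ler_wpM2r ?invr_ge0//.
  have -> : \sum_(i < N) f (iter i tau (tau x)) - \sum_(i < N) f (iter i tau x) =
            f (iter N tau x) - f x.
    elim: N => [|N ih]; first by rewrite !big_ord0 !subrr.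
    have e : iter N tau (tau x) = tau (iter N tau x) by rewrite -iterSr.
    by rewrite !big_ord_recr/= e; lra.
  by rewrite (le_trans (ler_normB _ _))// mulr2n mulrDl mul1r lerD.
have fM' N y := ergodic_avg_bounded fM N y.
apply/eqP; rewrite eq_le; apply/andP; split.
  by apply: (@limn_sup_le _ _ _ M).
apply: (@limn_sup_le _ _ _ M) => //.
by rewrite -[X in _ --> X]oppr0; under eq_fun do rewrite -opprB; exact: cvgN.
Qed.

Lemma birkhoff_limit_bounded f M : (forall x, `|f x| <= M) ->
  forall x, `|birkhoff_limit f x| <= M.
Proof. by move=> fM x; apply: limn_sup_bounded => N; exact: ergodic_avg_bounded. Qed.

Lemma bmf_birkhoff_limit f : bmf f -> bmf (birkhoff_limit f).
Proof.
move=> bf; have [M _ fM] := bmfM_pos bf.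
split; last by exists M; exact: birkhoff_limit_bounded.
apply: measurable_fun_limn_sup.
- move=> x _; exists M => _ [n _ <-].
  by rewrite (le_trans (ler_norm _))//; exact: ergodic_avg_bounded.
- move=> x _; exists (- M) => _ [n _ <-].
  by have := ergodic_avg_bounded fM n x; rewrite ler_norml => /andP[].
- by move=> n; case: (bmf_ergodic_avg n bf).
Qed.

(** Every orbit has an average exceeding the upper limit minus [e], so the maximal inequality
    applies to [f + e] minus the upper limit. The index is taken at least 1, the average of index 0
    being a junk value. *)
Lemma birkhoff_limit_le f : bmf f ->
  \int[P]_x birkhoff_limit f x <= \int[P]_x f x.
Proof.
move=> bf; have [M _ fM] := bmfM_pos bf; have bl := bmf_birkhoff_limit bf.
apply/ler_addgt0Pr => e e0.
rewrite -subr_ge0 -(Rint_cst P e) -RintD//; last exact: bmf_cst.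
rewrite -RintB//; last by apply: bmfD => //; exact: bmf_cst.
apply: maximal_ergodic; first by apply: bmfB => //; apply: bmfD => //; exact: bmf_cst.
move=> x; have [n n1 hn] := limn_sup_freq (fun N => ergodic_avg_bounded fM N x) 1 e0.
exists n; have n0 : 0 < n%:R :> R by rewrite ltr0n.
have inv i : birkhoff_limit f (iter i tau x) = birkhoff_limit f x.
  by elim: i => //= i ih; rewrite birkhoff_limit_invariant.
rewrite (eq_bigr (fun i : 'I_n =>
    f (iter i tau x) + (e - birkhoff_limit f x))); last first.
  by move=> i _; rewrite inv addrA.
rewrite big_split/= sumr_const card_ord -mulr_natr.
move: hn; rewrite /ergodic_avg ltr_pdivlMr// -/(birkhoff_limit f x).
by lra.
Qed.

(** The upper limits for [f] and [- f] have a nonnegative sum, whose integral is at most 0 by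
    [birkhoff_limit_le]; so the sum vanishes almost everywhere, which means convergence. *)
Theorem birkhoff_ae f : bmf f ->
  {ae P, forall x, ergodic_avg f N x @[N --> \oo] --> birkhoff_limit f x}.
Proof.
move=> bf; have [M _ fM] := bmfM_pos bf; have bnf := bmfN bf.
have bl := bmf_birkhoff_limit bf; have bln := bmf_birkhoff_limit bnf.
have opp x N : ergodic_avg (fun x => - f x) N x = - ergodic_avg f N x.
  by rewrite /ergodic_avg sumrN mulNr.
have limN x : birkhoff_limit (fun x => - f x) x =
              limn_sup (fun N => - ergodic_avg f N x).
  by rewrite /birkhoff_limit; congr limn_sup; apply/funext => N; exact: opp.
have ge0 x : 0 <= birkhoff_limit f x + birkhoff_limit (fun x => - f x) x.
  by rewrite limN; exact: limn_supDN_ge0 (fun N => ergodic_avg_bounded fM N x).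
have : \int[P]_x (birkhoff_limit f x + birkhoff_limit (fun x => - f x) x) = 0.
  apply/eqP; rewrite eq_le Rint_ge0// andbT RintD//.
  have := birkhoff_limit_le bf; have := birkhoff_limit_le bnf.
  by rewrite RintN//; lra.
move=> /(Rint_eq0_ae (bmfD bl bln) ge0); apply: filterS => x hx.
apply: (@limn_sup_cvg _ _ M); first by move=> N; exact: ergodic_avg_bounded.
by rewrite -limN hx.
Qed.

Lemma birkhoff_cvg_weak f g : bmf f -> bmf g ->
  \int[P]_x (ergodic_avg f N x * g x) @[N --> \oo] -->
  \int[P]_x (birkhoff_limit f x * g x).
Proof.
move=> bf bg; have [M _ fM] := bmfM_pos bf; have [K _ gK] := bmfM_pos bg.
have bl := bmf_birkhoff_limit bf.
apply: (@Rint_bcvg _ _ _ _ _ _ (M * K)).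
- by move=> N; case: (bmfM (bmf_ergodic_avg N bf) bg).
- by move=> N x; rewrite normrM ler_pM//; exact: ergodic_avg_bounded.
- by case: (bmfM bl bg).
- apply: filterS (birkhoff_ae bf) => x h.
  by apply: cvgM => //; exact: cvg_cst.
Qed.

Lemma birkhoff_cvgM f g : bmf f -> bmf g ->
  \int[P]_x (ergodic_avg f N x * ergodic_avg g N x) @[N --> \oo] -->
  \int[P]_x (birkhoff_limit f x * birkhoff_limit g x).
Proof.
move=> bf bg; have [M _ fM] := bmfM_pos bf; have [K _ gK] := bmfM_pos bg.
have bl := bmf_birkhoff_limit bf; have bl' := bmf_birkhoff_limit bg.
apply: (@Rint_bcvg _ _ _ _ _ _ (M * K)).
- by move=> N; case: (bmfM (bmf_ergodic_avg N bf) (bmf_ergodic_avg N bg)).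
- by move=> N x; rewrite normrM ler_pM//; exact: ergodic_avg_bounded.
- by case: (bmfM bl bl').
- by apply: filterS2 (birkhoff_ae bf) (birkhoff_ae bg) => x h h'; exact: cvgM.
Qed.

(** The limit acts as a conditional expectation on the invariant functions: for invariant [g] the
    integrals of [g] against the averages of [f] do not depend on the positive index [N]. *)
Lemma Rint_birkhoff_limitM f g : bmf f -> bmf g ->
  (forall x, g (tau x) = g x) ->
  \int[P]_x (birkhoff_limit f x * g x) = \int[P]_x (f x * g x).
Proof.
move=> bf bg ginv; have h := birkhoff_cvg_weak bf bg.
rewrite -(cvg_lim _ h)//; apply: lim_near_cst => //; exists 1%N => // -[|N] _//=.
rewrite -(Rint_ergodic_avg N (bmfM bf bg)); apply: eq_Rint => x.
have inv i : g (iter i tau x) = g x by elim: i => //= i <-; rewrite ginv.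
rewrite /ergodic_avg mulrAC; congr (_ / _); rewrite mulr_suml.
by apply: eq_bigr => i _; rewrite inv.
Qed.

Lemma Rint_birkhoff_limit f : bmf f ->
  \int[P]_x birkhoff_limit f x = \int[P]_x f x.
Proof.
move=> bf; have := Rint_birkhoff_limitM bf (bmf_cst W 1) (fun=> erefl).
by under eq_Rint do rewrite mulr1; under [RHS]eq_Rint do rewrite mulr1.
Qed.

(** The set where [g] exceeds its mean is invariant, hence null or of full measure; either way
    [g - c] has a constant sign almost everywhere and integral 0. *)
Lemma ergodic_invariant_cst g : ergodic P tau -> bmf g ->
  (forall x, g (tau x) = g x) -> {ae P, forall x, g x = \int[P]_y g y}.
Proof.
move=> erg bg ginv; set c := \int[P]_y g y.
have mA : measurable [set x | c < g x].
  have [m _] := bg; have := m measurableT `]c, +oo[%classic (measurable_itv _).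
  rewrite setTI (_ : _ @^-1` _ = [set x | c < g x])//.
  by apply/seteqP; split => x /=; rewrite in_itv/= andbT.
have bgc : bmf (fun x => g x - c) by apply: bmfB => //; exact: bmf_cst.
have i0 : \int[P]_x (g x - c) = 0.
  by rewrite RintB ?Rint_cst ?subrr//; exact: bmf_cst.
suff h0 : \int[P]_x `|g x - c| = 0.
  have := Rint_eq0_ae (bmf_norm bgc) (fun=> normr_ge0 _) h0.
  by apply: filterS => x /eqP; rewrite normr_eq0 subr_eq0 => /eqP.
have mabs : measurable_fun setT (fun x => `|g x - c|) by case: (bmf_norm bgc).
have [|PA|PA] := erg _ mA.
- by apply/seteqP; split => x /=; rewrite ginv.
- rewrite (@Rint_ae _ _ _ P _ (fun x => - (g x - c))) ?RintN ?i0 ?oppr0//.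
    by case: (bmfN bgc).
  have : {ae P, forall x, ~ (c < g x)}.
    by exists [set x | c < g x]; split => // x /= /contrapT.
  apply: filterS => x /negP; rewrite -leNgt => h.
  by rewrite ler0_norm// subr_le0.
- rewrite (@Rint_ae _ _ _ P _ (fun x => g x - c)) ?i0//; first by case: bgc.
  have : {ae P, forall x, c < g x}.
    exists (~` [set x | c < g x]); split => //; first exact: measurableC.
    by rewrite [LHS]probability_setC// [X in (_ - X)%E]PA subee.
  apply: filterS => x h.
  by rewrite gtr0_norm// subr_gt0.
Qed.

End birkhoff.

(** * Characteristic functions and mean ergodicity *)

Section complex_sqn.
Context {R : realType}.
Implicit Types z w : R[i].

Lemma complexM (a b c e : R) :
  Complex a b * Complex c e = Complex (a * c - b * e) (a * e + b * c) :> R[i].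
Proof. by []. Qed.

Definition sqn z : R := complex.Re z ^+ 2 + complex.Im z ^+ 2.

Lemma sqn_ge0 z : 0 <= sqn z.
Proof. by rewrite /sqn addr_ge0// sqr_ge0. Qed.

Lemma sqnM z w : sqn (z * w) = sqn z * sqn w.
Proof. by case: z => a b; case: w => c e; rewrite /sqn/=; ring. Qed.

Lemma sqn1 : sqn 1 = 1.
Proof. by rewrite /sqn/= expr1n expr0n/= addr0. Qed.

Lemma sqnX z n : sqn (z ^+ n) = sqn z ^+ n.
Proof. by elim: n => [|n ih]; rewrite ?expr0 ?sqn1// !exprS sqnM ih. Qed.

Lemma sqn_eq0 z : sqn z = 0 -> z = 0.
Proof.
case: z => a b /eqP; rewrite /sqn/= paddr_eq0 ?sqr_ge0// !sqrf_eq0.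
by move=> /andP[/eqP-> /eqP->].
Qed.

Lemma sqn_gt0 z : z != 0 -> 0 < sqn z.
Proof.
move=> z0; rewrite lt_neqAle sqn_ge0 andbT eq_sym.
by apply: contra_neq z0 => /sqn_eq0.
Qed.

Lemma sqn_real (x : R) : sqn (Complex x 0) = x ^+ 2.
Proof. by rewrite /sqn/= expr0n/= addr0. Qed.

Lemma sqnD_le z w (t : R) : 0 < t ->
  sqn (z + w) <= (1 + t) * sqn z + (1 + t^-1) * sqn w.
Proof.
move=> t0; have key (x y : R) :
    (x + y) ^+ 2 <= (1 + t) * x ^+ 2 + (1 + t^-1) * y ^+ 2.
  rewrite -subr_ge0 (_ : _ - _ = t^-1 * (t * x - y) ^+ 2).
    by rewrite mulr_ge0 ?sqr_ge0// invr_ge0 ltW.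
  by field; rewrite gt_eqF.
case: z => a b; case: w => c e; rewrite /sqn/=.
have := key a c; have := key b e; lra.
Qed.

(** Telescoping [z^l - 1] costs a factor [l] in modulus, hence [l^2] here. This is the price of
    passing from a root to its l-th convolution power. *)
Lemma sqnX_sub1_le z c l : 1 <= c -> sqn z <= c ->
  sqn (z ^+ l - 1) <= l%:R ^+ 2 * c ^+ l * sqn (z - 1).
Proof.
move=> c1 zc; have q0 := sqn_ge0 (z - 1); case: l => [|l].
  by rewrite expr0 subrr (sqn_real 0) expr0n/= !mul0r.
elim: l => [|l ih].
  by rewrite !expr1 expr1n mul1r ler_peMl.
rewrite exprS (_ : z * _ - 1 = z * (z ^+ l.+1 - 1) + (z - 1)); last by ring.
(* With [n = l.+1] and weight [1/n], the coefficients add up to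
   [(1 + 1/n) n^2 + (1 + n) = (n + 1)^2]. *)
have l0 : 0 < l.+1%:R^-1 :> R by rewrite invr_gt0.
apply: (le_trans (sqnD_le _ _ l0)); rewrite invrK sqnM.
have cl : 1 <= c ^+ l.+2 by rewrite exprn_ege1.
have {}ih : sqn z * sqn (z ^+ l.+1 - 1) <= l.+1%:R ^+ 2 * c ^+ l.+2 * sqn (z - 1).
  apply: (le_trans (ler_pM (sqn_ge0 _) (sqn_ge0 _) zc ih)).
  by rewrite [c ^+ l.+2]exprS le_eqVlt; apply/orP; left; apply/eqP; ring.
have l1 : 0 <= 1 + l.+1%:R^-1 :> R by rewrite addr_ge0// ltW.
apply: (le_trans (lerD (ler_wpM2l l1 ih) (lexx _))).
have h : 0 <= (1 + l.+1%:R) * sqn (z - 1) * (c ^+ l.+2 - 1).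
  apply: mulr_ge0; last by rewrite subr_ge0.
  by apply: mulr_ge0 => //; rewrite addr_ge0.
have n0 : l.+1%:R != 0 :> R by rewrite pnatr_eq0.
rewrite -[l.+2%:R]natr1; move: (l.+1%:R) n0 h => n n0 h.
rewrite (_ : (1 + n^-1) * _ = (n ^+ 2 + n) * c ^+ l.+2 * sqn (z - 1)); last first.
  by field.
by move: h; rewrite expr2 (expr2 (n + 1)); lra.
Qed.

Lemma polar (z : R[i]) : exists2 t : R, z = Complex (Num.sqrt (sqn z) * cos t)
  (Num.sqrt (sqn z) * sin t) & True.
Proof.
have [->|z0] := eqVneq z 0.
  by exists 0 => //; rewrite (sqn_real 0) expr0n/= sqrtr0 !mul0r.
have q0 := sqn_gt0 z0; set r := Num.sqrt (sqn z).
have r0 : 0 < r by rewrite sqrtr_gt0.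
have rr : r ^+ 2 = sqn z by rewrite sqr_sqrtr// ltW.
case: z @r r0 rr q0 {z0} => a b r r0 rr q0.
have ab : (a / r) ^+ 2 + (b / r) ^+ 2 = 1.
  by rewrite !expr_div_n -mulrDl rr divff// gt_eqF.
have ar : -1 <= a / r <= 1.
  rewrite -ler_norml -[leRHS]sqrtr1 -sqrtr_sqr ler_wsqrtr// -ab lerDl sqr_ge0//.
have sb : sin (acos (a / r)) = `|b / r|.
  by rewrite sin_acos// -ab addrAC subrr add0r sqrtr_sqr.
have [b0|b0] := leP 0 b.
  exists (acos (a / r)) => //; rewrite sb acosK ?in_itv//=.
  rewrite ger0_norm ?divr_ge0// 1?ltW//.
  by congr Complex; field; rewrite gt_eqF.
exists (- acos (a / r)) => //; rewrite cosN sinN sb acosK ?in_itv//=.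
rewrite ler0_norm; last by rewrite pmulr_lle0 ?invr_gt0// ltW.
by congr Complex; field; rewrite gt_eqF.
Qed.

End complex_sqn.

Section charfun.
Context {R : realType}.

Definition charfun d (W : measurableType d) (P : probability W R) (a : W -> R) :
  R[i] := Complex (\int[P]_x cos (a x)) (\int[P]_x sin (a x)).

Lemma Rint_cosD d (W : measurableType d) (P : probability W R) (a : W -> R) r :
  measurable_fun setT a ->
  \int[P]_x cos (a x + r) =
  (complex.Re (charfun P a)) * cos r - (complex.Im (charfun P a)) * sin r.
Proof.
move=> ma; have bc := bmf_cos ma; have bs := bmf_sin ma.
under eq_Rint do rewrite cosD (mulrC (cos (a _))) (mulrC (sin (a _))).
by rewrite RintB ?RintZ//; [rewrite mulrC [X in _ - X]mulrC|exact: bmfZ|exact: bmfZ].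
Qed.

Lemma Rint_sinD d (W : measurableType d) (P : probability W R) (a : W -> R) r :
  measurable_fun setT a ->
  \int[P]_x sin (a x + r) =
  (complex.Re (charfun P a)) * sin r + (complex.Im (charfun P a)) * cos r.
Proof.
move=> ma; have bc := bmf_cos ma; have bs := bmf_sin ma.
under eq_Rint do rewrite sinD addrC (mulrC (cos (a _))) (mulrC (sin (a _))).
by rewrite RintD ?RintZ//; [rewrite mulrC [X in _ + X]mulrC|exact: bmfZ|exact: bmfZ].
Qed.

Lemma charfunN d (W : measurableType d) (P : probability W R) (a : W -> R) :
  measurable_fun setT a ->
  charfun P (fun x => - a x) = conjc (charfun P a).
Proof.
move=> ma; rewrite /charfun/=; congr Complex.
  by apply: eq_Rint => x; rewrite cosN.
rewrite -RintN; last exact: bmf_sin.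
by apply: eq_Rint => x; rewrite sinN.
Qed.

Lemma sqn_charfun_le1 d (W : measurableType d) (P : probability W R) (a : W -> R) :
  measurable_fun setT a -> sqn (charfun P a) <= 1.
Proof.
move=> ma; have bc := bmf_cos ma; have bs := bmf_sin ma.
apply: (le_trans (lerD (Rint_sqr_le P bc) (Rint_sqr_le P bs))).
rewrite -RintD; [|exact: bmfX|exact: bmfX].
by under eq_Rint do rewrite cos2Dsin2; rewrite Rint_cst.
Qed.

Lemma charfun_prod d1 d2 (W1 : measurableType d1) (W2 : measurableType d2)
  (P1 : probability W1 R) (P2 : probability W2 R) (a1 : W1 -> R) (a2 : W2 -> R) :
  measurable_fun setT a1 -> measurable_fun setT a2 ->
  charfun (P1 \x P2)%E (fun x => a1 x.1 + a2 x.2) = charfun P1 a1 * charfun P2 a2.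
Proof.
move=> m1 m2.
pose c1 x := cos (a1 x); pose c2 x := cos (a2 x).
pose s1 x := sin (a1 x); pose s2 x := sin (a2 x).
have bc1 : bmf c1 := bmf_cos m1; have bs1 : bmf s1 := bmf_sin m1.
have bc2 : bmf c2 := bmf_cos m2; have bs2 : bmf s2 := bmf_sin m2.
have B (f : W1 -> R) (g : W2 -> R) : bmf f -> bmf g ->
    bmf (fun x : W1 * W2 => f x.1 * g x.2).
  by move=> bf bg; apply: bmfM; [exact: bmf_comp bf|exact: bmf_comp bg].
have ec : \int[(P1 \x P2)%E]_x cos (a1 x.1 + a2 x.2) =
    \int[P1]_x c1 x * \int[P2]_x c2 x - \int[P1]_x s1 x * \int[P2]_x s2 x.
  rewrite -(Rint_prodM P1 P2 bc1 bc2) -(Rint_prodM P1 P2 bs1 bs2) -RintB.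
  - by apply: eq_Rint => x; rewrite cosD.
  - exact: (B c1 c2).
  - exact: (B s1 s2).
have es : \int[(P1 \x P2)%E]_x sin (a1 x.1 + a2 x.2) =
    \int[P1]_x c1 x * \int[P2]_x s2 x + \int[P1]_x s1 x * \int[P2]_x c2 x.
  rewrite -(Rint_prodM P1 P2 bc1 bs2) -(Rint_prodM P1 P2 bs1 bc2) -RintD.
  - by apply: eq_Rint => x; rewrite sinD addrC.
  - exact: (B c1 s2).
  - exact: (B s1 c2).
by rewrite /charfun ec es complexM.
Qed.

Lemma charfun_comp d1 d2 (W1 : measurableType d1) (W2 : measurableType d2)
  (P1 : probability W1 R) (P2 : probability W2 R) (h : W1 -> W2) (a : W2 -> R) :
  measurable_fun setT h -> eq_meas (pushforward P1 h) P2 ->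
  measurable_fun setT a -> charfun P1 (fun x => a (h x)) = charfun P2 a.
Proof.
move=> mh hP ma; rewrite /charfun; congr Complex.
- by rewrite (Rint_pushforward mh hP (bmf_cos ma)).
- by rewrite (Rint_pushforward mh hP (bmf_sin ma)).
Qed.

Lemma eq_charfun d (W : measurableType d) (P : probability W R) (a b : W -> R) :
  (forall x, a x = b x) -> charfun P a = charfun P b.
Proof. by move=> /funext ->. Qed.

End charfun.

(** * Weak mixing expressed by mean square correlations *)

Section averages.
Context {R : realType}.

Definition avg2 (F : nat -> nat -> R) N : R :=
  (\sum_(i < N) \sum_(j < N) F i j) / N%:R ^+ 2.

Lemma le_avg2 (F G : nat -> nat -> R) N : (forall i j, F i j <= G i j) ->
  avg2 F N <= avg2 G N.
Proof.
move=> FG; rewrite /avg2 ler_wpM2r ?invr_ge0 ?exprn_ge0//.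
by apply: ler_sum => i _; apply: ler_sum.
Qed.

Lemma avg2D (F G : nat -> nat -> R) N :
  avg2 (fun i j => F i j + G i j) N = avg2 F N + avg2 G N.
Proof.
rewrite /avg2 -mulrDl -big_split; congr (_ / _); apply: eq_bigr => i _.
by rewrite big_split.
Qed.

Lemma avg2Z c (F : nat -> nat -> R) N :
  avg2 (fun i j => c * F i j) N = c * avg2 F N.
Proof.
rewrite /avg2 mulrA mulr_sumr; congr (_ / _); apply: eq_bigr => i _.
by rewrite mulr_sumr.
Qed.

Lemma avg2_cst (c : R) N : avg2 (fun _ _ => c) N.+1 = c.
Proof.
rewrite /avg2; under eq_bigr do rewrite sumr_const card_ord.
by rewrite sumr_const card_ord -mulrnA -(mulr_natr c) natrM -expr2 mulfK//.
Qed.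

Lemma avg2_ge0 (F : nat -> nat -> R) N : (forall i j, 0 <= F i j) -> 0 <= avg2 F N.
Proof.
move=> F0; rewrite /avg2 divr_ge0 ?exprn_ge0//.
by apply: sumr_ge0 => i _; apply: sumr_ge0.
Qed.

Lemma avg2_tr (F : nat -> nat -> R) N : avg2 (fun i j => F j i) N = avg2 F N.
Proof. by rewrite /avg2 exchange_big. Qed.

(** The multiples of [m] form a subset of positive density, so a vanishing average of nonnegative
    terms still vanishes along them. Powers of a transformation inherit [wmix] in this way. *)
Lemma avg2_multiples (F : nat -> nat -> R) m N : (0 < m)%N ->
  (forall i j, 0 <= F i j) ->
  avg2 (fun i j => F (m * i)%N (m * j)%N) N <= m%:R ^+ 2 * avg2 F (m * N)%N.
Proof.
move=> m0 F0.
have sub (G : nat -> R) : (forall i, 0 <= G i) ->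
    \sum_(i < N) G (m * i)%N <= \sum_(i < m * N) G i.
  move=> G0.
  have inj : {in [pred i : 'I_N | true] &, injective
      (fun i : 'I_N => (m * i)%N)} by move=> i j _ _ /eqP; rewrite eqn_pmul2l// => /eqP /val_inj.
  have lt (i : 'I_N) : (m * i < m * N)%N by rewrite ltn_pmul2l.
  pose f (i : 'I_N) : 'I_(m * N) := Ordinal (lt i).
  have finj : injective f.
    by move=> i j /(congr1 val)/= e; apply: inj.
  rewrite (_ : \sum_(i < N) _ = \sum_(i in [set f i | i : 'I_N]%SET) G i).
    rewrite [leRHS](bigID (mem [set f i | i : 'I_N]%SET))/= lerDl.
    exact: sumr_ge0.
  by rewrite big_imset//=; move=> i j _ _; exact: finj.
case: N sub => [|N] sub.
  by rewrite muln0 /avg2 !big_ord0 mul0r mulr0.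
have mR : m%:R != 0 :> R by rewrite pnatr_eq0 -lt0n.
rewrite /avg2 natrM; set S := (X in _ <= _ * (X / _)).
have nR : N.+1%:R != 0 :> R by rewrite pnatr_eq0.
have fld (a b c : R) : a != 0 -> b != 0 -> a ^+ 2 * (c / (a * b) ^+ 2) = c / b ^+ 2.
  by move=> a0 b0; field; rewrite a0 b0.
rewrite fld//.
rewrite ler_wpM2r ?invr_ge0 ?exprn_ge0//.
apply: le_trans (sub (fun i => \sum_(j < m * N.+1) F i j) _) => /=.
  by apply: ler_sum => i _; exact: sub.
by move=> i; exact: sumr_ge0.
Qed.

End averages.

Section mean_ergodic.
Context {R : realType}.

Lemma measurable_pair_map d1 d2 (W1 : measurableType d1) (W2 : measurableType d2)
  (f : W1 -> W1) (g : W2 -> W2) : measurable_fun setT f ->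
  measurable_fun setT g -> measurable_fun setT (pair_map f g).
Proof. by move=> mf mg; apply: measurable_fun_pair; exact: measurableT_comp. Qed.

Lemma pair_map_preserving d1 d2 (W1 : measurableType d1) (W2 : measurableType d2)
  (P1 : probability W1 R) (P2 : probability W2 R) (f : W1 -> W1) (g : W2 -> W2) :
  measurable_fun setT f -> eq_meas (pushforward P1 f) P1 ->
  measurable_fun setT g -> eq_meas (pushforward P2 g) P2 ->
  eq_meas (pushforward (P1 \x P2)%E (pair_map f g)) (P1 \x P2)%E.
Proof.
move=> mf fP mg gP A mA.
have mh := measurable_pair_map mf mg.
pose H : {mfun (W1 * W2)%type >-> (W1 * W2)%type} :=
  HB.pack (pair_map f g) (isMeasurableFun.Build _ _ _ _ (pair_map f g) mh).
apply: esym; apply: (@product_measure_unique _ _ _ _ _ P1 P2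
  (distribution (P1 \x P2)%E H)) => //= B C mB mC.
rewrite /distribution/= /pushforward.
rewrite (_ : _ @^-1` _ = (f @^-1` B) `*` (g @^-1` C))//.
rewrite product_measure1E//; first by congr (_ * _)%E; [exact: fP|exact: gP].
- by rewrite -[X in measurable X]setTI; exact: mf.
- by rewrite -[X in measurable X]setTI; exact: mg.
Qed.

Lemma iter_pair_map W1 W2 (f : W1 -> W1) (g : W2 -> W2) n z :
  iter n (pair_map f g) z = (iter n f z.1, iter n g z.2).
Proof. by elim: n => [|n ih]; [case: z|rewrite /= ih]. Qed.

Definition mean_ergodic d (W : measurableType d) (P : probability W R)
    (tau : W -> W) (a : W -> R) : Prop :=
  forall r, \int[P]_x ((ergodic_avg tau (fun y => cos (a y + r)) N x -
                        \int[P]_y cos (a y + r)) ^+ 2) @[N --> \oo] --> 0.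

Section one_system.
Context d (W : measurableType d) (P : probability W R) (tau : W -> W).
Hypotheses (mtau : measurable_fun setT tau)
  (tau_P : eq_meas (pushforward P tau) P).

Lemma Rint_ergodic_avgM (f g : W -> R) N : bmf f -> bmf g ->
  \int[P]_x (ergodic_avg tau f N x * ergodic_avg tau g N x) =
  avg2 (fun i j => \int[P]_x (f (iter i tau x) * g (iter j tau x))) N.
Proof.
move=> bf bg; have bi n h : bmf h -> bmf (fun x => h (iter n tau x)).
  exact: bmf_iter.
have bij i j : bmf (fun x => f (iter i tau x) * g (iter j tau x)).
  by apply: bmfM; exact: bi.
rewrite (@eq_Rint _ _ _ _ _ (fun x => N%:R ^- 2 * \sum_(i < N) \sum_(j < N)
    (f (iter i tau x) * g (iter j tau x)))); last first.
  move=> x; rewrite /ergodic_avg mulrACA -expr2 exprVn mulrC; congr (_ * _).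
  by rewrite mulr_suml; apply: eq_bigr => i _; rewrite mulr_sumr.
rewrite RintZ; last first.
  apply: (bmf_sum (index_enum _)) => i; apply: (bmf_sum (index_enum _)) => j.
  exact: bij.
rewrite mulrC (Rint_sum P (index_enum _)); last first.
  by move=> i; apply: (bmf_sum (index_enum _)) => j; exact: bij.
by congr (_ / _); apply: eq_bigr => i _; rewrite (Rint_sum P (index_enum _)).
Qed.

Lemma variance_ergodic_avg (f : W -> R) N : bmf f ->
  \int[P]_x ((ergodic_avg tau f N.+1 x - \int[P]_y f y) ^+ 2) =
  avg2 (fun i j => \int[P]_x (f (iter i tau x) * f (iter j tau x))) N.+1 -
  (\int[P]_y f y) ^+ 2.
Proof.
move=> bf; set c := \int[P]_y f y; have ba := bmf_ergodic_avg mtau N.+1 bf.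
rewrite -Rint_ergodic_avgM//.
rewrite (@eq_Rint _ _ _ _ _ (fun x => (ergodic_avg tau f N.+1 x *
  ergodic_avg tau f N.+1 x + (- (2 * c)) * ergodic_avg tau f N.+1 x) + c ^+ 2)).
  rewrite !RintD ?Rint_cst ?RintZ ?Rint_ergodic_avg//; last first.
  - exact: bmf_cst.
  - by apply: bmfD; [exact: bmfM|exact: bmfZ].
  - exact: bmfZ.
  - exact: bmfM.
  - by rewrite -/c; ring.
by move=> x; ring.
Qed.

Lemma ergodic_mean_ergodic (a : W -> R) : ergodic P tau ->
  measurable_fun setT a -> mean_ergodic P tau a.
Proof.
move=> erg ma r; set f := fun y => cos (a y + r).
have bf : bmf f by apply: bmf_cos; exact: measurable_funD.
have bl := bmf_birkhoff_limit mtau bf.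
have := birkhoff_cvgM mtau tau_P bf bf.
rewrite (_ : \int[P]_x (birkhoff_limit tau f x * birkhoff_limit tau f x) =
  (\int[P]_y f y) ^+ 2); last first.
  have binv x : birkhoff_limit tau f (tau x) = birkhoff_limit tau f x.
    exact: birkhoff_limit_invariant.
  have := ergodic_invariant_cst erg bl binv.
  rewrite Rint_birkhoff_limit// => h.
  rewrite (@Rint_ae _ _ _ P _ (fun=> (\int[P]_y f y) ^+ 2)) ?Rint_cst//.
  - by case: (bmfM bl bl).
  - by apply: filterS h => x ->; rewrite expr2.
move=> h; rewrite -(subrr ((\int[P]_y f y) ^+ 2)).
have {h} := cvgB h (cvg_cst ((\int[P]_y f y) ^+ 2)).
rewrite -cvg_shiftS => h; rewrite -cvg_shiftS.
rewrite (_ : (fun n => _) = (fun n => \int[P]_x (ergodic_avg tau f n.+1 x *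
  ergodic_avg tau f n.+1 x) - (\int[P]_y f y) ^+ 2)); first exact: h.
by apply/funext => N; rewrite variance_ergodic_avg// Rint_ergodic_avgM.
Qed.

(* If A is invariant, then integrating a function over A amounts to           *)
(* integrating its ergodic averages, so the restriction of P to A and the     *)
(* multiple P(A) P of P have the same Fourier transform.                      *)
Lemma mean_ergodic_ergodic (L : set (W -> R)) :
  L (fun=> 0) -> (forall a b, L a -> L b -> L (fun x => a x + b x)) ->
  (forall c a, L a -> L (fun x => c * a x)) ->
  (forall a, L a -> measurable_fun setT a) ->
  (measurable `<=` <<s [set A | exists (a : W -> R) (B : set R),
     [/\ L a, measurable B & A = a @^-1` B]] >>) ->
  (forall a, L a -> mean_ergodic P tau a) -> ergodic P tau.
Proof.
move=> L0 LD LZ Lm Lgen Lerg A mA Ainv.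
have bA : bmf (\1_A : W -> R) by exact: bmf_indic.
have iA x : (\1_A : W -> R) (tau x) = \1_A x.
  rewrite !indicE; congr (_%:R); congr nat_of_bool.
  apply/idP/idP; rewrite !inE => h; first by rewrite -Ainv.
  by move: h; rewrite -{1}Ainv.
set p : R := fine (P A).
have key a r : L a -> \int[P]_x (\1_A x * cos (a x + r)) =
                      \int[P]_x (p * cos (a x + r)).
  move=> La; set f := fun y => cos (a y + r); set c := \int[P]_y f y.
  have bf : bmf f by apply: bmf_cos; apply: measurable_funD => //; exact: Lm.
  rewrite RintZ// -/c.
  have ba N := bmf_ergodic_avg mtau N bf.
  have bac N : bmf (fun x => ergodic_avg tau f N x - c).
    by apply: bmfB => //; exact: bmf_cst.
  have e N : \int[P]_x (\1_A x * f x) - p * c =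
             \int[P]_x (\1_A x * (ergodic_avg tau f N.+1 x - c)).
    rewrite (@eq_Rint _ _ _ _ (fun x => _ * (_ - _)) (fun x => \1_A x *
      ergodic_avg tau f N.+1 x - c * \1_A x)); last by move=> x; ring.
    rewrite RintB ?RintZ ?Rint_indic//; last 2 first.
    - exact: bmfM.
    - exact: bmfZ.
    rewrite (mulrC c); congr (_ - _).
    rewrite -(Rint_ergodic_avg mtau tau_P N (bmfM bA bf)); apply: eq_Rint => x.
    rewrite /ergodic_avg mulrA; congr (_ / _); rewrite mulr_sumr.
    apply: eq_bigr => i _; congr (_ * _).
    by elim: (nat_of_ord i) => //= k ih; rewrite iA.
  apply/eqP; rewrite -subr_eq0 -sqrf_eq0; apply/eqP.
  apply/eqP; rewrite eq_le sqr_ge0 andbT.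
  have h := Lerg a La r; rewrite -/f -/c in h.
  rewrite -(cvg_lim _ h)//; apply: limr_ge; first exact: cvgP h.
  exists 1%N => // -[|N] _//=; rewrite (e N).
  apply: (le_trans (Rint_CS P bA (bac N.+1))).
  rewrite ler_piMl//; first by apply: Rint_ge0 => x; exact: sqr_ge0.
  rewrite -(Rint_cst P 1); apply: le_Rint; [exact: bmfX|exact: bmf_cst|].
  by move=> x; rewrite indicE; case: (_ \in _); rewrite ?expr1n// expr0n.
have := charfun_unique_weighted bA (bmf_cst W p) (@measurable_id _ _ setT)
  (@measurable_id _ _ setT) L0 LD LZ Lm Lgen key mA.
rewrite RintZ// Rint_indic// -/p.
rewrite (@eq_Rint _ _ _ _ _ (\1_A : W -> R)); last first.
  by move=> x; rewrite indicE; case: (_ \in _); rewrite ?mulr1 ?mulr0.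
rewrite Rint_indic// -/p => /eqP; rewrite eq_sym -subr_eq0.
rewrite (_ : p * p - p = p * (p - 1)); last by ring.
have pE : P A = p%:E by rewrite /p fineK// fin_num_measure.
rewrite mulf_eq0 subr_eq0 => /orP[|] /eqP pe; [left|right];
  by rewrite pE pe.
Qed.

Lemma Rint_cos_sin_iter (a : W -> R) r i j : measurable_fun setT a ->
  \int[P]_x (cos (a (iter i tau x) + r) * cos (a (iter j tau x) + r)) +
  \int[P]_x (sin (a (iter i tau x) + r) * sin (a (iter j tau x) + r)) =
  complex.Re (charfun P (fun x => a (iter i tau x) - a (iter j tau x))).
Proof.
move=> ma; have mi n : measurable_fun setT (fun x => a (iter n tau x) + r).
  apply: measurable_funD => //; exact: measurableT_comp ma (measurable_iter mtau n).
rewrite -RintD; last 2 first.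
- by apply: bmfM; exact: bmf_cos.
- by apply: bmfM; exact: bmf_sin.
apply: eq_Rint => x; rewrite -cosB; congr cos; ring.
Qed.

(** The charfun of the difference is the correlation of [exp(i a)] at times [i] and [j], and the
    constant is its value under independence: this is weak mixing of the single function [exp(i a)].
    Written with charfuns, it behaves well under products and convolutions. *)
Definition wmix (a : W -> R) : Prop :=
  avg2 (fun i j => sqn (charfun P (fun x => a (iter i tau x) - a (iter j tau x)) -
    Complex (sqn (charfun P a)) 0)) N @[N --> \oo] --> 0.

(** The variances of the averages of cosine and sine add up to the average of the real parts of the
    deviations, and a real part [x] is at most [eps / 2 + x^2 / (2 eps)], which [wmix] controls. *)
Lemma wmix_mean_ergodic (a : W -> R) : measurable_fun setT a -> wmix a ->
  mean_ergodic P tau a.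
Proof.
move=> ma wa r.
set f := fun y => cos (a y + r); set g := fun y => sin (a y + r).
have mr : measurable_fun setT (fun y => a y + r) by exact: measurable_funD.
have bf : bmf f by exact: bmf_cos.
have bg : bmf g by exact: bmf_sin.
have cs : (\int[P]_y f y) ^+ 2 + (\int[P]_y g y) ^+ 2 = sqn (charfun P a).
  rewrite Rint_cosD// Rint_sinD// /sqn -[RHS]mulr1 -(cos2Dsin2 r); ring.
have e N : \int[P]_x ((ergodic_avg tau f N.+1 x - \int[P]_y f y) ^+ 2) +
    \int[P]_x ((ergodic_avg tau g N.+1 x - \int[P]_y g y) ^+ 2) =
  avg2 (fun i j => complex.Re (charfun P (fun x => a (iter i tau x) - a (iter j tau x)) -
    Complex (sqn (charfun P a)) 0)) N.+1.
  rewrite !variance_ergodic_avg//.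
  rewrite addrACA -avg2D -opprD cs -{1}(avg2_cst (sqn (charfun P a)) N).
  rewrite -mulN1r -avg2Z -avg2D; congr avg2; apply/funext => i; apply/funext => j.
  rewrite Rint_cos_sin_iter//.
  by move: (charfun P (fun _ => _ - _)) => [x y] /=; rewrite mulN1r.
have v0 h N : 0 <= \int[P]_x ((ergodic_avg tau h N.+1 x - \int[P]_y h y) ^+ 2).
  by apply: Rint_ge0 => x; exact: sqr_ge0.
apply/cvgr0Pnorm_lt => eps eps0.
have /cvgr0Pnorm_lt/(_ (eps ^+ 2))[|N0 _ hN0] := wa; first by rewrite exprn_gt0.
exists N0.+1 => // -[|N]//= NN; rewrite ger0_norm//.
have := hN0 N.+1 (ltnW NN); rewrite ger0_norm; last first.
  by apply: avg2_ge0 => i j; exact: sqn_ge0.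
set D := avg2 _ _ => Dlt.
apply: (@le_lt_trans _ _ (eps / 2 + (2 * eps)^-1 * D)); last first.
  have : (2 * eps)^-1 * D < eps / 2.
    rewrite mulrC ltr_pdivrMr ?mulr_gt0// (_ : eps / 2 * (2 * eps) = eps ^+ 2)//.
    by field.
  lra.
have := e N; have := v0 g N; set X := (X in 0 <= X) => X0 eX.
apply: (@le_trans _ _ (\int[P]_x ((ergodic_avg tau f N.+1 x - \int[P]_y f y) ^+ 2) + X)).
  by rewrite lerDl.
rewrite eX /D -(avg2_cst (eps / 2) N) -avg2Z -avg2D; apply: le_avg2 => i j.
move: (_ - _) => [x y]; rewrite /sqn/=.
rewrite -subr_ge0 (_ : _ - _ = (2 * eps)^-1 * ((x - eps) ^+ 2 + y ^+ 2)).
  by rewrite mulr_ge0 ?invr_ge0 ?addr_ge0 ?sqr_ge0// mulr_ge0// ltW.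
by field; rewrite gt_eqF.
Qed.

Lemma wmix_ge0 (a : W -> R) N :
  0 <= avg2 (fun i j => sqn (charfun P (fun x => a (iter i tau x) - a (iter j tau x)) -
    Complex (sqn (charfun P a)) 0)) N.
Proof. by apply: avg2_ge0 => i j; exact: sqn_ge0. Qed.

End one_system.

Lemma wmix_iter d (W : measurableType d) (P : probability W R) (tau : W -> W) m a :
  (0 < m)%N -> wmix P tau a -> wmix P (iter m tau) a.
Proof.
move=> m0 wa; have h : m%:R ^+ 2 * avg2 (fun i j => sqn (charfun P
    (fun x => a (iter i tau x) - a (iter j tau x)) -
    Complex (sqn (charfun P a)) 0)) (m * N)%N @[N --> \oo] --> 0.
  rewrite -[X in _ --> X](mulr0 (m%:R ^+ 2)); apply: cvgM; first exact: cvg_cst.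
  apply: (@cvg_comp _ _ _ (fun N => m * N)%N); last exact: wa.
  apply/cvgnyPge => A; exists A => // N /= AN.
  by rewrite (leq_trans AN)// leq_pmull.
apply: squeeze_cvgr (cvg_cst 0) h; apply: nearW => N; rewrite wmix_ge0/=.
have := @avg2_multiples R (fun i j => sqn (charfun P
    (fun x => a (iter i tau x) - a (iter j tau x)) -
    Complex (sqn (charfun P a)) 0)) m N m0 (fun _ _ => sqn_ge0 _).
apply: le_trans; apply: le_avg2 => i j; rewrite le_eqVlt; apply/orP; left.
by under eq_charfun do rewrite -!iterM; rewrite mulnC (mulnC m j).
Qed.

(** Correlations multiply, and [z1 z2 - w1 w2 = (z1 - w1) z2 + w1 (z2 - w2)] with all moduli at most
    1. *)
Lemma wmix_prod d1 d2 (W1 : measurableType d1) (W2 : measurableType d2)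
  (P1 : probability W1 R) (P2 : probability W2 R) (tau1 : W1 -> W1)
  (tau2 : W2 -> W2) (a1 : W1 -> R) (a2 : W2 -> R) :
  measurable_fun setT tau1 -> measurable_fun setT tau2 ->
  measurable_fun setT a1 -> measurable_fun setT a2 ->
  wmix P1 tau1 a1 -> wmix P2 tau2 a2 ->
  wmix (P1 \x P2)%E (pair_map tau1 tau2) (fun z => a1 z.1 + a2 z.2).
Proof.
move=> mt1 mt2 m1 m2 w1 w2.
rewrite /wmix; move: w1 w2; rewrite /wmix; set D1 := avg2 _; set D2 := avg2 _.
move=> w1 w2; have h : 2 * D1 N + 2 * D2 N @[N --> \oo] --> 0.
  rewrite [X in _ --> X](_ : _ = 2 * 0 + 2 * 0); last by rewrite mulr0 addr0.
  by apply: cvgD; apply: cvgM => //; exact: cvg_cst.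
move: h; rewrite {w1 w2}/D1 /D2 => h.
apply: squeeze_cvgr (cvg_cst 0) h; apply: nearW => N; rewrite wmix_ge0/=.
rewrite -!avg2Z -avg2D; apply: le_avg2 => i j.
have md k d (W : measurableType d) (tau : W -> W) (a : W -> R) l :
    measurable_fun setT tau -> measurable_fun setT a ->
    measurable_fun setT (fun x => a (iter k tau x) - a (iter l tau x)).
  move=> mt ma; apply: measurable_funB.
    exact: (measurableT_comp ma (measurable_iter mt k)).
  exact: (measurableT_comp ma (measurable_iter mt l)).
rewrite (@eq_charfun _ _ _ _ _ (fun z =>
  (a1 (iter i tau1 z.1) - a1 (iter j tau1 z.1)) +
  (a2 (iter i tau2 z.2) - a2 (iter j tau2 z.2)))); last first.
  by move=> z; rewrite !iter_pair_map/=; ring.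
rewrite (charfun_prod _ _ (md i _ _ _ _ j mt1 m1) (md i _ _ _ _ j mt2 m2)).
rewrite charfun_prod// sqnM.
have z21 := sqn_charfun_le1 P2 (md i _ _ _ _ j mt2 m2).
have w11 := sqn_charfun_le1 P1 m1; have w10 := sqn_ge0 (charfun P1 a1).
move: (charfun P1 (fun _ => _ - _)) (charfun P2 (fun _ => _ - _)) z21 => z1 z2 z21.
move: (sqn (charfun P1 a1)) (sqn (charfun P2 a2)) w11 w10 => w1 w2 w11 w10.
rewrite (_ : z1 * z2 - _ = (z1 - Complex w1 0) * z2 +
    Complex w1 0 * (z2 - Complex w2 0)); last first.
  rewrite (_ : Complex (w1 * w2) 0 = Complex w1 0 * Complex w2 0); last first.
    by rewrite complexM !mulr0 mul0r subr0 addr0.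
  by ring.
apply: (le_trans (sqnD_le _ _ ltr01)); rewrite invr1 !sqnM sqn_real.
have w12 : w1 ^+ 2 <= 1 by rewrite exprn_ile1.
have q1 := sqn_ge0 (z1 - Complex w1 0); have q2 := sqn_ge0 (z2 - Complex w2 0).
rewrite [1 + 1](_ : _ = 2)// lerD// ler_wpM2l//.
  by rewrite ler_piMr.
by rewrite ler_piMl.
Qed.

(* Integrating out the second coordinate multiplies the phase function by the *)
(* constant charfun P2 a2.                                                    *)
Lemma mean_ergodic_fst d1 d2 (W1 : measurableType d1) (W2 : measurableType d2)
  (P1 : probability W1 R) (P2 : probability W2 R) (tau1 : W1 -> W1)
  (tau2 : W2 -> W2) (a1 : W1 -> R) (a2 : W2 -> R) :
  measurable_fun setT tau1 -> measurable_fun setT tau2 ->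
  eq_meas (pushforward P2 tau2) P2 ->
  measurable_fun setT a1 -> measurable_fun setT a2 ->
  charfun P2 a2 != 0 ->
  mean_ergodic (P1 \x P2)%E (pair_map tau1 tau2) (fun z => a1 z.1 + a2 z.2) ->
  mean_ergodic P1 tau1 a1.
Proof.
move=> mt1 mt2 t2P m1 m2 c0 h r.
have q0 := sqn_gt0 c0; have [t ct _] := polar (charfun P2 a2).
move: q0 ct; set q := sqn _; set rho := Num.sqrt q => q0 ct.
have rr : rho ^+ 2 = q by rewrite sqr_sqrtr// ltW.
set f := fun y => cos (a1 y + r); set c := \int[P1]_y f y.
have bf : bmf f by apply: bmf_cos; exact: measurable_funD.
have {h} := h (r - t).
set F := fun z => cos (a1 z.1 + a2 z.2 + (r - t)); set C := \int[_]_y F y => h.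
have bF : bmf F.
  apply: bmf_cos; apply: measurable_funD => //; apply: measurable_funD.
    exact: measurableT_comp.
  exact: measurableT_comp.
have FE n y : \int[P2]_z F (y, iter n tau2 z) = rho * f y.
  have bn := measurable_iter mt2 n.
  have bFy : bmf (fun z => F (y, z)) by apply: bmf_comp bF; exact: pair1_measurable.
  rewrite (Rint_iter mt2 t2P n bFy) /F/=.
  rewrite (@eq_Rint _ _ _ _ _ (fun z => cos (a2 z + (a1 y + r - t)))); last first.
    by move=> z; congr cos; ring.
  rewrite Rint_cosD// ct/= /f cosB sinB.
  rewrite -[X in _ = rho * X]mulr1 -(cos2Dsin2 t); ring.
have mT := measurable_pair_map mt1 mt2.
have bA N : bmf (ergodic_avg (pair_map tau1 tau2) F N) by exact: bmf_ergodic_avg.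
have ba N : bmf (ergodic_avg tau1 f N) by exact: bmf_ergodic_avg.
have AE N y : \int[P2]_z ergodic_avg (pair_map tau1 tau2) F N (y, z) =
              rho * ergodic_avg tau1 f N y.
  rewrite /ergodic_avg; under eq_Rint do rewrite mulrC.
  have bi i : bmf (fun z => F (iter i (pair_map tau1 tau2) (y, z))).
    apply: bmf_comp (bmf_iter mT i bF); exact: pair1_measurable.
  rewrite RintZ; last exact: (bmf_sum (index_enum _)).
  rewrite (Rint_sum P2 (index_enum _))// mulrC mulrA mulr_sumr; congr (_ / _).
  apply: eq_bigr => i _; rewrite -(FE i); apply: eq_Rint => z.
  by rewrite iter_pair_map.
have CE : C = rho * c.
  rewrite /C Rint_fubini// -RintZ//; apply: eq_Rint => y; exact: (FE 0%N).
have {}h : q^-1 * \int[(P1 \x P2)%E]_x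
    ((ergodic_avg (pair_map tau1 tau2) F N x - C) ^+ 2) @[N --> \oo] --> 0.
  by rewrite -[X in _ --> X](mulr0 q^-1); apply: cvgM => //; exact: cvg_cst.
apply: squeeze_cvgr (cvg_cst 0) h; apply: nearW => N.
rewrite Rint_ge0//=; last by move=> x; exact: sqr_ge0.
rewrite ler_pdivlMl// -RintZ; last first.
  by apply: bmfX; apply: bmfB => //; exact: bmf_cst.
have bAC : bmf (fun z => ergodic_avg (pair_map tau1 tau2) F N z - C).
  by apply: bmfB => //; exact: bmf_cst.
rewrite Rint_fubini; last exact: bmfX.
apply: le_Rint.
- by apply/bmfZ/bmfX/bmfB => //; exact: bmf_cst.
- exact: (bmf_Rint2 P1 P2 (bmfX 2 bAC)).
move=> y; have bACy : bmf (fun z => ergodic_avg (pair_map tau1 tau2) F N (y, z) - C).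
  by apply: bmf_comp bAC; exact: pair1_measurable.
apply: le_trans (Rint_sqr_le P2 bACy); rewrite RintB; last 2 first.
- by apply: bmf_comp (bA N); exact: pair1_measurable.
- exact: bmf_cst.
by rewrite AE Rint_cst CE -mulrBr exprMn rr.
Qed.
End mean_ergodic.

(** * Correlations under an ergodic convolution square *)

Lemma cvg_sqrB_comb (R : realType) (f g h : nat -> R) (x y z : R) :
  f @ \oo --> x -> g @ \oo --> y -> h @ \oo --> z ->
  f N - 2 * g N + h N @[N --> \oo] --> x - 2 * y + z.
Proof.
move=> fx gy hz; apply: cvgD; last exact: hz.
by apply: cvgB; [exact: fx|apply: cvgM; [exact: cvg_cst|exact: gy]].
Qed.

Section correlation_bound.
Context {R : realType} d (W : measurableType d) (P : probability W R).
Variables (tau : W -> W) (a : W -> R).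
Hypotheses (mtau : measurable_fun setT tau)
  (tau_P : eq_meas (pushforward P tau) P) (ma : measurable_fun setT a)
  (erg : ergodic P tau)
  (me2 : mean_ergodic (P \x P)%E (pair_map tau tau) (fun z => a z.1 + a z.2))
  (c0 : charfun P a != 0).

Let q := sqn (charfun P a).
Let eps := q^-1 - 1.
Let q0 : 0 < q. Proof. exact: sqn_gt0. Qed.

Let t : R := sval (cid2 (polar (charfun P a))).
Let ct : charfun P a = Complex (Num.sqrt q * cos t) (Num.sqrt q * sin t).
Proof. by rewrite /t; case: cid2. Qed.

Let rho := Num.sqrt q.
Let rho0 : 0 < rho. Proof. by rewrite sqrtr_gt0. Qed.
Let rho_neq0 : rho != 0. Proof. by rewrite gt_eqF. Qed.
Let rr : rho ^+ 2 = q. Proof. by rewrite sqr_sqrtr// ltW. Qed.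

Let v x := cos (a x - t).
Let s x := sin (a x - t).
Let mat : measurable_fun setT (fun x => a x - t).
Proof. exact: measurable_funB. Qed.
Let bv : bmf v. Proof. exact: bmf_cos. Qed.
Let bs : bmf s. Proof. exact: bmf_sin. Qed.

Let Ev : \int[P]_x v x = rho.
Proof.
rewrite /v Rint_cosD// ct/= cosN sinN -[RHS]mulr1 -(cos2Dsin2 t) -/rho; ring.
Qed.

Let Es : \int[P]_x s x = 0.
Proof. rewrite /s Rint_sinD// ct/= cosN sinN -/rho; ring. Qed.

(* u1 + i u2 = exp(i a) / charfun P a - 1; as 1 + u1 + i u2 has constant      *)
(* modulus, the real part u1 is of the order of the square of the modulus.    *)
Let u1 x := v x / rho - 1.
Let u2 x := s x / rho.
Let bu1 : bmf u1.
Proof. by apply: bmfB; [apply: bmfM => //|]; exact: bmf_cst. Qed.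
Let bu2 : bmf u2. Proof. by apply: bmfM => //; exact: bmf_cst. Qed.

Let Eu1 : \int[P]_x u1 x = 0.
Proof.
rewrite RintB; [|by apply: bmfM => //; exact: bmf_cst|exact: bmf_cst].
under eq_Rint do rewrite mulrC.
by rewrite RintZ// Ev Rint_cst mulVf// subrr.
Qed.

Let Eu2 : \int[P]_x u2 x = 0.
Proof. by under eq_Rint do rewrite /u2 mulrC; rewrite RintZ// Es mulr0. Qed.

Let u_eq x : u1 x ^+ 2 + u2 x ^+ 2 = eps - 2 * u1 x.
Proof.
rewrite /u1 /u2 /eps -rr.
have -> : rho ^- 2 = (v x ^+ 2 + s x ^+ 2) / rho ^+ 2 by rewrite cos2Dsin2 div1r.
by field.
Qed.

Let Eu : \int[P]_x (u1 x ^+ 2) + \int[P]_x (u2 x ^+ 2) = eps.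
Proof.
rewrite -RintD; [|exact: bmfX|exact: bmfX].
under eq_Rint do rewrite u_eq.
by rewrite RintB ?Rint_cst ?RintZ// ?Eu1 ?mulr0 ?subr0//; [exact: bmf_cst|exact: bmfZ].
Qed.

Let Eu1_ge0 : 0 <= \int[P]_x (u1 x ^+ 2).
Proof. by apply: Rint_ge0 => x; exact: sqr_ge0. Qed.

Let Eu2_ge0 : 0 <= \int[P]_x (u2 x ^+ 2).
Proof. by apply: Rint_ge0 => x; exact: sqr_ge0. Qed.

Let eps_ge0 : 0 <= eps. Proof. by rewrite -Eu addr_ge0. Qed.

(** By [u_eq], [|u1|] is at most half of [eps + |u|^2], and [|u|^2] has mean [eps]. A general
    function of variance [eps] would only give the square root of [eps]. *)
Let Eu1_abs : \int[P]_x `|u1 x| <= eps.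
Proof.
apply: (@le_trans _ _ (\int[P]_x (eps / 2 + 2^-1 * (u1 x ^+ 2 + u2 x ^+ 2)))).
  apply: le_Rint; first exact: bmf_norm.
    apply: bmfD; first exact: bmf_cst.
    by apply/bmfZ/bmfD; exact: bmfX.
  move=> x; have := u_eq x; have := sqr_ge0 (u1 x); have := sqr_ge0 (u2 x).
  have := eps_ge0.
  by rewrite ler_norml => ? ? ? ?; apply/andP; split; lra.
rewrite RintD; [|exact: bmf_cst|by apply/bmfZ/bmfD; exact: bmfX].
rewrite Rint_cst RintZ; last by apply: bmfD; exact: bmfX.
by rewrite RintD; [rewrite Eu; lra|exact: bmfX|exact: bmfX].
Qed.

Let tau2 := pair_map tau tau.
Let PP : probability _ R := (P \x P)%E.
Let mtau2 : measurable_fun setT tau2. Proof. exact: measurable_pair_map. Qed.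
Let tau2_PP : eq_meas (pushforward PP tau2) PP.
Proof. exact: pair_map_preserving. Qed.

Let f (u : W -> R) (z : W * W) := u z.1 * u z.2.
Let bf u : bmf u -> bmf (f u).
Proof. by move=> bu; apply: bmfM; exact: bmf_comp bu. Qed.

Let F u := birkhoff_limit tau2 (f u).
Let bF u : bmf u -> bmf (F u).
Proof. by move=> bu; apply: bmf_birkhoff_limit => //; exact: bf. Qed.

Let corr (u w : W -> R) i j :=
  \int[P]_x (u (iter i tau x) * w (iter j tau x)).

(** The square of a correlation under [P] is a correlation under [P \x P] of tensor squares, so
    Birkhoff limits on the product compute the mean square correlations. *)
Let corrE u w N : bmf u -> bmf w ->
  avg2 (fun i j => corr u w i j ^+ 2) N =
  \int[PP]_z (ergodic_avg tau2 (f u) N z * ergodic_avg tau2 (f w) N z).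
Proof.
move=> bu bw; rewrite Rint_ergodic_avgM//; [|exact: bf|exact: bf].
congr avg2; apply/funext => i; apply/funext => j.
have b : bmf (fun x => u (iter i tau x) * w (iter j tau x)).
  by apply: bmfM; exact: bmf_iter.
rewrite expr2 -(Rint_prodM P P b b); apply: eq_Rint => z.
by rewrite !iter_pair_map /f/=; ring.
Qed.

Let corr_cvg u w : bmf u -> bmf w ->
  avg2 (fun i j => corr u w i j ^+ 2) N @[N --> \oo] --> \int[PP]_z (F u z * F w z).
Proof.
move=> bu bw; have := birkhoff_cvgM mtau2 tau2_PP (bf bu) (bf bw).
rewrite (_ : (fun N => _) = (fun N => avg2 (fun i j => corr u w i j ^+ 2) N))//.
by apply/funext => N; rewrite corrE.
Qed.

Let x11 := \int[PP]_z (F u1 z * F u1 z).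
Let x12 := \int[PP]_z (F u1 z * F u2 z).
Let x22 := \int[PP]_z (F u2 z * F u2 z).

(* The real part of exp(i (a z.1 + a z.2)) has convergent ergodic averages.   *)
Let x_eq : x11 - 2 * x12 + x22 = 0.
Proof.
pose w z := cos (a z.1 + a z.2 + (- t - t)).
have wE z : w z = v z.1 * v z.2 - s z.1 * s z.2.
  by rewrite /w /v /s -cosD; congr cos; ring.
have bw : bmf w.
  apply: bmf_cos; apply: measurable_funD => //.
  by apply: measurable_funD; exact: measurableT_comp.
have Ew : \int[PP]_z w z = rho ^+ 2.
  under eq_Rint do rewrite wE.
  rewrite RintB; [|exact: (bf bv)|exact: (bf bs)].
  by rewrite (Rint_prodM P P bv bv) (Rint_prodM P P bs bs) Ev Es mulr0 subr0.
have h1 := me2 (- t - t); rewrite -/w -/PP -/tau2 Ew in h1.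
have h2 := ergodic_mean_ergodic mtau tau_P erg ma (- t); rewrite -/v Ev in h2.
pose A N z := ergodic_avg tau2 w N z - rho ^+ 2.
pose B N x := ergodic_avg tau v N x - rho.
have bA N : bmf (A N).
  by apply: bmfB; [exact: bmf_ergodic_avg|exact: bmf_cst].
have bB N : bmf (B N).
  by apply: bmfB; [exact: bmf_ergodic_avg|exact: bmf_cst].
have bB1 N : bmf (fun z : W * W => B N z.1) by apply: bmf_comp (bB N).
have bB2 N : bmf (fun z : W * W => B N z.2) by apply: bmf_comp (bB N).
(* Writing [u] and [u'] for [u1 + i u2] at the two coordinates, this averages the real part of [u u'
   = (1 + u)(1 + u') - (1 + u) - (1 + u') + 1]. Here [A] tends to 0 in mean square by [me2], and [B]
   by ergodicity of [P]. *)
have GE N z : ergodic_avg tau2 (f u1) N.+1 z - ergodic_avg tau2 (f u2) N.+1 z =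
    A N.+1 z / rho ^+ 2 - B N.+1 z.1 / rho - B N.+1 z.2 / rho.
  rewrite /A /B /ergodic_avg.
  have e : \sum_(i < N.+1) f u1 (iter i tau2 z) - \sum_(i < N.+1) f u2 (iter i tau2 z)
    = (\sum_(i < N.+1) w (iter i tau2 z)) / rho ^+ 2
    - (\sum_(i < N.+1) v (iter i tau z.1)) / rho
    - (\sum_(i < N.+1) v (iter i tau z.2)) / rho + N.+1%:R.
    elim: (N.+1) => [|n ih]; first by rewrite !big_ord0; ring.
    rewrite !big_ord_recr/= -natr1.
    move: ih; set S1 := \sum_(_ < _) _; set S2 := \sum_(_ < _) _.
    set S3 := \sum_(_ < _) _; set S4 := \sum_(_ < _) _; set S5 := \sum_(_ < _) _.
    move=> ih; rewrite [LHS](_ : _ = (S1 - S2) +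
      (f u1 (iter n tau2 z) - f u2 (iter n tau2 z))); last by ring.
    rewrite ih wE !iter_pair_map /f /u1 /u2/=; field.
    by [].
  have nR : N.+1%:R != 0 :> R by rewrite pnatr_eq0.
  rewrite -mulrBl e; move: (N.+1%:R) nR => n0 nR; field.
  by rewrite rho_neq0 nR.
have lim1 := corr_cvg bu1 bu1; have lim2 := corr_cvg bu1 bu2.
have lim3 := corr_cvg bu2 bu2.
pose G N := avg2 (fun i j => corr u1 u1 i j ^+ 2) N -
   2 * avg2 (fun i j => corr u1 u2 i j ^+ 2) N +
   avg2 (fun i j => corr u2 u2 i j ^+ 2) N.
have limG : G N @[N --> \oo] --> x11 - 2 * x12 + x22.
  exact: (cvg_sqrB_comb lim1 lim2 lim3).
have GG N : G N.+1 = \int[PP]_z ((A N.+1 z / rho ^+ 2 - B N.+1 z.1 / rho -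
    B N.+1 z.2 / rho) ^+ 2).
  rewrite /G !corrE//.
  have b1 := bmf_ergodic_avg mtau2 N.+1 (bf bu1).
  have b2 := bmf_ergodic_avg mtau2 N.+1 (bf bu2).
  under [RHS]eq_Rint do rewrite -GE.
  rewrite -RintZ; last exact: bmfM.
  rewrite -RintB; [|exact: bmfM|by apply/bmfZ/bmfM].
  rewrite -RintD; [|by apply: bmfB; [exact: bmfM|apply/bmfZ/bmfM]|exact: bmfM].
  by apply: eq_Rint => z; ring.
have limG0 : G N.+1 @[N --> \oo] --> 0.
  have h : 3 * (rho ^- 4 * \int[PP]_z (A N z ^+ 2) +
      2 * rho ^- 2 * \int[P]_x (B N x ^+ 2)) @[N --> \oo] --> 0.
    rewrite [X in _ --> X](_ : _ = 3 * (rho ^- 4 * 0 + 2 * rho ^- 2 * 0)).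
      apply: cvgM; first exact: cvg_cst.
      by apply: cvgD; apply: cvgM => //; exact: cvg_cst.
    by rewrite !mulr0 addr0 mulr0.
  rewrite -cvg_shiftS in h.
  apply: squeeze_cvgr (cvg_cst 0) h; apply: nearW => N; rewrite GG.
  rewrite Rint_ge0/=; last by move=> z; exact: sqr_ge0.
  have e1 : \int[PP]_z (B N.+1 z.1 ^+ 2) = \int[P]_x (B N.+1 x ^+ 2).
    rewrite Rint_fubini; last exact: bmfX.
    by apply: eq_Rint => x; rewrite /= Rint_cst.
  have e2 : \int[PP]_z (B N.+1 z.2 ^+ 2) = \int[P]_x (B N.+1 x ^+ 2).
    by rewrite Rint_fubini/= ?Rint_cst//; exact: bmfX.
  rewrite (_ : 3 * _ = \int[PP]_z (3 * (rho ^- 4 * A N.+1 z ^+ 2 +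
      rho ^- 2 * (B N.+1 z.1 ^+ 2 + B N.+1 z.2 ^+ 2)))); last first.
    have b1 : bmf (fun z : W * W => B N.+1 z.1 ^+ 2 + B N.+1 z.2 ^+ 2).
      by apply: bmfD; exact: bmfX.
    rewrite RintZ; last by apply: bmfD; [apply/bmfZ/bmfX|exact: bmfZ].
    rewrite RintD; [|by apply/bmfZ/bmfX|exact: bmfZ].
    rewrite RintZ; last exact: bmfX.
    rewrite RintZ// RintD ?e1 ?e2; [|exact: bmfX|exact: bmfX].
    by congr (_ * _); ring.
  apply: le_Rint.
  - apply: bmfX; apply: bmfB; last by apply: bmfM => //; exact: bmf_cst.
    by apply: bmfB; apply: bmfM => //; exact: bmf_cst.
  - apply/bmfZ/bmfD; first by apply/bmfZ/bmfX.
    by apply/bmfZ/bmfD; exact: bmfX.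
  move=> z; move: (A N.+1 z) (B N.+1 z.1) (B N.+1 z.2) => x y y'.
  have -> : 3 * (rho ^- 4 * x ^+ 2 + rho ^- 2 * (y ^+ 2 + y' ^+ 2)) =
     3 * ((x / rho ^+ 2) ^+ 2 + (y / rho) ^+ 2 + (y' / rho) ^+ 2) by field.
  move: (x / rho ^+ 2) (y / rho) (y' / rho) => {}x {}y {}y'.
  have := sqr_ge0 (x + y); have := sqr_ge0 (x + y'); have := sqr_ge0 (y - y').
  by rewrite !expr2; lra.
rewrite (cvg_shiftS G) in limG0.
exact: (cvg_unique _ limG limG0).
Qed.

Let x11_ge0 : 0 <= x11.
Proof. by apply: Rint_ge0 => z; rewrite -expr2 sqr_ge0. Qed.

(** Equality in the arithmetic-geometric inequality: [2 x12 = x11 + x22] while [x12^2 <= x11 x22].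
    The correlations of [u2], a priori of lower order, are thereby tied to those of [u1]. *)
Let x_eqs : x12 = x11 /\ x22 = x11.
Proof.
have cs : x12 ^+ 2 <= x11 * x22.
  have h := Rint_CS PP (bF bu1) (bF bu2).
  have sq u : \int[PP]_z (F u z ^+ 2) = \int[PP]_z (F u z * F u z).
    by apply: eq_Rint => z; rewrite expr2.
  by rewrite !sq in h; exact: h.
have e := x_eq.
have : (x11 - x22) ^+ 2 <= 0.
  have -> : (x11 - x22) ^+ 2 = (2 * x12) ^+ 2 - 4 * (x11 * x22).
    by rewrite (_ : 2 * x12 = x11 + x22); [ring|lra].
  by rewrite exprMn; lra.
move=> h; have /eqP := le_anti (introT andP (conj h (sqr_ge0 _))).
by rewrite sqrf_eq0 subr_eq0 => /eqP x12e; split; lra.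
Qed.

(** [F u1] is invariant under the product map and [P] under [tau]. By ergodicity of [P] the squared
    norm of the sections is then almost surely constant. *)
Let F1_section x : \int[P]_y (F u1 (tau x, y) ^+ 2) = \int[P]_y (F u1 (x, y) ^+ 2).
Proof.
have b y : bmf (fun z => F u1 (y, z) ^+ 2).
  by apply: bmfX; apply: bmf_comp (bF bu1); exact: pair1_measurable.
rewrite -[LHS](Rint_invariant mtau tau_P (b _)); apply: eq_Rint => y.
congr (_ ^+ 2); have := birkhoff_limit_invariant tau2 (x, y) (bf bu1).
exact.
Qed.

(** By the conditional expectation property, [x11] is the integral of [u1 x * w x]. Cauchy-Schwarz
    on sections of constant norm bounds [|w|] by the square root of [eps * x11], and [|u1|] has mean
    at most [eps]; dividing by the square root of [x11] leaves [eps^(3/2)]. *)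
Let x11_le : x11 <= eps ^+ 3.
Proof.
have e1 : x11 = \int[PP]_z (f u1 z * F u1 z).
  rewrite /x11 /F (Rint_birkhoff_limitM mtau2 tau2_PP (bf bu1) (bF bu1))//.
  by move=> z; apply: birkhoff_limit_invariant => //; exact: bf.
pose g x := \int[P]_y (F u1 (x, y) ^+ 2).
have bg : bmf g by exact: (bmf_Rint2 P P (bmfX 2 (bF bu1))).
have Eg : \int[P]_x g x = x11.
  transitivity (\int[PP]_z (F u1 z ^+ 2)); last first.
    by apply: eq_Rint => z; rewrite expr2.
  by rewrite [RHS]Rint_fubini//; exact: bmfX 2 (bF bu1).
have gae := ergodic_invariant_cst erg bg F1_section; rewrite Eg in gae.
have bFx x : bmf (fun y => F u1 (x, y)).
  by apply: bmf_comp (bF bu1); exact: pair1_measurable.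
pose w x := \int[P]_y (u1 y * F u1 (x, y)).
have bw : bmf w.
  have b : bmf (fun z => u1 z.2 * F u1 z).
    by apply: bmfM; [exact: bmf_comp bu1|exact: bF].
  exact: (bmf_Rint2 P P b).
have we x : w x ^+ 2 <= \int[P]_y (u1 y ^+ 2) * g x by exact: Rint_CS.
have e2 : x11 = \int[P]_x (u1 x * w x).
  rewrite e1 Rint_fubini; last by apply: bmfM; [exact: bf|exact: bF].
  apply: eq_Rint => x; rewrite -RintZ; last exact: bmfM.
  by apply: eq_Rint => y; rewrite /f/= mulrA.
pose k := Num.sqrt (eps * x11).
have kk : k ^+ 2 = eps * x11 by rewrite sqr_sqrtr// mulr_ge0.
have k0 : 0 <= k by exact: sqrtr_ge0.
have wae : {ae P, forall x, `|w x| <= k}.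
  apply: filterS gae => x gx; rewrite -(ler_pXn2r (ltn0Sn 1)) ?nnegrE//.
  rewrite real_normK ?num_real// kk (le_trans (we x))// gx ler_wpM2r//.
  by have := Eu; have := Eu2_ge0; lra.
have : x11 <= k * eps.
  apply: (@le_trans _ _ (\int[P]_x (k * `|u1 x|))); last first.
    by rewrite RintZ ?ler_wpM2l//; exact: bmf_norm.
  rewrite (le_trans (ler_norm _))// e2 (le_trans (norm_Rint P (bmfM bu1 bw)))//.
  (* The minimum turns the almost sure bound on [w] into one valid at every point, as [le_Rint]
     requires. *)
  rewrite (@Rint_ae _ _ _ P _ (fun x => Num.min (k * `|u1 x|) `|u1 x * w x|)).
  - apply: le_Rint; last by move=> x; rewrite ge_min lexx.
    + split; first apply: measurable_minr.
      * by case: (bmfZ k (bmf_norm bu1)).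
      * by case: (bmf_norm (bmfM bu1 bw)).
      * have [_ [M hM]] := bmf_norm (bmfM bu1 bw); exists M => x.
        rewrite ger0_norm; last by rewrite le_min normr_ge0 mulr_ge0.
        by rewrite ge_min; apply/orP; right; rewrite (le_trans _ (hM x))// ler_norm.
    + by apply/bmfZ; exact: bmf_norm.
  - by case: (bmf_norm (bmfM bu1 bw)).
  - apply: measurable_minr; first by case: (bmfZ k (bmf_norm bu1)).
    by case: (bmf_norm (bmfM bu1 bw)).
  - apply: filterS wae => x wx; rewrite min_r// normrM mulrC ler_wpM2r//.
move=> h; have [->|xn0] := eqVneq x11 0; first by rewrite exprn_ge0.
have xp : 0 < x11 by rewrite lt_neqAle eq_sym xn0.
rewrite -(ler_pM2l xp).
have -> : x11 * eps ^+ 3 = (k * eps) ^+ 2 by rewrite exprMn kk; ring.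
by rewrite -expr2 ler_pXn2r ?nnegrE// mulr_ge0.
Qed.

(** The normalized correlation minus 1 is the mean of [u] at time [i] times the conjugate of [u] at
    time [j]. Its real and imaginary parts are a sum and a difference of two real correlations,
    whose squares all average to [x11 <= eps^3] in the limit. *)
Lemma correlation_bound : forall delta : R, 0 < delta ->
  \forall N \near \oo,
  avg2 (fun i j => sqn (charfun P (fun x => a (iter i tau x) - a (iter j tau x)) *
    Complex (sqn (charfun P a))^-1 0 - 1)) N <=
  8 * ((sqn (charfun P a))^-1 - 1) ^+ 3 + delta.
Proof.
move=> delta delta0; rewrite -/q -/eps.
have [e12 e22] := x_eqs.
have lim1 := corr_cvg bu1 bu1; have lim2 := corr_cvg bu1 bu2.
have lim3 := corr_cvg bu2 bu2.
rewrite -/x11 -/x12 -/x22 e12 e22 in lim1 lim2 lim3.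
have d0 : 0 < delta / 8 by rewrite divr_gt0.
have ev u w : avg2 (fun i j => corr u w i j ^+ 2) N @[N --> \oo] --> x11 ->
    \forall N \near \oo, avg2 (fun i j => corr u w i j ^+ 2) N < eps ^+ 3 + delta / 8.
  move=> /cvgrPdist_lt/(_ _ d0); apply: filterS => N.
  by rewrite ltr_norml => /andP[h _]; have := x11_le; lra.
near=> N.
have l1 : avg2 (fun i j => corr u1 u1 i j ^+ 2) N < eps ^+ 3 + delta / 8.
  by near: N; exact: ev.
have l2 : avg2 (fun i j => corr u1 u2 i j ^+ 2) N < eps ^+ 3 + delta / 8.
  by near: N; exact: ev.
have l3 : avg2 (fun i j => corr u2 u2 i j ^+ 2) N < eps ^+ 3 + delta / 8.
  by near: N; exact: ev.
(* The factor 2 comes from [(c + c')^2 <= 2 (c^2 + c'^2)]; four averages, each below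
   [eps^3 + delta / 8], give the constants 8 and [delta]. *)
apply: (@le_trans _ _ (2 * (avg2 (fun i j => corr u1 u1 i j ^+ 2) N +
  avg2 (fun i j => corr u2 u2 i j ^+ 2) N + avg2 (fun i j => corr u1 u2 i j ^+ 2) N
  + avg2 (fun i j => corr u1 u2 j i ^+ 2) N))); last first.
  by rewrite (avg2_tr (fun i j => corr u1 u2 i j ^+ 2)); lra.
rewrite -!avg2D -avg2Z; apply: le_avg2 => i j.
have bi n (u : W -> R) : bmf u -> bmf (fun x => u (iter n tau x)) by exact: bmf_iter.
have E1 n : \int[P]_x u1 (iter n tau x) = 0 by rewrite Rint_iter.
have E2 n : \int[P]_x u2 (iter n tau x) = 0 by rewrite Rint_iter.
have vE x : v x = rho * (1 + u1 x) by rewrite /u1; field.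
have sE x : s x = rho * u2 x by rewrite /u2; field.
have b1 n : bmf (fun x => u1 (iter n tau x)) by exact: (bi n u1 bu1).
have b2 n : bmf (fun x => u2 (iter n tau x)) by exact: (bi n u2 bu2).
have b11 := bmfM (b1 i) (b1 j); have b22 := bmfM (b2 i) (b2 j).
have b12 := bmfM (b1 i) (b2 j); have b21 := bmfM (b1 j) (b2 i).
have shift x : a (iter i tau x) - a (iter j tau x) =
    (a (iter i tau x) - t) - (a (iter j tau x) - t) by ring.
have ReE : \int[P]_x cos (a (iter i tau x) - a (iter j tau x)) =
    q * (1 + corr u1 u1 i j + corr u2 u2 i j).
  have bc := bmfD (bmf_cst W 1) (b1 i); have bd := bmfD bc (b1 j).
  transitivity (\int[P]_x (q * (1 + u1 (iter i tau x) + u1 (iter j tau x)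
     + u1 (iter i tau x) * u1 (iter j tau x) + u2 (iter i tau x) * u2 (iter j tau x)))).
    apply: eq_Rint => x; rewrite shift cosB -/(v _) -/(v _) -/(s _) -/(s _).
    by rewrite !vE !sE -rr; ring.
  rewrite (RintZ P q (bmfD (bmfD bd b11) b22)) (RintD P (bmfD bd b11) b22).
  rewrite (RintD P bd b11) (RintD P bc (b1 j)) (RintD P (bmf_cst W 1) (b1 i)).
  by rewrite Rint_cst !E1 !addr0.
have ImE : \int[P]_x sin (a (iter i tau x) - a (iter j tau x)) =
    q * (corr u1 u2 j i - corr u1 u2 i j).
  have bc := bmfB (b2 i) (b2 j); have bd := bmfB b21 b12.
  transitivity (\int[P]_x (q * (u2 (iter i tau x) - u2 (iter j tau x)
     + (u1 (iter j tau x) * u2 (iter i tau x) - u1 (iter i tau x) * u2 (iter j tau x))))).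
    apply: eq_Rint => x; rewrite shift sinB -/(v _) -/(v _) -/(s _) -/(s _).
    by rewrite !vE !sE -rr; ring.
  rewrite (RintZ P q (bmfD bc bd)) (RintD P bc bd).
  by rewrite (RintB P (b2 i) (b2 j)) (RintB P b21 b12) !E2 subrr add0r.
rewrite /charfun ReE ImE complexM.
have qn0 : q != 0 by rewrite gt_eqF.
move: (corr u1 u1 i j) (corr u2 u2 i j) (corr u1 u2 j i) (corr u1 u2 i j).
move=> c1 c2 c3 c4.
rewrite (_ : Complex _ _ - 1 = Complex (c1 + c2) (c3 - c4)); last first.
  by apply/eqP; rewrite eq_complex /=; apply/andP; split; apply/eqP; field.
rewrite /sqn/=; have h1 := sqr_ge0 (c1 - c2); have h2 := sqr_ge0 (c3 + c4).
by rewrite !expr2 in h1 h2 *; lra.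
Unshelve. all: by end_near. Qed.

End correlation_bound.

(** * Roots of infinitely divisible laws *)

Section linear_functionals.
Context {R : realType}.
Implicit Types (a b : Zseq R -> R) (P Q : probability (Zseq R) R).

(** These functionals are the space [L] of the uniqueness theorem. The axiomatic form, in place of
    finite combinations of coordinates, makes stability under the shift immediate. *)
Definition mlinear a : Prop :=
  [/\ measurable_fun setT a,
      forall x y : Zseq R, a (fun n => x n + y n) = a x + a y &
      forall (c : R) (x : Zseq R), a (fun n => c * x n) = c * a x].

Lemma mlinear_measurable a : mlinear a -> measurable_fun setT a.
Proof. by case. Qed.

Lemma mlinear0 : mlinear (fun=> 0).
Proof. by split=> *; rewrite ?addr0 ?mulr0//; exact: measurable_cst. Qed.

Lemma mlinearD a b : mlinear a -> mlinear b -> mlinear (fun x => a x + b x).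
Proof.
move=> [ma aD aZ] [mb bD bZ]; split; first exact: measurable_funD.
- by move=> x y; rewrite aD bD addrACA.
- by move=> c x; rewrite aZ bZ mulrDr.
Qed.

Lemma mlinearZ c a : mlinear a -> mlinear (fun x => c * a x).
Proof.
move=> [ma aD aZ]; split; first exact: measurable_funM.
- by move=> x y; rewrite aD mulrDr.
- by move=> e x; rewrite aZ mulrCA.
Qed.

Lemma mlinearB a b : mlinear a -> mlinear b -> mlinear (fun x => a x - b x).
Proof.
move=> La Lb; rewrite (_ : (fun _ => _) = (fun x => a x + -1 * b x)).
  by apply: mlinearD => //; exact: mlinearZ.
by apply/funext => x; rewrite mulN1r.
Qed.

Lemma mlinear_coord (n : int) : mlinear (fun x => x n).
Proof. by split => //; exact: measurable_coord. Qed.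

Lemma mlinear_shift a : mlinear a -> mlinear (fun x => a (Zshift x)).
Proof.
move=> [ma aD aZ]; split; first exact: measurableT_comp ma (@measurable_Zshift R).
- by move=> x y; rewrite -aD.
- by move=> c x; rewrite -aZ.
Qed.

Lemma mlinear_iter a n : mlinear a -> mlinear (fun x => a (iter n (@Zshift R) x)).
Proof.
move=> La; elim: n => [|n ih]//=.
rewrite (_ : (fun _ => _) = (fun x => a (iter n (@Zshift R) (Zshift x)))).
  exact: mlinear_shift ih.
by apply/funext => x; rewrite -iterSr.
Qed.

Lemma mlinear_vanish a : mlinear a -> a (fun=> 0) = 0.
Proof.
move=> [_ _ aZ]; rewrite -[RHS](mul0r (a (fun=> 0))) -aZ.
by congr a; apply/funext => n; rewrite mul0r.
Qed.

Lemma mlinear_gen : measurable `<=` <<s [set A | exists a (B : set R),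
  [/\ mlinear a, measurable B & A = a @^-1` B]] >>.
Proof.
apply: smallest_sub; first exact: smallest_sigma_algebra.
move=> _ [n [B [mB ->]]]; apply: sub_sigma_algebra.
by exists (fun x => x n), B; split => //; exact: mlinear_coord.
Qed.

Lemma charfun_convolution P Q a : mlinear a ->
  charfun (convolution P Q) a = charfun P a * charfun Q a.
Proof.
move=> [ma aD _]; rewrite -charfun_prod//.
rewrite -(@charfun_comp _ _ _ _ _ (P \x Q)%E _ (@Zseq_add R))//.
by apply: eq_charfun => x; rewrite -aD.
Qed.

Lemma charfun_convolution_power P a k : mlinear a ->
  charfun (convolution_power P k) a = charfun P a ^+ k.
Proof.
move=> La; elim: k => [|k ih] /=; last by rewrite charfun_convolution// ih exprS.
rewrite expr0 /charfun; have a0 := mlinear_vanish La; have [ma _ _] := La.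
have D (f : Zseq R -> R) : measurable_fun setT f ->
    \int[dirac ((fun=> 0) : Zseq R)]_x f x = f (fun=> 0).
  move=> mf; rewrite /Rintegral integral_dirac//; last exact/measurable_EFinP.
  by rewrite diracT mul1e.
by rewrite (D _ (bmf_cos ma).1) (D _ (bmf_sin ma).1) a0 cos0 sin0.
Qed.

Lemma charfun_unique P Q : (forall a, mlinear a -> charfun P a = charfun Q a) ->
  eq_meas P Q.
Proof.
move=> h A mA.
have b1 : bmf (fun _ : Zseq R => 1 : R) by exact: bmf_cst.
have mid := @measurable_id _ (Zseq R) setT.
have := charfun_unique_weighted (m1 := P) (m2 := Q) b1 b1 mid mid mlinear0 mlinearD
   mlinearZ mlinear_measurable mlinear_gen _ mA.
have -> (M : probability (Zseq R) R) :
    \int[M]_x (1 * \1_A x : R) = fine (M A).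
  by rewrite -Rint_indic//; apply: eq_Rint => x; rewrite mul1r.
have -> (M : probability (Zseq R) R) :
    \int[M]_x (1 * \1_A x : R) = fine (M A).
  by rewrite -Rint_indic//; apply: eq_Rint => x; rewrite mul1r.
move=> e; have {}e : fine (P A) = fine (Q A).
  apply: e => a r La; have ma := mlinear_measurable La.
  under eq_Rint do rewrite mul1r; under [RHS]eq_Rint do rewrite mul1r.
  by rewrite !Rint_cosD// h.
by rewrite -[LHS]fineK ?fin_num_measure// e fineK// fin_num_measure.
Qed.

Lemma charfun_eq_meas P Q a : eq_meas P Q -> charfun P a = charfun Q a.
Proof. by move=> PQ; rewrite /charfun !(eq_meas_Rint _ PQ). Qed.

Lemma charfun_stationary P a : stationary P -> mlinear a ->
  charfun P (fun x => a (Zshift x)) = charfun P a.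
Proof.
by move=> sP [ma _ _]; rewrite (charfun_comp (@measurable_Zshift R) sP).
Qed.

End linear_functionals.

(** * Zeros and roots of characteristic functionals *)

Section doubling.
Context {R : realType} d (W : measurableType d) (P : probability W R).
Variables (a : W -> R).
Hypothesis ma : measurable_fun setT a.

Let sqnE c : sqn (charfun P (fun x => c * a x)) =
  \int[(P \x P)%E]_z cos (c * (a z.1 - a z.2)).
Proof.
have mca : measurable_fun setT (fun x => c * a x) by exact: measurable_funM.
have mnca : measurable_fun setT (fun x => - (c * a x)) by exact: measurableT_comp.
have := charfun_prod P P mca mnca.
rewrite charfunN// => /(congr1 (@complex.Re _)) e.
have -> : sqn (charfun P (fun x => c * a x)) =
    complex.Re (charfun P (fun x => c * a x) * conjc (charfun P (fun x => c * a x))).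
  by case: (charfun P _) => x y; rewrite /sqn/=; ring.
by rewrite -e /=; apply: eq_Rint => z; congr cos; ring.
Qed.

(** With [D] the difference of two independent copies of [a], the squared modulus is the mean of
    [cos D], and [1 - cos (2 D) = 2 (1 - cos D)(1 + cos D) <= 4 (1 - cos D)]. *)
Lemma sqn_charfun_double :
  1 - sqn (charfun P (fun x => 2 * a x)) <= 4 * (1 - sqn (charfun P a)).
Proof.
have -> : charfun P a = charfun P (fun x => 1 * a x).
  by apply: eq_charfun => x; rewrite mul1r.
rewrite !sqnE.
have mc c : bmf (fun z : W * W => cos (c * (a z.1 - a z.2))).
  apply: bmf_cos; apply: measurable_funM => //.
  by apply: measurable_funB; exact: measurableT_comp.
have b1 : bmf (fun z : W * W => 1 : R) by exact: bmf_cst.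
have e c : 1 - \int[(P \x P)%E]_z cos (c * (a z.1 - a z.2)) =
    \int[(P \x P)%E]_z (1 - cos (c * (a z.1 - a z.2))).
  by rewrite RintB// Rint_cst.
rewrite !e -RintZ; last exact: bmfB.
apply: le_Rint; [exact: bmfB|by apply/bmfZ; exact: bmfB|].
move=> z; rewrite mul1r (_ : 2 * _ = (a z.1 - a z.2) *+ 2); last by rewrite mulr_natl.
rewrite cos_mulr2n; move: (cos _) (cos_le1 (a z.1 - a z.2)) (cos_geN1 (a z.1 - a z.2)).
by move=> c c1 cN1; rewrite mulr2n; nra.
Qed.

Lemma charfun_scale_neq0 : exists n, charfun P (fun x => 2^-1 ^+ n * a x) != 0.
Proof.
have h : \int[P]_x cos (2^-1 ^+ n * a x) @[n --> \oo] --> \int[P]_x (1 : R).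
  have mn n : measurable_fun setT (fun x => 2^-1 ^+ n * a x).
    exact: measurable_funM.
  apply: (@Rint_bcvg _ _ _ P _ _ 1).
  - by move=> n; case: (bmf_cos (mn n)).
  - by move=> n x; exact: cos_max.
  - exact: measurable_cst.
  - apply: aeW => x; rewrite -[X in _ --> X](@cos0 R).
    apply: continuous_cvg; first exact: continuous_cos.
    rewrite -[X in _ --> X](mul0r (a x)); apply: cvgM; last exact: cvg_cst.
    have half : `|2^-1 : R| < 1 by rewrite ger0_norm; lra.
    exact: cvg_expr half.
rewrite Rint_cst in h.
have /cvgrPdist_lt/(_ 1 ltr01)[N _ hN] := h.
exists N; have := hN N (leqnn N); apply: contraTneq => /(congr1 (@complex.Re _)) /= ->.
by rewrite subr0 normr1 ltxx.
Qed.

Lemma continuous_charfun_ray : continuous (fun t : R => \int[P]_x cos (t * a x)) /\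
  continuous (fun t : R => \int[P]_x sin (t * a x)).
Proof.
have mt t : measurable_fun setT (fun x => t * a x) by exact: measurable_funM.
have ct x : continuous (fun t : R => t * a x) by move=> t; exact: mulrr_continuous.
have i1 : P.-integrable setT (EFin \o fun=> 1) by exact/bmf_integrable/bmf_cst.
split=> t.
- apply: (@continuity_under_integral R _ W P (fun t x => cos (t * a x)) setT
    measurableT (t - 1) (t + 1) _ _ (fun=> 1) i1).
  + by move=> s _; exact/bmf_integrable/bmf_cos.
  + apply/aeW => x _ s _.
    by apply: continuous_comp; [exact: ct|exact: continuous_cos].
  + by move=> s _; apply/aeW => x _; exact: cos_max.
  + by rewrite inE/= in_itv/= ltrBlDr ltrDl ltr01.
- apply: (@continuity_under_integral R _ W P (fun t x => sin (t * a x)) setT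
    measurableT (t - 1) (t + 1) _ _ (fun=> 1) i1).
  + by move=> s _; exact/bmf_integrable/bmf_sin.
  + apply/aeW => x _ s _.
    by apply: continuous_comp; [exact: ct|exact: continuous_sin].
  + by move=> s _; apply/aeW => x _; exact: sin_max.
  + by rewrite inE/= in_itv/= ltrBlDr ltrDl ltr01.
Qed.

End doubling.

Section finite_range.
Context {R : realType}.

(** By the intermediate value theorem a non-constant [f] would take the infinitely many values
    [f 0 + (f t - f 0) / (n + 1)]. *)
Lemma continuous_finite_range_cst (f : R -> R) (s : seq R) : continuous f ->
  (forall t, f t \in s) -> forall t, 0 <= t -> f t = f 0.
Proof.
move=> cf fs t t0; apply/eqP; apply: contrapT => /negP ne.
have inj : {in [pred n : nat | true] &, injective
   (fun n : nat => f 0 + (f t - f 0) / n.+1%:R)}.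
  move=> i j _ _ /addrI /(mulfI _) h; apply/eqP.
  have /eqP := h ltac:(by rewrite subr_eq0).
  by rewrite (inj_eq invr_inj) eqr_nat eqSS.
have hs n : f 0 + (f t - f 0) / n.+1%:R \in s.
  have n0 : 0 < n.+1%:R :> R by rewrite ltr0n.
  have k0 : 0 < n.+1%:R^-1 :> R by rewrite invr_gt0.
  have k1 : n.+1%:R^-1 <= 1 :> R by rewrite invf_le1// ler1n.
  have [||c _ <-] := @IVT R f 0 t (f 0 + (f t - f 0) / n.+1%:R) t0.
  - by apply: continuous_subspaceT.
  - rewrite le_max ge_min.
    have [h|h] := leP (f 0) (f t).
      apply/andP; split; apply/orP; [left|right].
        by rewrite lerDl mulr_ge0 ?subr_ge0// ltW.
      by rewrite -lerBrDl ler_piMr ?subr_ge0.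
    apply/andP; split; apply/orP; [right|left].
      by rewrite -lerBlDl; move: (n.+1%:R^-1) k0 k1 => k k0 k1; nra.
    by rewrite gerDl; move: (n.+1%:R^-1) k0 k1 => k k0 k1; nra.
  - exact: fs.
pose l := [seq f 0 + (f t - f 0) / n.+1%:R | n <- iota 0 (size s).+1].
have ul : uniq l by rewrite map_inj_in_uniq ?iota_uniq// => i j _ _; exact: inj.
have := uniq_leq_size ul (_ : {subset l <= s}).
rewrite size_map size_iota ltnn => h; suff : false by [].
by apply: h => _ /mapP[n _ ->]; exact: hs.
Qed.

End finite_range.

Section infinitely_divisible_processes.
Context {R : realType}.
Implicit Types (a : Zseq R -> R) (P Q : probability (Zseq R) R).

Lemma charfun_root P Q k a : eq_meas P (convolution_power Q k) -> mlinear a ->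
  charfun Q a ^+ k = charfun P a.
Proof.
by move=> PQ La; rewrite -charfun_convolution_power//; exact/esym/charfun_eq_meas.
Qed.

(** Bernoulli for [x^-1]. Applied to squared moduli, it says that the charfun of a k-th root has
    modulus within [O(1/k)] of 1. *)
Lemma inv_sub1_le (x b : R) k : 0 < x -> x ^+ k = b^-1 -> 0 < b ->
  (x^-1 - 1) *+ k <= b - 1.
Proof.
move=> x0 xk b0; have := @bernoulli_ineq R (x^-1 - 1) k.
rewrite [1 + (_ - 1)]addrC subrK exprVn xk invrK => h.
rewrite lerBrDr addrC; apply: h; rewrite lerBrDr addrC subrr invr_ge0 ltW//.
Qed.

(** For a k-th root with [k > 4 (b - 1)], the defect of the squared modulus at [a] is below 1/4, so
    doubling leaves it below 1 at [2 a]. *)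
Lemma ID_charfun_double P a : infinitely_divisible P -> mlinear a ->
  charfun P a != 0 -> charfun P (fun x => 2 * a x) != 0.
Proof.
move=> idP La c0; have q0 := sqn_gt0 c0; have ma := mlinear_measurable La.
set b := (sqn (charfun P a))^-1; have b0 : 0 < b by rewrite invr_gt0.
have [k k1 hk] : exists2 k, (1 <= k)%N & 4 * (b - 1) < k%:R.
  exists (Num.truncn `|4 * (b - 1)|).+1 => //.
  by rewrite (le_lt_trans (ler_norm _))// truncnS_gt.
have [Q PQ] := idP k k1; have La2 := mlinearZ 2 La.
rewrite -(charfun_root PQ La2) expf_neq0//.
have x0 : 0 < sqn (charfun Q a).
  apply: sqn_gt0; apply: contra_neq c0 => c0.
  by rewrite -(charfun_root PQ La) c0 expr0n eqn0Ngt k1.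
have xk : sqn (charfun Q a) ^+ k = b^-1.
  by rewrite -sqnX (charfun_root PQ La) invrK.
have h := inv_sub1_le x0 xk b0; have dbl := sqn_charfun_double Q ma.
have x1 := sqn_charfun_le1 Q ma.
apply/eqP => z0; move: dbl; rewrite z0 (sqn_real 0) expr0n/= subr0.
have k0 : 0 < k%:R :> R by rewrite ltr0n.
have : (1 - sqn (charfun Q a)) * k%:R <= b - 1.
  apply: le_trans h; rewrite -(mulr_natr (_ - _)) ler_wpM2r//.
  rewrite -(ler_pM2l x0) !mulrBr mulfV ?gt_eqF//.
  by have := sqr_ge0 (sqn (charfun Q a) - 1); rewrite expr2; lra.
move: (sqn _) (k%:R : R) x0 x1 k0 hk => x n x0 x1 n0 hn h1 h2.
have : n <= 4 * ((1 - x) * n) by nra.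
lra.
Qed.

(** The charfun is non-zero at [2^-n a] for some [n] by continuity at 0; doubling [n] times returns
    to [a]. *)
Lemma ID_charfun_neq0 P a : infinitely_divisible P -> mlinear a ->
  charfun P a != 0.
Proof.
move=> idP La; have ma := mlinear_measurable La.
have [n] := charfun_scale_neq0 P ma; elim: n => [|n ih].
  by under eq_charfun do rewrite expr0 mul1r.
move=> /(ID_charfun_double idP (mlinearZ _ La)) h; apply: ih.
rewrite (@eq_charfun _ _ _ _ _ (fun x => 2^-1 ^+ n * a x)) in h => //.
by move=> x; rewrite exprS mulrA mulrA mulfV ?mul1r// pnatr_eq0.
Qed.

Lemma unity_roots_finite k : (0 < k)%N ->
  exists s : seq R[i], forall z : R[i], z ^+ k = 1 -> z \in s.
Proof.
move=> k0; have [s hs] := closed_field_poly_normal ('X^k - 1%:P : {poly R[i]}).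
exists s => z zk; rewrite -root_prod_XsubC.
have p0 : lead_coef ('X^k - 1%:P : {poly R[i]}) != 0.
  by rewrite lead_coef_eq0 -size_poly_eq0 size_XnsubC.
by rewrite -(rootZ _ _ p0) -hs rootE hornerD hornerN hornerXn hornerC zk subrr.
Qed.

(* The quotient of two k-th roots of a nowhere vanishing charfun is           *)
(* continuous along each ray and takes values in the finite set of k-th roots *)
(* of unity, hence is constant, equal to its value 1 at 0.                    *)
Lemma charfun_root_unique Q1 Q2 k : (0 < k)%N ->
  (forall a, mlinear a -> charfun Q2 a != 0) ->
  (forall a, mlinear a -> charfun Q1 a ^+ k = charfun Q2 a ^+ k) ->
  forall a, mlinear a -> charfun Q1 a = charfun Q2 a.
Proof.
move=> k0 n0 e a La; have ma := mlinear_measurable La.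
pose z t := charfun Q1 (fun x => t * a x); pose w t := charfun Q2 (fun x => t * a x).
have wn0 t : w t != 0 by exact/n0/mlinearZ.
have rk t : (z t / w t) ^+ k = 1.
  rewrite expr_div_n [z t ^+ k]e; last exact: mlinearZ.
  by rewrite divff// expf_neq0// wn0.
pose f t := complex.Re (z t / w t).
have fE t : f t = (complex.Re (z t) * complex.Re (w t) +
    complex.Im (z t) * complex.Im (w t)) / sqn (w t).
  rewrite /f /sqn; case: (z t) => x y; case: (w t) => x' y' /=; ring.
have [s hs] := unity_roots_finite k0.
have fs t : f t \in [seq complex.Re u | u <- s] by apply: map_f; exact/hs/rk.
have [cz1 cz2] := continuous_charfun_ray Q1 ma.
have [cw1 cw2] := continuous_charfun_ray Q2 ma.
have cf : continuous f.
  move=> t; rewrite (_ : f = fun t => (complex.Re (z t) * complex.Re (w t) +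
    complex.Im (z t) * complex.Im (w t)) / sqn (w t)); last exact/funext.
  have sq0 : sqn (w t) != 0 by rewrite gt_eqF// sqn_gt0.
  apply: cvgM; last apply: cvgV => //.
    by apply: cvgD; apply: cvgM; [exact: cz1|exact: cw1|exact: cz2|exact: cw2].
  by apply: cvgD; rewrite expr2; under eq_fun do rewrite expr2;
    apply: cvgM; [exact: cw1|exact: cw1|exact: cw2|exact: cw2].
have f01 : f 0 = 1.
  rewrite /f (_ : z 0 = 1); last first.
    rewrite /z /charfun; under eq_Rint do rewrite mul0r cos0.
    by under [X in Complex _ X]eq_Rint do rewrite mul0r sin0; rewrite !Rint_cst.
  rewrite (_ : w 0 = 1) ?divr1//.
  rewrite /w /charfun; under eq_Rint do rewrite mul0r cos0.
  by under [X in Complex _ X]eq_Rint do rewrite mul0r sin0; rewrite !Rint_cst.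
have f1 := continuous_finite_range_cst cf fs (@ler01 R); rewrite f01 in f1.
have : sqn (z 1 / w 1) = 1.
  apply/eqP; rewrite -(@pexpr_eq1 _ _ k) ?sqn_ge0//.
  by rewrite -sqnX rk sqn1.
rewrite /sqn -/(f 1) f1 expr1n => /eqP.
rewrite -subr_eq0 addrAC subrr add0r sqrf_eq0 => /eqP im0.
have : z 1 / w 1 = 1.
  by move: im0 f1; rewrite /f; case: (z 1 / w 1) => x y /= -> ->.
move=> /(congr1 (fun u => u * w 1)); rewrite divfK// mul1r /z /w.
by under eq_charfun do rewrite mul1r; under [RHS]eq_charfun do rewrite mul1r.
Qed.

(** The shifted law of [Q] is again a k-th root of the stationary law [P], hence equals [Q]. *)
Lemma root_stationary P Q k : (0 < k)%N ->
  (forall a, mlinear a -> charfun P a != 0) -> stationary P ->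
  eq_meas P (convolution_power Q k) -> stationary Q.
Proof.
move=> k0 n0 sP PQ.
have mS := @measurable_Zshift R.
pose S : {mfun Zseq R >-> Zseq R} :=
  HB.pack (@Zshift R) (isMeasurableFun.Build _ _ _ _ (@Zshift R) mS).
suff : eq_meas (distribution Q S) Q by [].
apply: charfun_unique => a La.
have e b : mlinear b -> charfun (distribution Q S) b =
    charfun Q (fun x => b (Zshift x)).
  by move=> [mb _ _]; rewrite (@charfun_comp _ _ _ _ _ Q (distribution Q S)).
have Qn0 b : mlinear b -> charfun Q b != 0.
  move=> Lb; apply: contra_neq (n0 b Lb) => h.
  by rewrite -(charfun_root PQ Lb) h expr0n eqn0Ngt k0.
apply: (charfun_root_unique k0 Qn0) => // b Lb.
rewrite e// (charfun_root PQ (mlinear_shift Lb)) (charfun_root PQ Lb).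
exact: charfun_stationary.
Qed.

(** Addition is a factor map commuting with the shifts, so mean ergodicity of [exp(i a)] lifts to
    functions of the sum; the product itself is not claimed to be ergodic. *)
Lemma mean_ergodic_convolution Q1 Q2 a : mlinear a ->
  mean_ergodic (convolution Q1 Q2) (@Zshift R) a ->
  mean_ergodic (Q1 \x Q2)%E (pair_map (@Zshift R) (@Zshift R))
    (fun z => a z.1 + a z.2).
Proof.
move=> La h r; have [ma aD _] := La; move: (h r).
pose f x := cos (a x + r); have bf : bmf f.
  by apply: bmf_cos; exact: measurable_funD.
have E (g : Zseq R -> R) : bmf g ->
    \int[convolution Q1 Q2]_x g x = \int[(Q1 \x Q2)%E]_z g (Zseq_add z).
  exact: Rint_distribution.
have addS n z : Zseq_add (iter n (pair_map (@Zshift R) (@Zshift R)) z) =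
    iter n (@Zshift R) (Zseq_add z).
  by elim: n => //= n <-.
have aA z : a (Zseq_add z) = a z.1 + a z.2 by rewrite -aD.
rewrite E//.
rewrite (_ : (fun N => _) = (fun N => \int[(Q1 \x Q2)%E]_x
  ((ergodic_avg (pair_map (@Zshift R) (@Zshift R))
     (fun y => cos (a y.1 + a y.2 + r)) N x -
   \int[(Q1 \x Q2)%E]_y (cos (a y.1 + a y.2 + r))) ^+ 2)))//.
apply/funext => N; rewrite E; last first.
  apply: bmfX; apply: bmfB; last exact: bmf_cst.
  exact: (bmf_ergodic_avg (@measurable_Zshift R) N bf).
apply: eq_Rint => z; congr ((_ - _) ^+ 2); last first.
  by apply: eq_Rint => y; rewrite /f aA.
rewrite /ergodic_avg; congr (_ / _); apply: eq_bigr => i _.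
by rewrite -addS aA.
Qed.

End infinitely_divisible_processes.

Section root_weakly_mixing.
Context {R : realType}.
Variable P : probability (Zseq R) R.
Hypotheses (sP : stationary P) (erg : ergodic P (@Zshift R))
  (idP : infinitely_divisible P).

Let Pn0 a : mlinear a -> charfun P a != 0.
Proof. exact: ID_charfun_neq0. Qed.

Lemma root_charfun_neq0 (Q : probability (Zseq R) R) k a : (0 < k)%N ->
  eq_meas P (convolution_power Q k) -> mlinear a -> charfun Q a != 0.
Proof.
move=> k0 PQ La; apply: contra_neq (Pn0 La) => h.
by rewrite -(charfun_root PQ La) h expr0n eqn0Ngt k0.
Qed.

Let mean_ergodicP a : mlinear a -> mean_ergodic P (@Zshift R) a.
Proof.
by move=> [ma _ _]; exact: ergodic_mean_ergodic (@measurable_Zshift R) sP _ erg ma.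
Qed.

Lemma mean_ergodic_eq_meas (P1 P2 : probability (Zseq R) R) tau a :
  eq_meas P1 P2 -> mean_ergodic P1 tau a -> mean_ergodic P2 tau a.
Proof.
move=> e h r; have := h r; rewrite (eq_meas_Rint _ e).
by under eq_fun do rewrite (eq_meas_Rint _ e).
Qed.

(** Lift to the product, then integrate out the second summand, whose charfun is non-zero because
    that of [P] is. *)
Lemma factor_mean_ergodic (Q1 Q2 : probability (Zseq R) R) a :
  eq_meas P (convolution Q1 Q2) -> stationary Q2 ->
  mlinear a -> mean_ergodic Q1 (@Zshift R) a.
Proof.
move=> PQ sQ2 La; have [ma _ _] := La; have mS := @measurable_Zshift R.
apply: (mean_ergodic_fst mS mS sQ2 ma ma).
  apply: contra_neq (Pn0 La) => h.
  by rewrite (charfun_eq_meas _ PQ) charfun_convolution// h mulr0.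
by apply: mean_ergodic_convolution => //; exact: mean_ergodic_eq_meas PQ (mean_ergodicP La).
Qed.

End root_weakly_mixing.

(** * Weak mixing of the roots *)

Section root_wmix.
Context {R : realType}.
Variable P : probability (Zseq R) R.
Hypotheses (sP : stationary P) (erg : ergodic P (@Zshift R))
  (idP : infinitely_divisible P).

Let mS := @measurable_Zshift R.

Lemma stationary_convolution_power (Q : probability (Zseq R) R) j :
  stationary Q -> stationary (convolution_power Q j).
Proof.
move=> sQ; pose S : {mfun Zseq R >-> Zseq R} :=
  HB.pack (@Zshift R) (isMeasurableFun.Build _ _ _ _ (@Zshift R) mS).
suff : eq_meas (distribution (convolution_power Q j) S) (convolution_power Q j) by [].
apply: charfun_unique => a La; have [ma _ _] := La.
rewrite -(@charfun_comp _ _ _ _ _ (convolution_power Q j)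
  (distribution (convolution_power Q j) S) (@Zshift R))//.
rewrite !charfun_convolution_power//; last exact: mlinear_shift.
by rewrite charfun_stationary.
Qed.

(** Uniqueness of roots makes [Q0] the l-th power of a finer root [Q], to which [correlation_bound]
    applies with [eps <= K / l]. Taking l-th powers of the correlations costs [l^2], leaving
    [8 K^3 / l] plus a negligible term; [l] is arbitrary. *)
Lemma root_wmix (Q0 : probability (Zseq R) R) k0 a : (0 < k0)%N ->
  eq_meas P (convolution_power Q0 k0) -> mlinear a -> wmix Q0 (@Zshift R) a.
Proof.
move=> k00 PQ0 La; have ma := mlinear_measurable La.
have Pn0 b (Lb : mlinear b) := ID_charfun_neq0 idP Lb.
have Q0n0 := root_charfun_neq0 idP k00 PQ0.
set q0 := sqn (charfun Q0 a).
have q00 : 0 < q0 by exact/sqn_gt0/Q0n0.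
pose K := q0^-1 - 1.
have K0 : 0 <= K by rewrite subr_ge0 -invr1 lef_pV2 ?posrE// sqn_charfun_le1.
apply/cvgr0Pnorm_lt => eta eta0.
have [l [l2 l0 hl]] : exists l, [/\ (1 < l)%N, 0 < l%:R :> R &
    8 * K ^+ 3 / l%:R < eta / 2].
  exists (Num.truncn (16 * K ^+ 3 / eta)).+2; split=> //.
  rewrite ltr_pdivrMr// -ltr_pdivrMl ?divr_gt0//.
  have -> : (eta / 2)^-1 * (8 * K ^+ 3) = 16 * K ^+ 3 / eta by field; rewrite gt_eqF.
  by rewrite (lt_trans (truncnS_gt _))// ltr_nat.
have kl1 : (1 <= k0 * l)%N by rewrite muln_gt0 k00 ltnW.
have [Q PQ] := idP kl1.
have sQ : stationary Q by exact: (root_stationary kl1 Pn0 sP PQ).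
have chQ0 b : mlinear b -> charfun Q0 b = charfun Q b ^+ l.
  move=> Lb; rewrite -charfun_convolution_power//; apply/esym.
  apply: (charfun_root_unique k00) => // c Lc.
  rewrite charfun_convolution_power// -exprM mulnC (charfun_root PQ Lc).
  by rewrite (charfun_root PQ0 Lc).
(* Since [l > 1], two copies of [Q] can be split off from [P]: one for the ergodicity of [Q], both
   for the mean ergodicity of [convolution Q Q]. *)
have klE : (k0 * l)%N = (k0 * l - 2).+2.
  by rewrite -addn2 subnK// -[1%N.+1]mul1n leq_mul.
have PQ2 : eq_meas P (convolution_power Q (k0 * l - 2).+2) by rewrite -klE.
move: (k0 * l - 2)%N PQ2 {klE} => k2 PQ2.
have meQ b : mlinear b -> mean_ergodic Q (@Zshift R) b.
  apply: (factor_mean_ergodic sP erg idP (Q2 := convolution_power Q k2.+1)).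
    exact: PQ2.
  exact: stationary_convolution_power.
have meQQ b : mlinear b -> mean_ergodic (convolution Q Q) (@Zshift R) b.
  apply: (factor_mean_ergodic sP erg idP (Q2 := convolution_power Q k2)).
    apply: charfun_unique => c Lc.
    by rewrite (charfun_eq_meas _ PQ2) /= !charfun_convolution// mulrA.
  exact: stationary_convolution_power.
have ergQ : ergodic Q (@Zshift R).
  apply: (mean_ergodic_ergodic mS sQ mlinear0 mlinearD mlinearZ mlinear_measurable
    mlinear_gen); exact: meQ.
have me2 := mean_ergodic_convolution La (meQQ a La).
have Qn0 : charfun Q a != 0 by exact: (root_charfun_neq0 idP kl1 PQ La).
have d0 : 0 < eta / (2 * l%:R ^+ 2) by rewrite divr_gt0// mulr_gt0// exprn_gt0.
have := correlation_bound mS sQ ma ergQ me2 Qn0 d0.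
set q := sqn (charfun Q a); have qpos : 0 < q by exact: sqn_gt0.
have qq : q ^+ l = q0 by rewrite -sqnX -chQ0.
set eps := q^-1 - 1.
have e0 : 0 <= eps by rewrite subr_ge0 -invr1 lef_pV2 ?posrE// sqn_charfun_le1.
have epsK : eps * l%:R <= K.
  have := @inv_sub1_le R q (q0^-1) l qpos; rewrite invrK => /(_ qq).
  by rewrite invr_gt0 => /(_ q00); rewrite -(mulr_natr (_ - _)).
apply: filterS => N hN; rewrite ger0_norm ?wmix_ge0//.
apply: (@le_lt_trans _ _ (l%:R ^+ 2 * (8 * eps ^+ 3 + eta / (2 * l%:R ^+ 2)))).
  apply: (@le_trans _ _ (l%:R ^+ 2 * avg2 (fun i j => sqn (charfun Q
    (fun x => a (iter i (@Zshift R) x) - a (iter j (@Zshift R) x)) *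
    Complex q^-1 0 - 1)) N)); last by rewrite ler_wpM2l// exprn_ge0// ltW.
  rewrite -avg2Z; apply: le_avg2 => i j.
  have Lb : mlinear (fun x => a (iter i (@Zshift R) x) - a (iter j (@Zshift R) x)).
    by apply: mlinearB; exact: mlinear_iter.
  rewrite chQ0//; have b1 := sqn_charfun_le1 Q (mlinear_measurable Lb).
  move: (charfun Q _) b1 => z z1.
  have cq n : Complex (q ^+ n) 0 = Complex q 0 ^+ n.
    by elim: n => [|n ih]; rewrite ?expr0// !exprS -ih complexM !mulr0 mul0r subr0 addr0.
  have qi : Complex q 0 * Complex q^-1 0 = 1.
    by rewrite complexM !mulr0 mul0r subr0 addr0 mulfV// gt_eqF.
  rewrite -/q0 -qq cq (_ : z ^+ l - _ = Complex q 0 ^+ l *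
      ((z * Complex q^-1 0) ^+ l - 1)); last first.
    by rewrite mulrBr mulr1 -exprMn mulrCA qi mulr1.
  rewrite sqnM sqnX sqn_real.
  (* The modulus of [z / q] can exceed 1; its square is at most [q^-2], and the resulting factor
     [q^(-2 l)] cancels exactly against the squared modulus of [q^l]. *)
  have c1 : 1 <= q ^- 2.
    by rewrite -invr1 lef_pV2 ?posrE ?exprn_gt0// exprn_ile1 ?sqn_charfun_le1// ltW.
  have zc : sqn (z * Complex q^-1 0) <= q ^- 2.
    by rewrite sqnM sqn_real exprVn ler_piMl// invr_ge0 exprn_ge0// ltW.
  have := sqnX_sub1_le l c1 zc.
  have w0 : 0 < (q ^+ 2) ^+ l by rewrite !exprn_gt0.
  rewrite -(ler_pM2l w0) => h; apply: (le_trans h).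
  have cancel_w (w c s : R) : 0 < w -> w * (c * w^-1 * s) = c * s.
    by move=> wp; field; rewrite gt_eqF.
  by rewrite exprVn cancel_w.
have -> : l%:R ^+ 2 * (8 * eps ^+ 3 + eta / (2 * l%:R ^+ 2)) =
    8 * (eps * l%:R) ^+ 3 / l%:R + eta / 2.
  by field; rewrite gt_eqF.
suff : 8 * (eps * l%:R) ^+ 3 / l%:R <= 8 * K ^+ 3 / l%:R by lra.
rewrite ler_pM2r ?invr_gt0// ler_pM2l// ler_pXn2r ?nnegrE//.
by rewrite mulr_ge0// ltW.
Qed.

End root_wmix.

(** * Powers of the shift and finite products of roots *)

Section ergodic_products.
Context {R : realType}.

Lemma wmix_distribution d d' (W : measurableType d) (V : measurableType d')
  (P : probability W R) (h : {mfun W >-> V}) (tau : W -> W) (sigma : V -> V)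
  (a : W -> R) (b : V -> R) : measurable_fun setT sigma -> measurable_fun setT b ->
  (forall n x, b (iter n sigma (h x)) = a (iter n tau x)) ->
  wmix P tau a -> wmix (distribution P h) sigma b.
Proof.
move=> ms mb e; rewrite /wmix.
have mh : measurable_fun setT h by exact: measurable_funPT.
rewrite (_ : avg2 _ = avg2 (fun i j => sqn (charfun (distribution P h)
  (fun x => b (iter i sigma x) - b (iter j sigma x)) -
    Complex (sqn (charfun (distribution P h) b)) 0)))//.
congr avg2; apply/funext => i; apply/funext => j.
rewrite -(@charfun_comp _ _ _ _ _ P (distribution P h) h b)//.
rewrite -(@charfun_comp _ _ _ _ _ P (distribution P h) h)//; last first.
  apply: measurable_funB.
    exact: (measurableT_comp mb (measurable_iter ms i)).
  exact: (measurableT_comp mb (measurable_iter ms j)).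
congr (sqn (_ - Complex (sqn _) 0)); apply: eq_charfun => x.
  by rewrite !e.
by rewrite -(e 0%N).
Qed.

Lemma ergodic_inverse d (W : measurableType d) (P : probability W R) f g :
  cancel f g -> ergodic P f -> ergodic P g.
Proof.
move=> fK erg A mA gA; apply: erg => //.
by rewrite -{1}gA; apply/seteqP; split => x /=; rewrite fK.
Qed.

Lemma aut_exp_iter d (W : measurableType d) (P : probability W R)
  (T : automorphism P) n : aut_exp T n =1 iter n T.
Proof. by elim: n => //= n ih x; rewrite /= ih. Qed.

Lemma aut_exp_inverse d (W : measurableType d) (P : probability W R)
  (T : automorphism P) n : cancel (iter n T) (aut_exp (aut_V T) n).
Proof.
elim: n => //= n ih x; rewrite /= -iterS iterSr.
by rewrite ih aut_funK.
Qed.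

Lemma Zseq_pair_gen : measurable `<=` <<s [set A |
  exists (c : Zseq R * Zseq R -> R) (B : set R),
  [/\ (exists a b, [/\ mlinear a, mlinear b & c = fun z => a z.1 + b z.2]),
      measurable B & A = c @^-1` B]] >>.
Proof.
set G := [set A | _].
apply: smallest_sub; first exact: smallest_sigma_algebra.
have sub (p : Zseq R * Zseq R -> Zseq R) :
    (forall n : int, exists a b, [/\ mlinear a, mlinear b &
      (fun z => p z n) = fun z => a z.1 + b z.2]) ->
    forall B, measurable B -> <<s G >> (p @^-1` B).
  move=> hp.
  pose K : set (set (Zseq R)) := [set B | <<s G >> (p @^-1` B)].
  suff : measurable `<=` K by [].
  have [s0 sD sU] := @smallest_sigma_algebra _ setT G.
  apply: smallest_sub.
    split.
    + by rewrite /K/= preimage_set0.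
    + by move=> B KB; rewrite /K/= setTD preimage_setC -setTD; exact: sD.
    + by move=> F KF; rewrite /K/= preimage_bigcup; exact: sU.
  move=> _ [n [B [mB ->]]]; rewrite /K/=; apply: sub_sigma_algebra.
  by exists (fun z => p z n), B; split => //; exact: hp.
move=> A [[B mB <-]|[B mB <-]]; rewrite setTI; apply: sub => // n.
- exists (fun x => x n), (fun=> 0); split; [exact: mlinear_coord|exact: mlinear0|].
  by apply/funext => z; rewrite addr0.
- exists (fun=> 0), (fun x => x n); split; [exact: mlinear0|exact: mlinear_coord|].
  by apply/funext => z; rewrite add0r.
Qed.

Lemma iter_preserving d (W : measurableType d) (P : probability W R) tau n :
  measurable_fun setT tau -> eq_meas (pushforward P tau) P ->
  eq_meas (pushforward P (iter n tau)) P.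
Proof.
move=> mt tP; elim: n => // n ih A mA.
rewrite -[RHS]ih// -[RHS]tP//; last first.
  by rewrite -[X in measurable X]setTI; exact: measurable_iter.
by congr (P _); apply/seteqP; split => x /=; rewrite -iterSr.
Qed.

(** On the square, functionals [a z.1 + b z.2] generate the sigma-algebra and inherit [wmix] from
    the factors, also along powers, so [mean_ergodic_ergodic] applies. A negative power is the
    inverse of a positive one and has the same invariant sets. *)
Lemma wmix_weakly_mixing (Q : probability (Zseq R) R) (sQ : stationary Q) (m : int) :
  m != 0 -> (forall a, mlinear a -> wmix Q (@Zshift R) a) ->
  weakly_mixing (aut_expz (shift_aut sQ) m).
Proof.
move=> m0 wQ; have mS := @measurable_Zshift R.
have mSS := measurable_pair_map mS mS.
have pSS := pair_map_preserving mS sQ mS sQ.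
have key n : (0 < n)%N ->
    ergodic (Q \x Q)%E (pair_map (iter n (@Zshift R)) (iter n (@Zshift R))).
  move=> n0; rewrite (_ : pair_map _ _ = iter n (pair_map (@Zshift R) (@Zshift R))).
    apply: (mean_ergodic_ergodic (measurable_iter mSS n) (iter_preserving n mSS pSS)
      (L := [set c | exists a b, [/\ mlinear a, mlinear b &
        c = fun z => a z.1 + b z.2]])).
    - exists (fun=> 0), (fun=> 0); split; [exact: mlinear0|exact: mlinear0|].
      by apply/funext => z; rewrite addr0.
    - move=> _ _ [a [b [La Lb ->]]] [a' [b' [La' Lb' ->]]].
      exists (fun x => a x + a' x), (fun x => b x + b' x).
      split; [exact: mlinearD|exact: mlinearD|].
      by apply/funext => z; rewrite addrACA.
    - move=> c _ [a [b [La Lb ->]]].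
      exists (fun x => c * a x), (fun x => c * b x).
      split; [exact: mlinearZ|exact: mlinearZ|].
      by apply/funext => z; rewrite mulrDr.
    - move=> _ [a [b [[ma _ _] [mb _ _] ->]]].
      by apply: measurable_funD; exact: measurableT_comp.
    - exact: Zseq_pair_gen.
    - move=> _ [a [b [La Lb ->]]]; have [ma _ _] := La; have [mb _ _] := Lb.
      apply: wmix_mean_ergodic.
      + exact: measurable_iter.
      + exact: iter_preserving.
      + by apply: measurable_funD; exact: measurableT_comp.
      + by apply/wmix_iter => //; apply: wmix_prod => //; exact: wQ.
  by apply/funext => z; rewrite iter_pair_map.
rewrite /weakly_mixing; case: m m0 => n n0 /=.
  have -> : aut_fun (aut_exp (shift_aut sQ) n) = iter n (@Zshift R).
    by apply/funext => x; rewrite aut_exp_iter.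
  by apply: key; rewrite lt0n.
apply: (@ergodic_inverse _ _ _ (pair_map (iter n.+1 (@Zshift R)) (iter n.+1 (@Zshift R)))).
  have h := aut_exp_inverse (shift_aut sQ) n.+1.
  by move=> [x y]; congr (_, _); exact: h.
exact: key.
Qed.

End ergodic_products.

Section products_of_roots.
Context {R : realType} (I : finType) (Q : probability (Zseq R) R).
Let ZI := dprod (fun _ : I => (Zseq R : measurableType _)).
Let nu (_ : I) := Q.
Let shiftI : ZI -> ZI := dprod_map (fun _ : I => @Zshift R).

Let mS := @measurable_Zshift R.

Let mcoord i : measurable_fun setT (fun x : ZI => x i).
Proof. exact: measurable_coord. Qed.

Lemma measurable_sum_coord (s : seq I) (a : I -> Zseq R -> R) :
  (forall i, mlinear (a i)) ->
  measurable_fun setT (fun x : ZI => \sum_(i <- s) a i (x i)).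
Proof.
move=> La; elim: s => [|i s ih].
  have -> : (fun x : ZI => \sum_(i <- [::]) a i (x i)) = fun=> 0.
    by apply/funext => x; rewrite big_nil.
  exact: measurable_cst.
have -> : (fun x : ZI => \sum_(j <- i :: s) a j (x j)) =
    (fun x => a i (x i) + \sum_(j <- s) a j (x j)).
  by apply/funext => x; rewrite big_cons.
apply: measurable_funD => //.
have [ma _ _] := La i; exact: (measurableT_comp ma (mcoord i)).
Qed.

Let measurable_shiftI : measurable_fun setT shiftI.
Proof. by apply: measurable_dprod_map => i; exact: mS. Qed.

Let iter_shiftI n x i : iter n shiftI x i = iter n (@Zshift R) (x i).
Proof. by elim: n => //= n ih; rewrite /shiftI /dprod_map ih. Qed.

Let sum_dupdate (s : seq I) i (a : I -> Zseq R -> R) p : i \notin s ->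
  \sum_(j <- i :: s) a j (@dupdate I _ (fun=> Zseq R) i p j) =
  a i p.1 + \sum_(j <- s) a j (p.2 j).
Proof.
move=> nis; rewrite big_cons /dupdate dfwithin; congr (_ + _).
rewrite big_seq [RHS]big_seq; apply: eq_bigr => j js.
by rewrite dfwithout//; apply: contraNneq nis => ->.
Qed.

Lemma charfun_seq_prod (s : seq I) (a : I -> Zseq R -> R) : uniq s ->
  (forall i, mlinear (a i)) ->
  charfun (seq_prod_measure nu s) (fun x => \sum_(i <- s) a i (x i)) =
  \prod_(i <- s) charfun Q (a i).
Proof.
move=> us La; elim: s us => [_|i s ih /= /andP[nis us]].
  rewrite big_nil; under eq_charfun do rewrite big_nil.
  rewrite /charfun; under eq_Rint do rewrite cos0.
  by under [X in Complex _ X]eq_Rint do rewrite sin0; rewrite !Rint_cst.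
have [ma _ _] := La i.
rewrite big_cons -ih// -charfun_prod//; last exact: measurable_sum_coord.
rewrite -(@charfun_comp _ _ _ _ _ (Q \x seq_prod_measure nu s)%E
  (distribution (Q \x seq_prod_measure nu s)%E (@dupdate I _ (fun=> Zseq R) i))
  (@dupdate I _ (fun=> Zseq R) i))//.
- by apply: eq_charfun => p; exact: sum_dupdate.
- exact: measurable_sum_coord.
Qed.

Lemma wmix_seq_prod (s : seq I) (a : I -> Zseq R -> R) : uniq s ->
  (forall i, mlinear (a i)) -> (forall i, wmix Q (@Zshift R) (a i)) ->
  wmix (seq_prod_measure nu s) shiftI (fun x => \sum_(i <- s) a i (x i)).
Proof.
move=> us La wa; elim: s us => [_|i s ih us].
  rewrite /wmix [X in X @ _](_ : _ = fun=> 0); first exact: cvg_cst.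
  have c1 (f : ZI -> R) : (forall x, f x = 0) ->
      charfun (seq_prod_measure nu [::]) f = 1.
    move=> f0; rewrite /charfun; under eq_Rint do rewrite f0 cos0.
    by under [X in Complex _ X]eq_Rint do rewrite f0 sin0; rewrite !Rint_cst.
  apply/funext => N; rewrite /avg2 big1 ?mul0r// => j _; rewrite big1// => k _.
  rewrite !c1; last 2 first.
  - by move=> x; rewrite big_nil.
  - by move=> x; rewrite !big_nil subrr.
  by rewrite sqn1 subrr (sqn_real 0) expr0n.
have /= /andP[nis us'] := us; have [ma _ _] := La i.
apply: (wmix_distribution (tau := pair_map (@Zshift R) shiftI)
  (a := fun p => a i p.1 + \sum_(j <- s) a j (p.2 j))).
- exact: measurable_shiftI.
- exact: measurable_sum_coord.
- move=> n p; rewrite -sum_dupdate//; apply: eq_bigr => j _.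
  rewrite iter_shiftI iter_pair_map /dupdate; congr (a j _).
  have [<-|ij] := eqVneq i j; first by rewrite !dfwithin/= /dupdate dfwithin.
  by rewrite !dfwithout//= iter_shiftI /dupdate dfwithout.
- apply: (wmix_prod (a1 := a i)
    (a2 := fun x : ZI => \sum_(j <- s) a j (x j))) => //.
    exact: measurable_sum_coord.
  exact: ih.
Qed.

Lemma dprod_gen : (measurable : set (set ZI)) `<=` <<s [set A |
  exists (c : ZI -> R) (B : set R),
  [/\ (exists2 a, (forall i, mlinear (a i)) & c = fun x => \sum_i a i (x i)),
      measurable B & A = c @^-1` B]] >>.
Proof.
set G := [set A | _].
have [s0 sD sU] := @smallest_sigma_algebra _ setT G.
apply: smallest_sub; first exact: smallest_sigma_algebra.
move=> _ [i [B [mB ->]]]; move: B mB.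
pose K : set (set (Zseq R)) := [set B | <<s G >> [set x : ZI | B (x i)]].
suff : measurable `<=` K by [].
apply: smallest_sub.
  split.
  + by rewrite /K/=.
  + by move=> B KB; have := sD _ KB; rewrite !setTD.
  + move=> F KF; have := sU _ KF.
    by rewrite (_ : \bigcup_k _ = [set x : ZI | (\bigcup_k F k) (x i)]).
move=> _ [n [B [mB ->]]]; rewrite /K/=; apply: sub_sigma_algebra.
exists (fun x => x i n), B; split => //.
exists (fun j => if j == i then (fun x => x n) else fun=> 0).
  by move=> j; case: ifP => _; [exact: mlinear_coord|exact: mlinear0].
by apply/funext => x; rewrite (bigD1 i)//= eqxx big1 ?addr0// => j /negbTE ->.
Qed.

Lemma dprod_ergodic n : (0 < n)%N -> stationary Q ->
  (forall a, mlinear a -> wmix Q (@Zshift R) a) ->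
  ergodic (dprod_measure nu) (iter n shiftI).
Proof.
move=> n0 sQ wQ.
have pres : eq_meas (pushforward (dprod_measure nu) shiftI) (dprod_measure nu).
  exact: (aut_preserving (dprod_aut (fun _ : I => shift_aut sQ))).
apply: (mean_ergodic_ergodic (measurable_iter measurable_shiftI n)
  (iter_preserving n measurable_shiftI pres)
  (L := [set c | exists2 a, (forall i, mlinear (a i)) &
     c = fun x : ZI => \sum_i a i (x i)])).
- exists (fun _ _ => 0); first by move=> i; exact: mlinear0.
  by apply/funext => x; rewrite big1.
- move=> _ _ [a La ->] [b Lb ->]; exists (fun i x => a i x + b i x).
    by move=> i; exact: mlinearD.
  by apply/funext => x; rewrite big_split.
- move=> c _ [a La ->]; exists (fun i x => c * a i x).
    by move=> i; exact: mlinearZ.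
  by apply/funext => x; rewrite mulr_sumr.
- by move=> _ [a La ->]; exact: measurable_sum_coord.
- exact: dprod_gen.
- move=> _ [a La ->]; apply: wmix_mean_ergodic.
  + exact: measurable_iter.
  + exact: iter_preserving.
  + exact: measurable_sum_coord.
  + apply: wmix_iter => //.
    have := @wmix_seq_prod (enum I) a (enum_uniq I) La (fun i => wQ _ (La i)).
    have -> : (fun x : ZI => \sum_(i <- enum I) a i (x i)) =
        (fun x : ZI => \sum_i a i (x i)).
      by apply/funext => x; rewrite big_enum.
    exact.
Qed.

Definition sumI (x : ZI) : Zseq R := fun n => \sum_i x i n.

Lemma measurable_sumI : measurable_fun setT sumI.
Proof.
apply: measurable_fun_dprod => n.
apply: (@measurable_sum_coord _ (fun _ x => x n)) => i; exact: mlinear_coord.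
Qed.

Lemma mlinear_sum a (s : seq I) (x : I -> Zseq R) : mlinear a ->
  a (fun n => \sum_(i <- s) x i n) = \sum_(i <- s) a (x i).
Proof.
move=> La; have [_ aD _] := La; elim: s => [|i s ih].
  rewrite big_nil -[RHS](mlinear_vanish La); congr a.
  by apply/funext => n; rewrite big_nil.
by rewrite big_cons -ih -aD; congr a; apply/funext => n; rewrite big_cons.
Qed.

Lemma sumI_preserving (P : probability (Zseq R) R) : eq_meas P (convolution_power Q #|I|) ->
  eq_meas (pushforward (dprod_measure nu) sumI) P.
Proof.
move=> PQ; pose S : {mfun ZI >-> Zseq R} :=
  HB.pack sumI (isMeasurableFun.Build _ _ _ _ sumI measurable_sumI).
suff : eq_meas (distribution (dprod_measure nu) S) P by [].
apply: charfun_unique => a La; have [ma _ _] := La.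
rewrite -(@charfun_comp _ _ _ _ _ (dprod_measure nu)
  (distribution (dprod_measure nu) S) sumI)//; last exact: measurable_sumI.
rewrite (@eq_charfun _ _ _ _ _ (fun x : ZI => \sum_(i <- enum I) a (x i))).
  apply: etrans (@charfun_seq_prod (enum I) (fun=> a) (enum_uniq I) (fun=> La)) _.
  rewrite big_const_seq count_predT -cardE.
  by rewrite iter_mulr_1 -(charfun_root PQ La).
by move=> x; rewrite big_enum/= -mlinear_sum.
Qed.

End products_of_roots.

(** * Joinings as bimeasures *)

Section dominated_additive.
Context {R : realType} d (W : measurableType d) (P : probability W R).
Variable kappa : set W -> R.
Hypotheses (k_ge0 : forall A, measurable A -> 0 <= kappa A)
  (k_le : forall A, measurable A -> kappa A <= fine (P A))
  (kU : forall A B, measurable A -> measurable B -> A `&` B = set0 ->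
     kappa (A `|` B) = kappa A + kappa B).

Let m (A : set W) : \bar R := if `[< measurable A >] then (kappa A)%:E else 0%E.

Let mE A : measurable A -> m A = (kappa A)%:E.
Proof. by move=> mA; rewrite /m; case: asboolP. Qed.

Let kappa0 : kappa set0 = 0.
Proof.
apply/eqP; rewrite eq_le k_ge0// andbT.
by have := k_le measurable0; rewrite measure0.
Qed.

Let m0 : m set0 = 0%E. Proof. by rewrite mE// kappa0. Qed.

Let m_ge0 A : (0 <= m A)%E.
Proof. by rewrite /m; case: asboolP => // mA; rewrite lee_fin k_ge0. Qed.

Let kappa_sum (F : nat -> set W) n : (forall i, measurable (F i)) ->
  trivIset setT F -> \sum_(0 <= i < n) kappa (F i) = kappa (\bigcup_(i < n) F i).
Proof.
move=> mF tF; elim: n => [|n ih].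
  by rewrite big_nil bigcup_mkord big_ord0 kappa0.
rewrite big_nat_recr//= ih !bigcup_mkord big_ord_recr/= -bigcup_mkord kU//.
  by apply: bigcup_measurable => i _.
apply/seteqP; split => // x [[i /= ni Fix] Fnx].
have : i = n.
  apply: (tF i n) => //; by exists x.
by move=> e; rewrite e ltnn in ni.
Qed.

Let kappaD A B : measurable A -> measurable B -> B `<=` A ->
  kappa A = kappa B + kappa (A `\` B).
Proof.
move=> mA mB BA; have mD := measurableD mA mB.
by rewrite -(kU mB mD (setDIK _ _)) setDUK.
Qed.

Let m_sigma_additive : semi_sigma_additive m.
Proof.
move=> F mF tF mU; set U := \bigcup_n F n.
have mFn n : measurable (\bigcup_(i < n) F i) by apply: bigcup_measurable.
have sub n : \bigcup_(i < n) F i `<=` U by move=> x [i _ Fix]; exists i.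
rewrite mE// (_ : (fun n => _) = (fun n => (kappa (\bigcup_(i < n) F i))%:E)); last first.
  apply/funext => n; rewrite -kappa_sum// -sumEFin.
  by apply: eq_bigr => i _; exact: mE.
suff key : kappa (\bigcup_(i < n) F i) @[n --> \oo] --> kappa U.
  by apply: cvg_EFin; [exact: nearW|exact: key].
have cP : fine (P (\bigcup_(i < n) F i)) @[n --> \oo] --> fine (P U).
  apply: fine_cvg; rewrite fineK ?fin_num_measure//.
  have := @nondecreasing_cvg_mu _ _ _ P (fun n => \bigcup_(i < n) F i) mFn.
  rewrite (_ : \bigcup_n \bigcup_(i < n) F i = U); last first.
    apply/seteqP; split=> [x [n _ [i _ Fix]]|x [i _ Fix]]; first by exists i.
    by exists i.+1 => //; exists i => /=.
  apply=> //; apply/nondecreasing_seqP => n; apply/subsetPset => x [i /= ni Fix].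
  by exists i => //=; exact: ltnW.
have cl : kappa U - (fine (P U) - fine (P (\bigcup_(i < n) F i))) @[n --> \oo] -->
    kappa U.
  rewrite -[X in _ --> X]subr0 -(subrr (fine (P U))).
  by apply: cvgB; [exact: cvg_cst|apply: cvgB => //; exact: cvg_cst].
apply: (squeeze_cvgr _ cl (cvg_cst _)); apply: nearW => n.
have mD : measurable (U `\` \bigcup_(i < n) F i) by exact: measurableD.
rewrite (kappaD mU (mFn n) (sub n)) lerDl k_ge0// andbT.
rewrite -addrA gerDl subr_le0 (le_trans (k_le mD))//.
rewrite measureD// ?(setIidr (sub n)) ?fineB ?fin_num_measure//.
by rewrite -ge0_fin_numE ?fin_num_measure.
Qed.

(** Domination upgrades finite additivity: [kappa] of the remainder of a countable union is at most
    its [P]-measure, which tends to 0. *)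
Lemma dominated_additive_measure :
  exists m : {finite_measure set W -> \bar R},
    forall A, measurable A -> m A = (kappa A)%:E.
Proof.
pose M : {measure set W -> \bar R} :=
  HB.pack m (isMeasure.Build _ _ _ m m0 m_ge0 m_sigma_additive).
have fM : fin_num_fun M by move=> A mA; rewrite /= mE.
pose FM : {finite_measure set W -> \bar R} :=
  HB.pack m M (Measure_isFinite.Build _ _ _ M fM).
by exists FM.
Qed.

(** The Radon-Nikodym density is at most 1 almost everywhere; truncation makes the bounds hold at
    every point. *)
Lemma dominated_density : exists f : W -> R,
  [/\ bmf f, forall x, 0 <= f x <= 1 &
      forall A, measurable A -> kappa A = \int[P]_x (\1_A x * f x)].
Proof.
have [M ME] := dominated_additive_measure.
have dom : M `<< P.
  apply/null_content_dominatesP => A mA PA0; rewrite ME//; congr (_%:E).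
  by apply/eqP; rewrite eq_le k_ge0// andbT; have := k_le mA; rewrite PA0.
have [f [f0 intf fE]] := radon_nikodym_finite dom.
have mf : measurable_fun setT f by exact: measurable_int intf.
pose g x := Num.min 1 (fine (f x)).
have mg : measurable_fun setT g.
  apply: measurable_minr => //.
  exact: (measurableT_comp (@fine_measurable R setT measurableT) mf).
have g01 x : 0 <= g x <= 1.
  by rewrite /g le_min ler01 fine_ge0//= ge_min lexx.
have bg : bmf g.
  by split=> //; exists 1 => x; have /andP[h0 h1] := g01 x; rewrite ger0_norm.
exists g; split=> // A mA.
(* Truncating at 2 gives a bounded function that still detects [f > 1]: over [B] the integral of
   [h - 1] is at most [kappa B - P B <= 0]. *)
pose h x := Num.min 2 (fine (f x)).
have mh : measurable_fun setT h.
  apply: measurable_minr => //.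
  exact: (measurableT_comp (@fine_measurable R setT measurableT) mf).
have h02 x : 0 <= h x <= 2.
  by rewrite /h le_min ler0n fine_ge0//= ge_min lexx.
have bh : bmf h.
  by split=> //; exists 2 => x; have /andP[h0 h1] := h02 x; rewrite ger0_norm.
pose B := [set x | 1 < h x].
have mB : measurable B.
  rewrite (_ : B = h @^-1` `]1, +oo[) -1?[X in measurable X]setTI; first exact: mh.
  by apply/seteqP; split => x /=; rewrite in_itv/= andbT.
have bB := bmf_indic (R := R) mB.
have b1h : bmf (fun x => \1_B x * (h x - 1)).
  by apply: bmfM => //; apply: bmfB => //; exact: bmf_cst.
have hB0 x : 0 <= \1_B x * (h x - 1).
  rewrite indicE; case: (boolP (x \in B)) => [|_]; last by rewrite mul0r.
  by rewrite inE /B/= mul1r subr_ge0 => /ltW.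
have iB0 : \int[P]_x (\1_B x * (h x - 1)) = 0.
  apply/eqP; rewrite eq_le Rint_ge0// andbT.
  rewrite (@eq_Rint _ _ _ _ _ (fun x => \1_B x * h x - \1_B x)); last first.
    by move=> x; rewrite mulrBr mulr1.
  rewrite RintB//; last exact: bmfM.
  rewrite Rint_indic// subr_le0 (le_trans _ (k_le mB))// -lee_fin -ME// fE//.
  rewrite /Rintegral fineK; last first.
    by apply: integrable_fin_num => //; apply: bmf_integrable; exact: bmfM.
  rewrite [leRHS]integral_mkcond; apply: ge0_le_integral => //=.
  - move=> x _; rewrite lee_fin mulr_ge0// ?indicE//; by have /andP[] := h02 x.
  - by apply/measurable_EFinP; case: (bmfM bB bh).
  - exact/(measurable_restrictT _ mB)/measurable_funTS.
  - move=> x _; rewrite patchE indicE; case: ifPn => xB; last by rewrite mul0r.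
    rewrite mul1r /h; have := f0 x; case: (f x) => [r| |]//= _.
      by rewrite lee_fin ge_min lexx orbT.
    by rewrite leey.
have ae1 : {ae P, forall x, fine (f x) <= 1}.
  apply: filterS (Rint_eq0_ae b1h hB0 iB0) => x /eqP.
  rewrite indicE; case: (boolP (x \in B)) => [|].
    by rewrite inE /B/= mul1r subr_eq0 => h1 /eqP e; rewrite e ltxx in h1.
  rewrite notin_setE /B/= /h => /negP; rewrite -leNgt => + _.
  by rewrite ge_min; case/orP => //; lra.
have fin : {ae P, forall x, f x \is a fin_num}.
  by apply: filterS (integrable_ae measurableT intf) => x; exact.
have fg : {ae P, forall x, f x = (g x)%:E}.
  apply: filterS2 ae1 fin => x fx1 /fineK fxE; rewrite -[LHS]fxE /g; congr (_%:E).
  by rewrite min_r.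
apply: EFin_inj; rewrite -ME// fE// integral_mkcond.
apply: (@etrans _ _ (\int[P]_x (\1_A x * g x)%:E)%E); first apply: ae_eq_integral => //.
- exact/(measurable_restrictT _ mA)/measurable_funTS.
- by apply/measurable_EFinP; case: (bmfM (bmf_indic mA) bg).
- apply: filterS fg => x fx _; rewrite patchE indicE.
  by case: ifPn => xA; rewrite ?mul1r ?mul0r.
rewrite /Rintegral fineK//; apply: integrable_fin_num => //.
by apply: bmf_integrable; apply: bmfM => //; exact: bmf_indic.
Qed.

End dominated_additive.

Section density_order.
Context {R : realType} d (W : measurableType d) (P : probability W R).
Implicit Types f g : W -> R.

Lemma density_le f g : bmf f -> bmf g ->
  (forall A, measurable A -> \int[P]_x (\1_A x * f x) <= \int[P]_x (\1_A x * g x)) ->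
  {ae P, forall x, f x <= g x}.
Proof.
move=> bf bg fg; have bfg := bmfB bf bg.
pose A := [set x | 0 < f x - g x].
have mA : measurable A.
  rewrite (_ : A = (fun x => f x - g x) @^-1` `]0, +oo[).
    by rewrite -[X in measurable X]setTI; case: bfg => m _; exact: m.
  by apply/seteqP; split => x /=; rewrite in_itv/= andbT.
have bA := bmf_indic (R := R) mA.
have h0 x : 0 <= \1_A x * (f x - g x).
  rewrite indicE; case: (boolP (x \in A)) => [|_]; last by rewrite mul0r.
  by rewrite inE /A/= mul1r => /ltW.
have i0 : \int[P]_x (\1_A x * (f x - g x)) = 0.
  apply/eqP; rewrite eq_le Rint_ge0// andbT.
  rewrite (@eq_Rint _ _ _ _ _ (fun x => \1_A x * f x - \1_A x * g x)).
    rewrite RintB; [|exact: bmfM|exact: bmfM].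
    by rewrite subr_le0 fg.
  by move=> x; rewrite mulrBr.
apply: filterS (Rint_eq0_ae (bmfM bA bfg) h0 i0) => x /eqP.
rewrite indicE; case: (boolP (x \in A)) => [|]; last first.
  by rewrite notin_setE /A/= => /negP; rewrite -leNgt subr_le0.
by rewrite inE /A/= mul1r => + /eqP e; rewrite e ltxx.
Qed.

Lemma density_eq f g : bmf f -> bmf g ->
  (forall A, measurable A -> \int[P]_x (\1_A x * f x) = \int[P]_x (\1_A x * g x)) ->
  {ae P, forall x, f x = g x}.
Proof.
move=> bf bg fg.
apply: filterS2 (density_le bf bg _) (density_le bg bf _).
- by move=> x fgx gfx; apply/eqP; rewrite eq_le fgx gfx.
- by move=> A mA; rewrite fg.
- by move=> A mA; rewrite fg.
Qed.

End density_order.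

Lemma ae_pushforward {R : realType} d d' (W : measurableType d) (V : measurableType d')
  (P : probability W R) (Q : probability V R) (h : W -> V) (p : V -> Prop) :
  measurable_fun setT h -> eq_meas (pushforward P h) Q ->
  {ae Q, forall y, p y} -> {ae P, forall x, p (h x)}.
Proof.
move=> mh Ph [N [mN N0 pN]]; exists (h @^-1` N); split.
- by rewrite -[X in measurable X]setTI; exact: mh.
- by rewrite -N0 -Ph.
- by move=> x /= nx; exact: pN.
Qed.

(** * Extension of bimeasures to measures by quantile functions *)

Section bimeasure.
Context {R : realType} d d' (X : measurableType d) (Z : measurableType d').
Context (mu : probability X R) (nu : probability Z R).

(** The trace of a coupling on rectangles. Only finite additivity is asked, so each condition
    involves finitely many values and is closed for pointwise convergence; countable additivity
    follows from the marginals. *)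
Definition bimeasure (b : set X -> set Z -> R) : Prop :=
  [/\ forall A B, measurable A -> measurable B -> 0 <= b A B,
      forall A A' B, measurable A -> measurable A' -> measurable B ->
        A `&` A' = set0 -> b (A `|` A') B = b A B + b A' B,
      forall A B B', measurable A -> measurable B -> measurable B' ->
        B `&` B' = set0 -> b A (B `|` B') = b A B + b A B',
      forall A, measurable A -> b A setT = fine (mu A) &
      forall B, measurable B -> b setT B = fine (nu B)].

Section extension.
Variables (c : Z -> R) (r : R -> Z).
Hypotheses (mc : measurable_fun setT c) (mr : measurable_fun setT r)
  (cK : cancel c r) (c01 : forall z, 0 <= c z <= 1).
Variable b : set X -> set Z -> R.
Hypothesis bb : bimeasure b.

Let b_ge0 A B : measurable A -> measurable B -> 0 <= b A B.
Proof. by case: bb => + _ _ _ _; exact. Qed.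

Let b_mono A B B' : measurable A -> measurable B -> measurable B' -> B `<=` B' ->
  b A B <= b A B'.
Proof.
move=> mA mB mB' BB'; have [_ _ bU _ _] := bb; have mD := measurableD mB' mB.
by rewrite -(setDUK BB') (bU _ _ _ mA mB mD (setDIK _ _)) lerDl b_ge0.
Qed.

Let b_le1 A B : measurable A -> measurable B -> b A B <= fine (mu A).
Proof.
by move=> mA mB; have [_ _ _ e _] := bb; rewrite -e//; exact: b_mono.
Qed.

Let b_le2 A B : measurable A -> measurable B -> b A B <= fine (nu B).
Proof.
move=> mA mB; have [_ bU _ _ e] := bb; rewrite -e//.
have mD := measurableD measurableT mA.
rewrite -[in leRHS](setDUK (@subsetT _ A)) (bU _ _ _ mA mD mB (setDIK _ _)).
by rewrite lerDl b_ge0.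
Qed.

Let dens_ex : exists f : set Z -> X -> R, forall B, measurable B ->
  [/\ bmf (f B), forall x, 0 <= f B x <= 1 &
      forall A, measurable A -> b A B = \int[mu]_x (\1_A x * f B x)].
Proof.
have /choice[f fP] : forall B, exists f : X -> R, measurable B ->
  [/\ bmf f, forall x, 0 <= f x <= 1 &
      forall A, measurable A -> b A B = \int[mu]_x (\1_A x * f x)].
  move=> B; have [mB|nB] := pselect (measurable B); last by exists (fun=> 0).
  have [|||f fP] := @dominated_density R _ _ mu (fun A => b A B).
  - by move=> A mA; exact: b_ge0.
  - by move=> A mA; exact: b_le1.
  - by move=> A A' mA mA' AA'; case: bb => _ + _ _ _; exact.
  - by exists f.
by exists f.
Qed.

Let dens : set Z -> X -> R := sval (cid dens_ex).
Let densP B : measurable B -> [/\ bmf (dens B), forall x, 0 <= dens B x <= 1 &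
      forall A, measurable A -> b A B = \int[mu]_x (\1_A x * dens B x)].
Proof. by rewrite /dens; case: cid => f /= h; exact: h. Qed.

Let dens_mono B B' : measurable B -> measurable B' -> B `<=` B' ->
  {ae mu, forall x, dens B x <= dens B' x}.
Proof.
move=> mB mB' BB'; have [bf _ fE] := densP mB; have [bg _ gE] := densP mB'.
by apply: density_le => // A mA; rewrite -fE// -gE// b_mono.
Qed.

Let q (n : nat) : R := ratr (odflt 0 (choice.unpickle n)).

Let q_dense s t : s < t -> exists n, s < q n < t.
Proof.
move=> /rat_in_itvoo[x]; rewrite in_itv/= => xst; exists (choice.pickle x).
by rewrite /q choice.pickleK.
Qed.

Let below t : set Z := [set z | c z < t].
Let mbelow t : measurable (below t).
Proof.
rewrite (_ : below t = c @^-1` `]-oo, t[).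
  by rewrite -[X in measurable X]setTI; exact: mc.
by apply/seteqP; split => x /=; rewrite in_itv/=.
Qed.

Let f n := dens (below (q n)).

(** The element 2 keeps the set nonempty and lies beyond all codes; [0 <= q n] keeps it bounded
    below, so the infimum is meaningful at every point. *)
Let Qset (z : X * R) : set R :=
  [set s | s = 2 \/ exists n, [/\ 0 <= q n, z.2 < f n z.1 & s = q n]].
(* For fixed x, Q (x, .) is the quantile function of the conditional law of   *)
(* the code c given x, whose distribution function is dens (below .) x.       *)
Let Q z := inf (Qset z).

Let Qset_inf z : has_inf (Qset z).
Proof.
split; first by exists 2; left.
by exists 0 => _ [->|[n [qn _ ->]]].
Qed.

Let Q_lt z t : Q z < t <->
  (2 < t \/ exists n, [/\ 0 <= q n, z.2 < f n z.1 & q n < t]).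
Proof.
split=> [/(inf_lt (Qset_inf z).1)[_ [->|[n [qn zf ->]]] st]|].
- by left.
- by right; exists n.
case=> [t2|[n [qn zf qnt]]].
  apply: le_lt_trans t2; apply: ge_inf; [exact: (Qset_inf z).2|by left].
apply: le_lt_trans qnt; apply: ge_inf; first exact: (Qset_inf z).2.
by right; exists n.
Qed.

Let m_sub (g : X -> R) : measurable_fun setT g ->
  measurable [set z : X * R | z.2 < g z.1].
Proof.
move=> mg; rewrite (_ : [set _ | _] = (fun z => g z.1 - z.2) @^-1` `]0, +oo[).
  rewrite -[X in measurable X]setTI; apply: (measurable_funB _ _ measurableT) => //.
  exact: measurableT_comp mg measurable_fst.
by apply/seteqP; split => z /=; rewrite in_itv/= andbT subr_gt0.
Qed.

Let mf n : measurable_fun setT (f n).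
Proof. by have [[]] := densP (mbelow (q n)). Qed.

Let mQ : measurable_fun setT Q.
Proof.
apply: (measurability _ (RGenInftyO.measurableE R)) => // _ [_ [t ->] <-].
rewrite setTI (_ : _ @^-1` _ = (if 2 < t then setT else set0) `|`
  \bigcup_n (if (0 <= q n) && (q n < t) then [set z : X * R | z.2 < f n z.1] else set0)).
  apply: measurableU; first by case: ifP.
  by apply: bigcup_measurable => n _; case: ifP => // _; exact: m_sub.
apply/seteqP; split => z /=.
  rewrite in_itv/= => /Q_lt[->|[n [qn zf qt]]]; first by left.
  by right; exists n => //; rewrite qn qt.
rewrite in_itv/= => -[|[n _]].
  by case: ifP => // t2 _; apply/Q_lt; left.
by case: ifP => // /andP[qn qt] zf; apply/Q_lt; right; exists n.
Qed.

Let U0 : probability (measurableTypeR R) R := uniform_prob (@ltr01 R).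

Let idR : measurableTypeR R -> R := id.
Let midR : measurable_fun setT idR.
Proof. by move=> _ B mB; rewrite setTI. Qed.
HB.instance Definition _ := isMeasurableFun.Build _ _ _ _ idR midR.

Let U : probability R R := distribution U0 idR.

Let U_lt s : 0 <= s <= 1 -> U [set u | u < s] = s%:E.
Proof.
move=> /andP[s0 s1]; rewrite -[LHS]/(uniform_prob (@ltr01 R) [set u | u < s]).
rewrite /uniform_prob integral_uniform_pdf.
rewrite (eq_integral (fun=> 1%E)); last first.
  move=> x; rewrite inE/= in_itv/= /uniform_pdf => -[_ ->].
  by rewrite subr0 invr1.
rewrite (_ : _ `&` _ = `[0, s[%classic); last first.
  apply/seteqP; split => x /=; rewrite !in_itv/=.
    by move=> [xs /andP[-> _]].
  by move=> /andP[-> xs]; split => //; rewrite ltW// (lt_le_trans xs).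
rewrite integral_cst//= mul1e lebesgue_measure_itv/= lte_fin.
by case: ltP => [_|]; rewrite ?sube0// => s00; congr (_%:E); apply: le_anti; rewrite s0.
Qed.

Let PU' : probability (X * R)%type R := (mu \x U)%E.

Let PU_rect' A B : measurable A -> measurable B -> PU' (A `*` B) = (mu A * U B)%E.
Proof. by move=> mA mB; exact: product_measure1E. Qed.

Let PU_lt' (A : set X) (g : X -> R) : measurable A -> measurable_fun setT g ->
  (forall x, 0 <= g x <= 1) ->
  fine (PU' [set z | A z.1 /\ z.2 < g z.1]) = \int[mu]_x (\1_A x * g x).
Proof.
move=> mA mg g01.
have mE : measurable [set z : X * R | A z.1 /\ z.2 < g z.1].
  apply: measurableI; last exact: m_sub.
  by rewrite -[X in measurable X]setTI; exact: measurable_fst.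
rewrite -Rint_indic// Rint_fubini; last exact: bmf_indic.
apply: eq_Rint => x.
have mlt : measurable [set u : R | u < g x].
  rewrite (_ : [set u | _] = `]-oo, g x[%classic); first exact: measurable_itv.
  by apply/seteqP; split => y /=; rewrite in_itv.
rewrite (@eq_Rint _ _ _ _ _ (fun u => \1_A x * \1_[set u | u < g x] u)).
  rewrite RintZ; last exact: bmf_indic.
  by rewrite Rint_indic// U_lt.
move=> u; rewrite !indicE -natrM mulnb; congr (_%:R); congr nat_of_bool.
apply/idP/andP; first by move=> /set_mem[? ?]; split; apply/mem_set.
by move=> [/set_mem ? /set_mem ?]; apply/mem_set.
Qed.

(** Seals the product of [mu] with the uniform law behind the two properties used in the sequel. *)
Let PU_ex : exists PU : probability (X * R)%type R,
  (forall A B, measurable A -> measurable B -> PU (A `*` B) = (mu A * U B)%E) /\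
  (forall (A : set X) (g : X -> R), measurable A -> measurable_fun setT g ->
    (forall x, 0 <= g x <= 1) ->
    fine (PU [set z | A z.1 /\ z.2 < g z.1]) = \int[mu]_x (\1_A x * g x)).
Proof. by exists PU'; split; [exact: PU_rect'|exact: PU_lt']. Qed.

Let PU : probability (X * R)%type R := sval (cid PU_ex).
Let PU_rect := (svalP (cid PU_ex)).1.
Let PU_lt := (svalP (cid PU_ex)).2.

(** For uniform [u], the event [Q < t] agrees up to a null set with [u < dens (below t) x], whose
    measure over [A] is [b A (below t)]. *)
Let PU_Q (A : set X) t : measurable A ->
  fine (PU [set z | A z.1 /\ Q z < t]) = b A (below t).
Proof.
move=> mA; have [t2|t2] := ltP 2 t.
  have -> : [set z : X * R | A z.1 /\ Q z < t] = A `*` setT.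
    by apply/seteqP; split => z /= [Az _]; split=> //; apply/Q_lt; left.
  rewrite PU_rect// [X in (_ * X)%E]probability_setT mule1.
  have -> : below t = setT.
    apply/seteqP; split => z //= _; have /andP[_ c1] := c01 z; rewrite /below/=; lra.
  by have [_ _ _ ->] := bb.
have mA1 : measurable [set z : X * R | A z.1].
  by rewrite -[X in measurable X]setTI; exact: measurable_fst.
have mS : measurable [set z : X * R | A z.1 /\ Q z < t].
  apply: measurableI => //.
  rewrite [X in measurable X](_ : _ = Q @^-1` `]-oo, t[).
    by rewrite -[X in measurable X]setTI; exact: mQ.
  by apply/seteqP; split => z /=; rewrite in_itv.
have [bt t01 tE] := densP (mbelow t).
have mt : measurable_fun setT (dens (below t)) by case: bt.
apply/eqP; rewrite eq_le; apply/andP; split.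
  rewrite (tE _ mA) -(PU_lt mA mt t01).
  (* Densities are monotone in the threshold only almost everywhere; countably many thresholds [q n]
     leave a single null set. *)
  have : {ae mu, forall x, forall n, q n < t -> f n x <= dens (below t) x}.
    apply: ae_foralln => n; have [qt|qt] := ltP (q n) t; last first.
      by apply: aeW.
    apply: filterS (dens_mono (mbelow (q n)) (mbelow t) _).
      by move=> x h _.
    by move=> z /= /lt_trans; apply.
  move=> [N [mN N0 subN]].
  have mE : measurable [set z : X * R | A z.1 /\ z.2 < dens (below t) z.1].
    by apply: measurableI => //; exact: m_sub.
  have mNT : measurable (N `*` [set: R]) by exact: measurableX.
  rewrite fine_le ?fin_num_measure//.
  apply: (@le_trans _ _ (PU ([set z : X * R | A z.1 /\ z.2 < dens (below t) z.1] `|`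
     (N `*` setT)))).
    apply: le_measure; rewrite ?inE//; first exact: measurableU.
    move=> z /= [Az /Q_lt[|[n [_ zf qt]]]]; first by rewrite ltNge t2.
    have [Nz|nN] := pselect (N z.1); [by right|left; split => //].
    apply: lt_le_trans zf _; apply: contrapT => h; apply: nN; apply: subN => /= h'.
    exact/h/h'.
  apply: (le_trans (measureU2 _ _ _)) => //.
  by rewrite [X in (_ + X)%E]PU_rect// N0 mul0e adde0.
have [t0|t0] := leP t 0.
  have -> : below t = set0.
    apply/seteqP; split => z //=; have /andP[c0 _] := c01 z; rewrite /below/=; lra.
  have [_ _ bU _ _] := bb.
  have := bU A set0 set0 mA measurable0 measurable0 (setI0 _).
  rewrite setU0 => /eqP; rewrite -subr_eq subrr eq_sym => /eqP ->.
  exact: fine_ge0.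
(* As a measure, [b A] is continuous from below along [below (t - 1/(k+1))], and some [q n] lies
   between [t - 1/(k+1)] and [t]. *)
have [M ME] : exists M : {finite_measure set Z -> \bar R},
    forall B, measurable B -> M B = (b A B)%:E.
  apply: (@dominated_additive_measure _ _ _ nu (b A)).
  - by move=> B mB; exact: b_ge0.
  - by move=> B mB; exact: b_le2.
  - by move=> B B' mB mB' BB'; case: bb => _ _ + _ _; exact.
have cv := @nondecreasing_cvg_mu _ _ _ M (fun k => below (t - k.+1%:R^-1)).
have : M (below (t - k.+1%:R^-1)) @[k --> \oo] --> M (below t).
  have -> : below t = \bigcup_k below (t - k.+1%:R^-1).
    apply/seteqP; split => z /=; rewrite /below/=.
      move=> czt; have e0 : 0 < t - c z by rewrite subr_gt0.
      have [k] := ltr_add_invr czt; exists k => //=.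
      by rewrite ltrBrDr.
    move=> [k _ /= h]; apply: (lt_trans h).
    by rewrite gtrBl invr_gt0.
  apply: cv => //.
    by apply: bigcup_measurable.
  apply/nondecreasing_seqP => k; apply/subsetPset => z /= h.
  apply: (lt_le_trans h); rewrite lerD2l lerN2 lef_pV2 ?posrE//.
  by rewrite ler_nat.
move=> h; rewrite -lee_fin -ME// fineK ?fin_num_measure//.
rewrite -(cvg_lim _ h)//; apply: lime_le; first exact: cvgP h.
apply: nearW => k; rewrite ME//.
have [n /andP[n1 n2]] : exists n, Num.max 0 (t - k.+1%:R^-1) < q n < t.
  by apply: q_dense; rewrite gt_max t0/= gtrBl invr_gt0.
move: n1; rewrite gt_max => /andP[qn0 qnk].
have [bn n01 nE] := densP (mbelow (q n)).
apply: (@le_trans _ _ (b A (below (q n)))%:E).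
  rewrite lee_fin b_mono// => z /= zk; exact: lt_trans zk qnk.
have mn : measurable_fun setT (dens (below (q n))) by case: bn.
rewrite (nE _ mA) -(PU_lt mA mn n01) fineK ?fin_num_measure//.
  apply: le_measure; rewrite ?inE//.
    by apply: measurableI => //; exact: m_sub.
  by move=> z /= [Az zf]; split=> //; apply/Q_lt; right; exists n; split=> //; exact: ltW.
by apply: measurableI => //; exact: m_sub.
Qed.

Let PU_Qset (A : set X) (D : set R) : measurable A -> measurable D ->
  fine (PU [set z | A z.1 /\ D (Q z)]) = b A (c @^-1` D).
Proof.
move=> mA mD.
have mA1 : measurable [set z : X * R | A z.1].
  by rewrite -[X in measurable X]setTI; exact: measurable_fst.
have mAD E : measurable E -> measurable [set z | A z.1 /\ E (Q z)].
  move=> mE; apply: measurableI => //.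
  by rewrite -[X in measurable X]setTI; exact: mQ.
have mcD E : measurable E -> measurable (c @^-1` E).
  by move=> mE; rewrite -[X in measurable X]setTI; exact: mc.
pose QQ : {mfun (X * R)%type >-> R} := HB.pack Q (isMeasurableFun.Build _ _ _ _ Q mQ).
pose CC : {mfun Z >-> R} := HB.pack c (isMeasurableFun.Build _ _ _ _ c mc).
have [M1 M1E] : exists M : {finite_measure set R -> \bar R},
    forall B, measurable B -> M B = (fine (PU [set z | A z.1 /\ B (Q z)]))%:E.
  apply: (@dominated_additive_measure _ _ _ (distribution PU QQ)).
  - by move=> B mB; exact: fine_ge0.
  - move=> B mB; rewrite fine_le ?fin_num_measure//; first exact: mAD.
    apply: le_measure; rewrite ?inE//; first exact: mAD.
      by rewrite -[X in measurable X]setTI; exact: mQ.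
    by move=> z /= [].
  - move=> B B' mB mB' BB'; rewrite -fineD ?fin_num_measure//; [|exact: mAD|exact: mAD].
    rewrite -measureU; [|exact: mAD|exact: mAD|].
      congr (fine (PU _)); apply/seteqP; split => z /=.
        by move=> [Az [?|?]]; [left|right].
      by move=> [[? ?]|[? ?]]; split=> //; [left|right].
    apply/seteqP; split => z //= [[_ h1] [_ h2]].
    by rewrite -[False]/(set0 (Q z)) -BB'.
have [M2 M2E] : exists M : {finite_measure set R -> \bar R},
    forall B, measurable B -> M B = (b A (c @^-1` B))%:E.
  apply: (@dominated_additive_measure _ _ _ (distribution nu CC)).
  - by move=> B mB; apply: b_ge0 => //; exact: mcD.
  - by move=> B mB; apply: b_le2 => //; exact: mcD.
  - move=> B B' mB mB' BB'; have [_ _ bU _ _] := bb.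
    rewrite preimage_setU bU//; [exact: mcD|exact: mcD|].
    by rewrite -preimage_setI BB' preimage_set0.
apply: EFin_inj; rewrite -M1E// -M2E//.
apply: (@measure_unique _ _ _ (@RGenInftyO.G R) (fun n => `]-oo, n%:R[%classic)) => //.
- exact: RGenInftyO.measurableE.
- move=> _ _ [s ->] [t ->]; exists (Num.min s t).
  by apply/seteqP; split => x /=; rewrite !in_itv/= lt_min; [move=> [-> ->]|move=> /andP[]].
- by move=> i; exists i%:R.
- apply/seteqP; split => // x _; exists (Num.truncn `|x|).+1 => //=.
  by rewrite in_itv/= (le_lt_trans (ler_norm _))// truncnS_gt.
- move=> _ [t ->].
  refine (etrans (M1E _ (measurable_itv _)) (etrans _ (esym (M2E _ (measurable_itv _))))).
  congr (_%:E).
  rewrite (_ : c @^-1` _ = below t); last first.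
    by apply/seteqP; split => x /=; rewrite in_itv.
  suff -> : [set z | A z.1 /\ `]-oo, t[%classic (Q z)] = [set z | A z.1 /\ Q z < t].
    exact: PU_Q.
  by apply/seteqP; split => x /=; rewrite in_itv.
- by move=> k; rewrite [X in (X < _)%E](M1E _ (measurable_itv _)) ltry.
Qed.

(** [L] is the law of [(x, r (Q (x, u)))] with [x] of law [mu] and [u] uniform and independent:
    sampling the code of the second coordinate from its conditional law given [x]. *)
Lemma bimeasure_extension : exists L : probability (X * Z)%type R,
  forall A B, measurable A -> measurable B -> L (A `*` B) = (b A B)%:E.
Proof.
pose h (z : X * R) := (z.1, r (Q z)).
have mh : measurable_fun setT h.
  by apply: measurable_fun_pair => //; exact: (measurableT_comp mr mQ).
pose H : {mfun (X * R)%type >-> (X * Z)%type} :=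
  HB.pack h (isMeasurableFun.Build _ _ _ _ h mh).
exists (distribution PU H) => A B mA mB.
have mrB : measurable (r @^-1` B).
  by rewrite -[X in measurable X]setTI; exact: mr.
rewrite [RHS](_ : _ = (b A (c @^-1` (r @^-1` B)))%:E); last first.
  by congr ((b A _)%:E); apply/seteqP; split => z /=; rewrite cK.
rewrite -PU_Qset// fineK//; apply: fin_num_measure.
apply: measurableI.
  by rewrite -[X in measurable X]setTI; exact: measurable_fst.
by rewrite -[X in measurable X]setTI; exact: mQ.
Qed.

End extension.
End bimeasure.

(** * Ergodic joinings as extreme points *)

HB.instance Definition _ (I : Type) (T : I -> ptopologicalType) :=
  Pointed.copy (prod_topology T) (forall i, T i).

Section extreme_point.
Context {R : realType} {I : choiceType}.
Let V : ptopologicalType := prod_topology (fun _ : I => R : ptopologicalType).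

Definition convex_comb (t : R) (x y : I -> R) : I -> R :=
  fun i => t * x i + (1 - t) * y i.

Variable K : set V.
Hypotheses (K01 : forall k i, K k -> 0 <= k i <= 1) (Kcl : closed K).

Let coord_continuous i : continuous (fun k : V => k i).
Proof. exact: (@proj_continuous I (fun _ : I => R : ptopologicalType) i). Qed.

Let Kcompact : compact K.
Proof.
pose B : set V := [set f | forall i, `[0, 1]%classic (f i)].
have cB : compact B.
  apply: (@tychonoff I (fun _ : I => R : topologicalType) (fun=> `[0, 1]%classic)).
  by move=> i; exact: segment_compact.
apply: (@subclosed_compact V K B Kcl cB).
by move=> k Kk i /=; rewrite in_itv/=; exact: K01.
Qed.

(* The complement in K of such a set U is a nonempty closed face of K. *)
Let coface (U : set V) := [/\ open U, K `\` U !=set0 &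
  forall t x y, 0 < t < 1 -> K x -> K y -> U x -> U (convex_comb t x y)].

Let convex_combC t (x y : I -> R) : convex_comb (1 - t) y x = convex_comb t x y.
Proof. by apply/funext => i; rewrite /convex_comb subKr addrC. Qed.

Let coface_r U t x y : coface U -> 0 < t < 1 -> K x -> K y -> U y ->
  U (convex_comb t x y).
Proof.
move=> [_ _ h] t01 Kx Ky Uy; rewrite -convex_combC; apply: h => //.
by move: t01 => /andP[? ?]; rewrite subr_gt0 gtrBl; apply/andP.
Qed.

(** By compactness, if the union covered [K] then a single member of the chain would. *)
Let coface_chain (F : set (set V)) : K !=set0 -> F `<=` coface ->
  total_on F subset -> coface (\bigcup_(U in F) U).
Proof.
move=> K0 Fc Ft; split.
- by apply: bigcup_open => U /Fc[].
- apply: contrapT => h.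
  have KF : K `<=` \bigcup_(U in F) U.
    by move=> k Kk; apply: contrapT => nF; apply: h; exists k.
  have [U0 FU0] : exists U0, F U0 by have [k /KF[U]] := K0; exists U.
  have := Kcompact; rewrite compact_cover => /(_ (set V) F id).
  case=> [U /Fc[]//|//|D DF KD].
  have : forall s : seq (set V), {subset s <= F} -> exists2 U, F U &
    forall W, W \in s -> W `<=` U.
    elim=> [|W s IH] sF; first by exists U0.
    have [|U FU sU] := IH; first by move=> w ws; apply: sF; rewrite inE ws orbT.
    have FW : F W by apply/set_mem/sF; rewrite inE eqxx.
    have [WU|UW] := Ft _ _ FW FU.
      by exists U => // w; rewrite inE => /orP[/eqP->//|]; exact: sU.
    exists W => // w; rewrite inE => /orP[/eqP->//|/sU]; move/subset_trans; exact.
  move=> /(_ _ DF)[U FU DU]; have [_ [k [Kk nUk]] _] := Fc _ FU.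
  by have [W WD Wk] := KD _ Kk; apply: nUk; exact: DU Wk.
- move=> t x y t01 Kx Ky [U FU Ux]; exists U => //.
  by have [_ _] := Fc _ FU; apply.
Qed.

Let sumv (l : seq (R * I)) (k : V) : R := \sum_(p <- l) p.1 * k p.2.

Let sumv_continuous l : continuous (sumv l).
Proof.
elim: l => [|p l IH] k.
  rewrite (_ : sumv [::] = fun=> 0); first exact: cvg_cst.
  by apply/funext => ?; rewrite /sumv big_nil.
rewrite (_ : sumv (p :: l) = fun k => p.1 * k p.2 + sumv l k).
  by apply: cvgD; [apply: cvgM; [exact: cvg_cst|exact: coord_continuous]|exact: IH].
by apply/funext => ?; rewrite /sumv big_cons.
Qed.

Let sumv_comb l t x y : sumv l (convex_comb t x y) = t * sumv l x + (1 - t) * sumv l y.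
Proof.
rewrite /sumv !big_distrr/= -big_split/=; apply: eq_bigr => p _.
by rewrite /convex_comb; ring.
Qed.

(* Passing to the part of a closed face where a linear form is maximal. *)
Let coface_max (U : set V) l : coface U -> exists2 W, coface W &
  U `<=` W /\ exists2 k0, K k0 /\ ~ U k0 &
    forall k, K k -> ~ U k -> sumv l k <= sumv l k0 /\ (~ W k <-> sumv l k0 <= sumv l k).
Proof.
move=> cU; have [oU KU0 fU] := cU.
have KUc : compact (K `\` U).
  apply: (subclosed_compact _ Kcompact); last by move=> ? [].
  by rewrite setDE; apply: closedI => //; exact: open_closedC.
have [k0 /set_mem [Kk0 nUk0] k0max] := compact_EVT_max KU0 KUc
  (continuous_subspaceT (@sumv_continuous l)).
have kmax k : K k -> ~ U k -> sumv l k <= sumv l k0.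
  by move=> Kk nUk; apply: k0max; apply/mem_set.
have WE k : ~ (U `|` [set k | sumv l k < sumv l k0]) k <->
    ~ U k /\ sumv l k0 <= sumv l k.
  rewrite leNgt; split=> [h|[h1 /negP h2] [//|//]]; split=> [Uk|]; first by apply: h; left.
  by apply/negP => lt; apply: h; right.
exists (U `|` [set k | sumv l k < sumv l k0]); last first.
  split; first by move=> k Uk; left.
  exists k0 => // k Kk nUk; split; first exact: kmax.
  by split=> [/WE[]//|h]; apply/WE.
split.
- apply: openU => //.
  rewrite (_ : [set k | _] = sumv l @^-1` `]-oo, sumv l k0[).
    by apply: open_comp => [k _|]; [exact: sumv_continuous|exact: interval_open].
  by apply/seteqP; split => k /=; rewrite in_itv.
- by exists k0; split => //; apply/WE.
- move=> t x y t01 Kx Ky; have /andP[t0 t1] := t01.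
  case=> [Ux|/= ltx]; first by left; exact: fU.
  have [Uy|nUy] := pselect (U y); first by left; exact: coface_r.
  right => /=; rewrite sumv_comb; have := kmax _ Ky nUy; nra.
Qed.

(** As in the Krein-Milman theorem: a minimal closed face inside the face where the linear form is
    maximal is a single point, which is extreme. *)
Lemma extreme_point_maximizing (k0 : V) (l : seq (R * I)) : K k0 ->
  exists2 k : V, K k & \sum_(p <- l) p.1 * k0 p.2 <= \sum_(p <- l) p.1 * k p.2 /\
    forall t x y, 0 < t < 1 -> K x -> K y -> k = convex_comb t x y -> x = k.
Proof.
move=> Kk0; have c0 : coface set0.
  by split; [exact: open0|exists k0; split|].
have [W0 cW0 [_ [k1 [Kk1 _] W0E]]] := coface_max l c0.
have [|U [cU Umax]] := @Zorn_bigcup V (fun U => coface (W0 `|` U)).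
  move=> F Fc Ft; rewrite (_ : _ `|` _ =
      \bigcup_(U in [set W0] `|` [set W0 `|` U | U in F]) U); last first.
    apply/seteqP; split=> k.
      move=> [W0k|[U FU Uk]]; first by exists W0 => //; left.
      by exists (W0 `|` U); [right; exists U|right].
    move=> [_ [->|[U FU <-]]]; first by left.
    by case; [left|right; exists U].
  apply: coface_chain; first by exists k0.
    by move=> _ [->//|[U FU <-]]; exact: Fc.
  move=> _ _ [->|[U FU <-]] [->|[U' FU' <-]]; [by left|by left => x; left|
    by right => x; left|].
  by have [s|s] := Ft _ _ FU FU'; [left|right]; exact: setUS.
pose W := W0 `|` U; have cW : coface W by [].
have [_ [k [Kk nWk]] fW] := cW.
have nW0 k' : ~ W k' -> ~ W0 k' by move=> + W0k; apply; left.
have uniq k' : K k' -> ~ W k' -> k' = k.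
  move=> Kk' nWk'; apply/funext => i.
  (* Maximizing coordinate [i] on the face cannot shrink it, so the coordinate is constant there. *)
  have [W' cW' [WW' [k2 _ W'E]]] := coface_max [:: (1, i)] cW.
  have W'W : W' `<=` W.
    apply: contrapT => nW'W; apply: (Umax W').
      split=> [x Ux|W'U]; first by apply: WW'; right.
      by apply: nW'W => x /W'U Ux; right.
    by rewrite (_ : _ `|` _ = W')//; apply: setUidr => x W0x; apply: WW'; left.
  have eqi k3 : K k3 -> ~ W k3 -> k3 i = k2 i.
    move=> K3 nW3; have [le3 [+ _]] := W'E _ K3 nW3 => /(_ (fun h => nW3 (W'W _ h))) ge3.
    move: le3 ge3; rewrite /sumv !big_seq1 !mul1r => le3 ge3.
    by apply/eqP; rewrite eq_le le3 ge3.
  by rewrite !eqi.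
exists k => //; split.
  have [_ W0k] := W0E _ Kk (@id False); have [le0 _] := W0E _ Kk0 (@id False).
  by apply: (le_trans le0); apply/W0k/nW0.
move=> t x y t01 Kx Ky ke; apply: uniq => // Wx; apply: nWk.
by rewrite ke; exact: fW.
Qed.
End extreme_point.

Lemma rectangles_unique {R : realType} d d' (X : measurableType d) (Z : measurableType d')
  (m1 m2 : {finite_measure set (X * Z)%type -> \bar R}) :
  (forall A B, measurable A -> measurable B -> m1 (A `*` B) = m2 (A `*` B)) ->
  eq_meas m1 m2.
Proof.
move=> h A mA.
apply: (@measure_unique _ _ _
  [set C | exists (A : set X), measurable A /\ exists B : set Z, measurable B /\ C = A `*` B] (fun=> setT)) => //.
- rewrite measurable_prod_measurableType; congr (<<s _ >>).
  apply/seteqP; split=> C /=.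
    by move=> [A' mA' [B mB <-]]; exists A'; split=> //; exists B.
  by move=> [A' [mA' [B [mB ->]]]]; exists A' => //; exists B.
- move=> _ _ [A1 [mA1 [B1 [mB1 ->]]]] [A2 [mA2 [B2 [mB2 ->]]]].
  exists (A1 `&` A2); split; first exact: measurableI.
  exists (B1 `&` B2); split; first exact: measurableI.
  by rewrite setXI.
- by move=> _; exists setT; split=> //; exists setT; split=> //; rewrite setXTT.
- by rewrite bigcup_const//; exists 0%N.
- by move=> _ [A' [mA' [B [mB ->]]]]; exact: h.
- by move=> _; rewrite ltey_eq fin_num_measure.
Qed.

(** Birkhoff averages of the indicator of [A] along the factor tend to the constant [mu A], and
    averaging does not change the integral over the invariant set [E]. Hence conditioning a joining
    on an invariant set keeps its ergodic marginals. *)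
Lemma invariant_indep_factor {R : realType} d d' (W : measurableType d)
  (X : measurableType d') (L : probability W R) (mu : probability X R)
  (tau : W -> W) (T : X -> X) (p : W -> X) (E : set W) (A : set X) :
  measurable_fun setT tau -> measurable_fun setT T -> measurable_fun setT p ->
  eq_meas (pushforward L tau) L -> eq_meas (pushforward mu T) mu ->
  eq_meas (pushforward L p) mu -> (forall w, p (tau w) = T (p w)) ->
  ergodic mu T -> measurable E -> tau @^-1` E = E -> measurable A ->
  fine (L (E `&` p @^-1` A)) = fine (L E) * fine (mu A).
Proof.
move=> mtau mT mp Ltau muT Lp pT erg mE invE mA.
have bA := bmf_indic (R := R) mA; have bE := bmf_indic (R := R) mE.
have bAp : bmf (fun w => \1_A (p w) : R) by exact: bmf_comp.
have mpA : measurable (p @^-1` A) by rewrite -[X in measurable X]setTI; exact: mp.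
have invE' w : \1_E (tau w) = \1_E w :> R.
  by rewrite !indicE -[in RHS]invE.
have := Rint_birkhoff_limitM mtau Ltau bAp bE invE'.
have -> : \int[L]_w (\1_A (p w) * \1_E w) = fine (L (E `&` p @^-1` A)).
  rewrite -Rint_indic; last exact: measurableI.
  by apply: eq_Rint => w; rewrite !indicE -natrM mulnb in_setI andbC.
move=> <-; rewrite -!Rint_indic//.
have BLp w : birkhoff_limit tau (fun w => \1_A (p w) : R) w = birkhoff_limit T \1_A (p w).
  congr limn_sup; apply/funext => N; congr (_ / _); apply: eq_bigr => i _.
  congr (\1_A _); elim: (nat_of_ord i) => //= k <-; exact: pT.
have bl := bmf_birkhoff_limit mT bA.
rewrite mulrC -RintZ//.
apply: Rint_ae.
- by have [] : bmf (fun x => birkhoff_limit tau (fun w => \1_A (p w)) x * \1_E x :> R) by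
    apply: bmfM => //; exact: bmf_birkhoff_limit.
- by have [] := bmfZ (\int[mu]_x \1_A x) bE.
have := ergodic_invariant_cst erg bl (fun x => birkhoff_limit_invariant T x bA).
rewrite (Rint_birkhoff_limit mT muT bA) => /(ae_pushforward mp Lp).
by apply: filterS => w; rewrite BLp => ->.
Qed.

Section ergodic_joining_existence.
Context {R : realType} d d' (X : measurableType d) (Z : measurableType d')
  (mu : probability X R) (nu : probability Z R)
  (T : automorphism mu) (S : automorphism nu).
Hypotheses (ergT : ergodic mu T) (ergS : ergodic nu S).
Variables (c : Z -> R) (r : R -> Z).
Hypotheses (mc : measurable_fun setT c) (mr : measurable_fun setT r)
  (cK : cancel c r) (c01 : forall z, 0 <= c z <= 1).

Let I : choiceType := (set X * set Z)%type.
Let V := prod_topology (fun _ : I => R : ptopologicalType).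
Let mrect (i : I) := measurable i.1 /\ measurable i.2.

Let mT A : measurable A -> measurable (T @^-1` A).
Proof. by move=> mA; rewrite -[X in measurable X]setTI; exact: measurable_aut_fun. Qed.

Let mS A : measurable A -> measurable (S @^-1` A).
Proof. by move=> mA; rewrite -[X in measurable X]setTI; exact: measurable_aut_fun. Qed.

(** Joinings as points of a product of copies of [R]. Fixing the value 0 off the measurable
    rectangles keeps every coordinate in [0, 1], as compactness requires. *)
Let K : set V := [set b | [/\ bimeasure mu nu (fun A B => b (A, B)),
  forall A B, measurable A -> measurable B -> b (T @^-1` A, S @^-1` B) = b (A, B) &
  forall i, ~ mrect i -> b i = 0]].

Let K01 b i : K b -> 0 <= b i <= 1.
Proof.
move=> [[b0 bl br bX bZ] _ bn]; have [[mA mB]|/bn ->] := pselect (mrect i); last first.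
  by rewrite lexx ler01.
case: i mA mB => A B /= mA mB; rewrite b0//=.
have mD := measurableD measurableT mB.
apply: (@le_trans _ _ (b (A, setT))).
  by rewrite -(setDUK (@subsetT _ B)) br// ?setDIK// lerDl b0.
by rewrite bX// -lee_fin fineK ?fin_num_measure//; exact: probability_le1.
Qed.

Let closed_forall (J : Type) (D : J -> Prop) (C : J -> set V) :
  (forall j, D j -> closed (C j)) -> closed [set b | forall j, D j -> C j b].
Proof.
move=> h; rewrite (_ : [set b | _] = \bigcap_(j in [set j | D j]) C j).
  by apply: closed_bigI => j; exact: h.
by apply/seteqP; split.
Qed.

Let coord_continuous i : continuous (fun k : V => k i).
Proof. exact: (@proj_continuous I (fun _ : I => R : ptopologicalType) i). Qed.

Let closed_eq0 (f : V -> R) : continuous f -> closed [set b | f b = 0].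
Proof.
move=> cf; rewrite (_ : [set b | _] = f @^-1` [set x | x = 0]) //.
by apply: closed_comp => [? _|]; [exact: cf|exact: closed_eq].
Qed.

Let Kcl : closed K.
Proof.
rewrite (_ : K =
  [set b : V | forall i, mrect i -> 0 <= b i] `&`
  [set b : V | forall j : set X * set X * set Z,
    [/\ measurable j.1.1, measurable j.1.2, measurable j.2 & j.1.1 `&` j.1.2 = set0] ->
    b (j.1.1 `|` j.1.2, j.2) - b (j.1.1, j.2) - b (j.1.2, j.2) = 0] `&`
  [set b : V | forall j : set X * set Z * set Z,
    [/\ measurable j.1.1, measurable j.1.2, measurable j.2 & j.1.2 `&` j.2 = set0] ->
    b (j.1.1, j.1.2 `|` j.2) - b (j.1.1, j.1.2) - b (j.1.1, j.2) = 0] `&`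
  [set b : V | forall A, measurable A -> b (A, setT) - fine (mu A) = 0] `&`
  [set b : V | forall B, measurable B -> b (setT, B) - fine (nu B) = 0] `&`
  [set b : V | forall i, mrect i -> b (T @^-1` i.1, S @^-1` i.2) - b i = 0] `&`
  [set b : V | forall i, ~ mrect i -> b i = 0]).
  repeat apply: closedI; apply: closed_forall => j Dj.
  - rewrite [X in closed X](_ : _ = (fun b : V => b j) @^-1` [set x | 0 <= x]) //.
    by apply: closed_comp => [? _|]; [exact: coord_continuous|exact: closed_ge].
  - apply: closed_eq0 => b; apply: cvgB; [apply: cvgB|]; exact: coord_continuous.
  - apply: closed_eq0 => b; apply: cvgB; [apply: cvgB|]; exact: coord_continuous.
  - apply: closed_eq0 => b; apply: cvgB; [exact: coord_continuous|exact: cvg_cst].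
  - apply: closed_eq0 => b; apply: cvgB; [exact: coord_continuous|exact: cvg_cst].
  - apply: closed_eq0 => b; apply: cvgB; exact: coord_continuous.
  - apply: closed_eq0 => b; exact: coord_continuous.
apply/seteqP; split=> b.
  move=> [[b0 bl br bX bZ] bi bn]; repeat split => /=.
  - by move=> [A B] [/= ? ?]; exact: b0.
  - by move=> [[A A'] B] [/= ? ? ? ?]; rewrite bl//; ring.
  - by move=> [[A B] B'] [/= ? ? ? ?]; rewrite br//; ring.
  - by move=> A mA; rewrite bX// subrr.
  - by move=> B mB; rewrite bZ// subrr.
  - by move=> [A B] [/= ? ?]; rewrite bi// subrr.
  - exact: bn.
move=> [[[[[[/= b0 bl] br] bX] bZ] bi] bn]; split=> //; first split.
- by move=> A B mA mB; exact: (b0 (A, B)).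
- move=> A A' B mA mA' mB AA'; have /= := bl (A, A', B); rewrite AA' => /(_ _)/eqP.
  by move=> /(_ (And4 mA mA' mB erefl)); rewrite -addrA -opprD subr_eq0 => /eqP.
- move=> A B B' mA mB mB' BB'; have /= := br (A, B, B'); rewrite BB' => /(_ _)/eqP.
  by move=> /(_ (And4 mA mB mB' erefl)); rewrite -addrA -opprD subr_eq0 => /eqP.
- by move=> A mA; apply/eqP; rewrite -subr_eq0 bX.
- by move=> B mB; apply/eqP; rewrite -subr_eq0 bZ.
- by move=> A B mA mB; apply/eqP; rewrite -subr_eq0; apply/eqP; exact: (bi (A, B)).
Qed.

Let on_rect (m : set (X * Z) -> R) : V :=
  fun i => if `[< mrect i >] then m (i.1 `*` i.2) else 0.

Let on_rectE m A B : measurable A -> measurable B -> on_rect m (A, B) = m (A `*` B).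
Proof. by move=> mA mB; rewrite /on_rect asboolT. Qed.

Let on_rectK (m : set (X * Z) -> R) : (forall C, measurable C -> 0 <= m C) ->
  (forall C D, measurable C -> measurable D -> C `&` D = set0 ->
    m (C `|` D) = m C + m D) ->
  (forall A, measurable A -> m (A `*` setT) = fine (mu A)) ->
  (forall B, measurable B -> m (setT `*` B) = fine (nu B)) ->
  (forall A B, measurable A -> measurable B ->
    m ((T @^-1` A) `*` (S @^-1` B)) = m (A `*` B)) -> K (on_rect m).
Proof.
move=> m0 mU mX mZ mI; split; [split| |].
- by move=> A B mA mB; rewrite on_rectE//; apply: m0; exact: measurableX.
- move=> A A' B mA mA' mB AA'; rewrite !on_rectE//; last exact: measurableU.
  rewrite -mU; [|exact: measurableX|exact: measurableX|by rewrite -setXI AA' set0X].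
  by congr m; apply/seteqP; split=> -[x z] /=; tauto.
- move=> A B B' mA mB mB' BB'; rewrite !on_rectE//; last exact: measurableU.
  rewrite -mU; [|exact: measurableX|exact: measurableX|by rewrite -setXI BB' setX0].
  by congr m; apply/seteqP; split=> -[x z] /=; tauto.
- by move=> A mA; rewrite on_rectE// mX.
- by move=> B mB; rewrite on_rectE// mZ.
- by move=> A B mA mB; rewrite !on_rectE//; [exact: mI|exact: mT|exact: mS].
- by move=> i ni; rewrite /on_rect asboolF.
Qed.

Let mTS : measurable_fun setT (pair_map T S).
Proof.
apply: measurable_fun_pair.
  exact: (measurableT_comp (measurable_aut_fun T) measurable_fst).
exact: (measurableT_comp (measurable_aut_fun S) measurable_snd).
Qed.

(** An extreme joining is ergodic, since an invariant set of intermediate measure would split it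
    into its two conditional measures, again joinings. Maximizing the linear form among joinings
    thus produces an ergodic one. *)
Lemma ergodic_joining_above (L' : probability (X * Z)%type R)
    (l : seq (R * (set X * set Z))) : joining T S L' ->
  (forall p, p \in l -> measurable p.2.1 /\ measurable p.2.2) ->
  exists2 L, ergodic_joining T S L &
    \sum_(p <- l) p.1 * fine (L' (p.2.1 `*` p.2.2)) <=
    \sum_(p <- l) p.1 * fine (L (p.2.1 `*` p.2.2)).
Proof.
move=> [L'X L'Z L'I] ml.
have KL' : K (on_rect (fun C => fine (L' C))).
  apply: on_rectK => /=.
  - by move=> C _; exact: fine_ge0.
  - by move=> C D mC mD CD; rewrite measureU// fineD// fin_num_measure.
  - by move=> A mA; rewrite setXT -L'X.
  - by move=> B mB; rewrite setTX -L'Z.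
  - move=> A B mA mB; rewrite -[in RHS]L'I//; exact: measurableX.
have [k Kk [lk kext]] := extreme_point_maximizing K01 Kcl l KL'.
have [bk kI _] := Kk.
have [L LE] := bimeasure_extension mc mr cK c01 bk.
have LX : eq_meas (pushforward L fst) mu.
  move=> A mA; have [_ _ _ bX _] := bk.
  rewrite [LHS](_ : _ = L (A `*` setT)); last by rewrite setXT.
  by rewrite LE// bX// fineK ?fin_num_measure.
have LZ : eq_meas (pushforward L snd) nu.
  move=> B mB; have [_ _ _ _ bZ] := bk.
  rewrite [LHS](_ : _ = L (setT `*` B)); last by rewrite setTX.
  by rewrite LE// bZ// fineK ?fin_num_measure.
pose TS : {mfun (X * Z)%type >-> (X * Z)%type} :=
  HB.pack (pair_map T S) (isMeasurableFun.Build _ _ _ _ _ mTS).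
have LI : eq_meas (pushforward L (pair_map T S)) L.
  apply: (rectangles_unique (m1 := distribution L TS)) => A B mA mB.
  rewrite [LHS](_ : _ = L ((T @^-1` A) `*` (S @^-1` B)))//.
  rewrite (LE _ _ (mT mA) (mS mB)) kI//; exact: (esym (LE _ _ mA mB)).
exists L; last first.
  rewrite (eq_big_seq (fun p => p.1 * on_rect (fun C => fine (L' C)) p.2)); last first.
    by move=> [x [A B]] /ml/= [mA mB]; rewrite on_rectE.
  rewrite [leRHS](eq_big_seq (fun p => p.1 * k p.2))//.
  by move=> [x [A B]] /ml/= [mA mB]; rewrite LE.
split=> // E mE EI.
have Lfin C : measurable C -> L C = (fine (L C))%:E.
  by move=> mC; rewrite fineK// fin_num_measure.
have mE' : measurable (~` E) by exact: measurableC.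
have EI' : pair_map T S @^-1` (~` E) = ~` E by rewrite -{2}EI.
set a := fine (L E).
have aC : fine (L (~` E)) = 1 - a.
  by rewrite probability_setC// (Lfin E mE) -EFinB.
have [a0|an0] := eqVneq a 0; first by left; rewrite (Lfin E mE) -/a a0.
have [a1|an1] := eqVneq a 1; first by right; rewrite (Lfin E mE) -/a a1.
have age0 : 0 <= a by exact: fine_ge0.
have a'ge0 : 0 <= 1 - a by rewrite -aC; exact: fine_ge0.
have a01 : 0 < a < 1.
  by rewrite !lt_neqAle eq_sym an0 age0 an1/= -subr_ge0.
pose cond (D : set (X * Z)) := on_rect (fun C => fine (L (D `&` C)) / fine (L D)).
have condK D : measurable D -> pair_map T S @^-1` D = D -> fine (L D) != 0 ->
    K (cond D).
  move=> mD DI D0; apply: on_rectK.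
  - by move=> C _; rewrite divr_ge0// fine_ge0.
  - move=> C C' mC mC' CC'; rewrite setIUr measureU; [|exact: measurableI|exact: measurableI|].
      by rewrite fineD ?mulrDl//; apply: fin_num_measure; exact: measurableI.
    by rewrite setIACA CC' setI0.
  - move=> A mA; rewrite setXT (invariant_indep_factor mTS (measurable_aut_fun T)
      measurable_fst LI (aut_preserving T) LX _ ergT mD DI mA)//.
    by rewrite mulrAC divff// mul1r.
  - move=> B mB; rewrite setTX (invariant_indep_factor mTS (measurable_aut_fun S)
      measurable_snd LI (aut_preserving S) LZ _ ergS mD DI mB)//.
    by rewrite mulrAC divff// mul1r.
  - move=> A B mA mB; congr (fine _ / _); rewrite -[in RHS]LI; last first.
      by apply: measurableI => //; exact: measurableX.
    by rewrite /pushforward preimage_setI DI.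
have kE : k = convex_comb a (cond E) (cond (~` E)).
  apply/funext => -[A B]; rewrite /convex_comb.
  have [[mA mB]|nAB] := pselect (mrect (A, B)); last first.
    have [_ _ ->//] := Kk.
    by rewrite /cond /on_rect !asboolF// !mulr0 addr0.
  have mAB : measurable (A `*` B) by exact: measurableX.
  rewrite /cond !on_rectE// aC mulrCA divff// mulr1 mulrCA divff ?mulr1; last first.
    by rewrite subr_eq0 eq_sym.
  rewrite -fineD ?fin_num_measure//; [|exact: measurableI|exact: measurableI].
  rewrite -measureU; [|exact: measurableI|exact: measurableI|].
    by rewrite -setIUl setUv setTI; exact: (esym (congr1 fine (LE _ _ mA mB))).
  by rewrite setIACA setICr set0I.
have cE : cond E = k.
  apply: (kext a _ _ a01 _ _ kE); first exact: condK.
  by apply: condK => //; rewrite aC subr_eq0 eq_sym.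
have [M1 M1E] : exists M : {finite_measure set (X * Z)%type -> \bar R},
    forall C, measurable C -> M C = (fine (L (E `&` C)))%:E.
  apply: (@dominated_additive_measure _ _ _ L).
  - by move=> C _; exact: fine_ge0.
  - move=> C mC; rewrite fine_le ?fin_num_measure//; first exact: measurableI.
    by apply: le_measure; rewrite ?inE//; exact: measurableI.
  - move=> C D mC mD CD; rewrite setIUr measureU; [|exact: measurableI|exact: measurableI|].
      by rewrite fineD//; apply: fin_num_measure; exact: measurableI.
    by rewrite setIACA CD setI0.
have [M2 M2E] : exists M : {finite_measure set (X * Z)%type -> \bar R},
    forall C, measurable C -> M C = (a * fine (L C))%:E.
  apply: (@dominated_additive_measure _ _ _ L).
  - by move=> C _; rewrite mulr_ge0// fine_ge0.
  - by move=> C mC; rewrite ler_piMl// ?fine_ge0//; lra.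
  - by move=> C D mC mD CD; rewrite measureU// fineD ?fin_num_measure// mulrDr.
have M12 : eq_meas M1 M2.
  apply: rectangles_unique => A B mA mB; have mAB := measurableX mA mB.
  rewrite M1E// M2E//; congr (_%:E).
  have := congr1 (fun k => k (A, B)) cE; rewrite /cond on_rectE// -[k _]/(fine (k (A, B))%:E).
  by rewrite -LE// -/a => <-; rewrite mulrCA divff// mulr1.
(* Extremality makes [E] independent of every measurable set, in particular of itself:
   [a = a * a]. *)
have := M12 E mE; rewrite M1E// M2E// setIid -/a => -[] /eqP.
by rewrite -{1}(mulr1 a) (inj_eq (mulfI an0)) eq_sym (negPf an1).
Qed.

End ergodic_joining_existence.

(** * Relatively independent lifts of joinings *)

Section joining_lift.
Context {R : realType} dX dY dZ (X : measurableType dX) (Y : measurableType dY)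
  (Z : measurableType dZ).
Context (mu : probability X R) (P : probability Y R) (nu : probability Z R)
  (T : automorphism mu) (SY : automorphism P) (SZ : automorphism nu).
Variable h : Z -> Y.
Hypotheses (mh : measurable_fun setT h) (nuh : eq_meas (pushforward nu h) P)
  (hS : forall z, h (SZ z) = SY (h z)).
Variable lam : probability (X * Y)%type R.
Hypothesis jlam : joining T SY lam.

Let density_ex : exists k : set X -> Y -> R, forall A, measurable A ->
  [/\ bmf (k A), forall y, 0 <= k A y <= 1 &
      forall B, measurable B -> fine (lam (A `*` B)) = \int[P]_y (\1_B y * k A y)].
Proof.
have /choice[k kP] : forall A, exists k : Y -> R, measurable A ->
  [/\ bmf k, forall y, 0 <= k y <= 1 &
      forall B, measurable B -> fine (lam (A `*` B)) = \int[P]_y (\1_B y * k y)].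
  move=> A; have [mA|nA] := pselect (measurable A); last by exists (fun=> 0).
  have [lX lY _] := jlam.
  have [|||k kP] := @dominated_density R _ _ P (fun B => fine (lam (A `*` B))).
  - by move=> B _; exact: fine_ge0.
  - move=> B mB; rewrite -lY// /pushforward -setTX.
    rewrite fine_le ?fin_num_measure//; [exact: measurableX|exact: measurableX|].
    by apply: le_measure; rewrite ?inE; [exact: measurableX|exact: measurableX|exact: setSX].
  - move=> B B' mB mB' BB'; rewrite -fineD ?fin_num_measure//; [|exact: measurableX|exact: measurableX].
    rewrite -measureU; [|exact: measurableX|exact: measurableX|by rewrite -setXI BB' setX0].
    by congr (fine (lam _)); apply/seteqP; split=> -[x z] /=; tauto.
  - by exists k.
by exists k.
Qed.

Let k : set X -> Y -> R := sval (cid density_ex).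
Let kP A : measurable A -> [/\ bmf (k A), forall y, 0 <= k A y <= 1 &
      forall B, measurable B -> fine (lam (A `*` B)) = \int[P]_y (\1_B y * k A y)].
Proof. by rewrite /k; case: cid => f /= g; exact: g. Qed.

(* The conditional probability of A given h z, integrated over B; in the      *)
(* lifted joining X and Z are independent conditionally on Y.                 *)
Let b (A : set X) (B : set Z) : R := \int[nu]_z (\1_B z * k A (h z)).

Let bkh A : measurable A -> bmf (fun z => k A (h z)).
Proof. by move=> mA; have [bk _ _] := kP mA; exact: bmf_comp. Qed.

Let mh' B : measurable B -> measurable (h @^-1` B).
Proof. by move=> mB; rewrite -[X in measurable X]setTI; exact: mh. Qed.

Let bh A B : measurable A -> measurable B -> b A (h @^-1` B) = fine (lam (A `*` B)).
Proof.
move=> mA mB; have [bk _ kE] := kP mA; rewrite kE// /b.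
have bB := bmf_indic (R := R) mB.
by rewrite -(Rint_pushforward mh nuh (bmfM bB bk)).
Qed.

Let bZ B : measurable B -> bmf (\1_B : Z -> R).
Proof. exact: bmf_indic. Qed.

Let eq_b A B f : measurable A -> measurable B -> bmf f ->
  {ae P, forall y, k A y = f y} -> b A B = \int[nu]_z (\1_B z * f (h z)).
Proof.
move=> mA mB bf /(ae_pushforward mh nuh) kf.
have [m1 _] := bmfM (bZ mB) (bkh mA); have [m2 _] := bmfM (bZ mB) (bmf_comp mh bf).
by apply: (Rint_ae m1 m2); apply: filterS kf => z ->.
Qed.

Let b_bimeasure : bimeasure mu nu b.
Proof.
have [lX lY lI] := jlam; split.
- move=> A B mA mB; apply: Rint_ge0 => z; have [_ k01 _] := kP mA.
  by rewrite mulr_ge0//; have /andP[] := k01 (h z).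
- move=> A A' B mA mA' mB AA'.
  have [b1 _ e1] := kP mA; have [b2 _ e2] := kP mA'; have [b3 _ e3] := kP (measurableU _ _ mA mA').
  rewrite (eq_b (f := fun y => k A y + k A' y) _ mB (bmfD b1 b2)); last 2 first.
  - exact: measurableU.
  - apply: (density_eq b3 (bmfD b1 b2)) => C mC; have bC := bmf_indic (R := R) mC.
    under [RHS]eq_Rint do rewrite mulrDr.
    rewrite RintD; [|exact: bmfM|exact: bmfM].
    rewrite -e1// -e2// -e3// -fineD ?fin_num_measure//; [|exact: measurableX|exact: measurableX].
    rewrite -measureU; [|exact: measurableX|exact: measurableX|by rewrite -setXI AA' set0X].
    by congr (fine (lam _)); apply/seteqP; split=> -[x z] /=; tauto.
  under eq_Rint do rewrite mulrDr.
  by rewrite RintD//; apply: bmfM (bZ mB) (bkh _).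
- move=> A B B' mA mB mB' BB'; rewrite /b -RintD; [|exact: bmfM (bZ _) (bkh _)|exact: bmfM (bZ _) (bkh _)].
  apply: eq_Rint => z; rewrite -mulrDl; congr (_ * _).
  by rewrite !indicE in_setU; have [zB|] := boolP (z \in B); have [zB'|] := boolP (z \in B');
    rewrite ?add0r ?addr0//; move: (set_mem zB) (set_mem zB') => ? ?;
    have : (B `&` B') z by []; rewrite BB'.
- move=> A mA; rewrite -(preimage_setT h) bh//.
  by rewrite setXT -lX.
- move=> B mB; have [b1 _ e1] := kP measurableT.
  rewrite (eq_b (f := fun=> 1) _ mB (bmf_cst _ _)); last 2 first.
  - exact: measurableT.
  - apply: (density_eq b1 (bmf_cst _ _)) => C mC.
    by rewrite -e1// setTX -/(pushforward lam snd C) lY//; under [RHS]eq_Rint do rewrite mulr1; rewrite Rint_indic.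
  by under eq_Rint do rewrite mulr1; rewrite Rint_indic.
Qed.

Let b_invariant A B : measurable A -> measurable B ->
  b (T @^-1` A) (SZ @^-1` B) = b A B.
Proof.
move=> mA mB; have [lX lY lI] := jlam.
have mTA : measurable (T @^-1` A).
  by rewrite -[X in measurable X]setTI; exact: measurable_aut_fun.
have mSB : measurable (SZ @^-1` B).
  by rewrite -[X in measurable X]setTI; exact: measurable_aut_fun.
have [b1 _ e1] := kP mA; have [b2 _ e2] := kP mTA.
have bkS : bmf (fun y => k A (SY y)) by apply: bmf_comp => //; exact: measurable_aut_fun.
(* Invariance of [lam] and almost sure uniqueness of densities identify the density for the preimage
   of [A] with [k A] composed with [SY]. *)
rewrite (eq_b (f := fun y => k A (SY y)) mTA mSB bkS); last first.
  apply: (density_eq b2 bkS) => C mC.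
  have mC' : measurable (aut_inv SY @^-1` C).
    by rewrite -[X in measurable X]setTI; exact: measurable_aut_inv.
  have CE : C = SY @^-1` (aut_inv SY @^-1` C).
    by apply/seteqP; split=> y /=; rewrite aut_funK.
  rewrite -e2// {1}CE.
  rewrite (_ : _ `*` _ = pair_map T SY @^-1` (A `*` (aut_inv SY @^-1` C)))//.
  rewrite -[lam (_ @^-1` _)]/(pushforward lam (pair_map T SY) _) lI; last exact: measurableX.
  rewrite e1// -(Rint_pushforward (measurable_aut_fun SY) (aut_preserving SY)); last first.
    by apply: bmfM => //; exact: bmf_indic.
  by apply: eq_Rint => y; congr (_ * _); rewrite [in RHS]CE.
rewrite [RHS]/b -[RHS](Rint_pushforward (measurable_aut_fun SZ) (aut_preserving SZ)); last first.
  by apply: bmfM; [exact: bZ|exact: bkh].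
by apply: eq_Rint => z; rewrite hS.
Qed.

(** The relatively independent extension: [b] is an invariant bimeasure, and its extension restricts
    to [lam] on sets coming from [Y]. *)
Lemma joining_lift (c : Z -> R) (r : R -> Z) :
  measurable_fun setT c -> measurable_fun setT r -> cancel c r ->
  (forall z, 0 <= c z <= 1) ->
  exists2 L, joining T SZ L & forall A B, measurable A -> measurable B ->
    L (A `*` (h @^-1` B)) = lam (A `*` B).
Proof.
move=> mc mr cK c01; have [L LE] := bimeasure_extension mc mr cK c01 b_bimeasure.
have [_ _ _ bX bZ'] := b_bimeasure.
exists L; last first.
  by move=> A B mA mB; rewrite LE ?bh ?fineK ?fin_num_measure//; [exact: measurableX|exact: mh'].
split.
- move=> A mA; rewrite [LHS](_ : _ = L (A `*` setT)); last by rewrite setXT.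
  by rewrite LE// bX// fineK ?fin_num_measure.
- move=> B mB; rewrite [LHS](_ : _ = L (setT `*` B)); last by rewrite setTX.
  by rewrite LE// bZ'// fineK ?fin_num_measure.
have mTS : measurable_fun setT (pair_map T SZ).
  apply: measurable_fun_pair.
    exact: (measurableT_comp (measurable_aut_fun T) measurable_fst).
  exact: (measurableT_comp (measurable_aut_fun SZ) measurable_snd).
pose TS : {mfun (X * Z)%type >-> (X * Z)%type} :=
  HB.pack (pair_map T SZ) (isMeasurableFun.Build _ _ _ _ _ mTS).
apply: (rectangles_unique (m1 := distribution L TS)) => A B mA mB.
have mTA : measurable (T @^-1` A).
  by rewrite -[X in measurable X]setTI; exact: measurable_aut_fun.
have mSB : measurable (SZ @^-1` B).
  by rewrite -[X in measurable X]setTI; exact: measurable_aut_fun.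
rewrite [LHS](_ : _ = L ((T @^-1` A) `*` (SZ @^-1` B)))//.
by rewrite (LE _ _ mTA mSB) b_invariant//; exact: (esym (LE _ _ mA mB)).
Qed.

End joining_lift.

(** * Standard Borel structure of the space of sequences *)

Section sequence_space.
Context {R : realType}.

(* Zseq with the topology of pointwise convergence; in the ball of radius e   *)
(* only the finitely many coordinates of code less than 1/e are constrained.  *)
Definition seq_space := int -> R.

HB.instance Definition _ := Choice.on seq_space.
HB.instance Definition _ := isPointed.Build seq_space (fun=> 0).

Let ball (x : seq_space) (e : R) (y : seq_space) : Prop :=
  forall i : int, (choice.pickle i)%:R * e < 1 -> `|x i - y i| < e.

Let ent : set_system (seq_space * seq_space) := entourage_ ball.
Let nbhs (x : seq_space) : set_system seq_space := nbhs_ ent x.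
Let nbhsE : nbhs = nbhs_ ent. Proof. by []. Qed.

HB.instance Definition _ := hasNbhs.Build seq_space nbhs.

Let ball_center x (e : R) : 0 < e -> ball x e x.
Proof. by move=> e0 i _; rewrite subrr normr0. Qed.

Let ball_sym x y (e : R) : ball x e y -> ball y e x.
Proof. by move=> h i /h; rewrite distrC. Qed.

Let ball_gt0 x y (e : R) : ball x e y -> 0 < e.
Proof.
move=> h; rewrite ltNge; apply/negP => e0.
suff /h : (choice.pickle (0 : int))%:R * e < 1 by rewrite ltNge (le_trans e0).
by rewrite (le_lt_trans _ ltr01)// mulr_ge0_le0.
Qed.

Let ball_triangle x y z e1 e2 : ball x e1 y -> ball y e2 z -> ball x (e1 + e2) z.
Proof.
move=> h1 h2 i; have [e10 e20] := (ball_gt0 h1, ball_gt0 h2).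
rewrite mulrDr => ie.
have ie1 : 0 <= (choice.pickle i)%:R * e1 by rewrite mulr_ge0// ltW.
have ie2 : 0 <= (choice.pickle i)%:R * e2 by rewrite mulr_ge0// ltW.
rewrite -(subrKA (y i)) (le_lt_trans (ler_normD _ _))// ltrD//.
  by apply: h1; lra.
by apply: h2; lra.
Qed.

Let entourageE : ent = entourage_ ball. Proof. by []. Qed.

HB.instance Definition _ := @Nbhs_isPseudoMetric.Build R seq_space
  ent nbhsE ball ball_center ball_sym ball_triangle entourageE.

Lemma seq_ballE (x y : seq_space) (e : R) : pseudometric_structure.ball x e y <->
  forall i : int, (choice.pickle i)%:R * e < 1 -> `|x i - y i| < e.
Proof. by []. Qed.

End sequence_space.
Arguments seq_space : clear implicits.

Section sequence_space_complete.
Context {R : realType}.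
Implicit Types x y : seq_space R.

(** A radius small enough for a ball to constrain coordinate [i]. *)
Let pick_lt1 (i : int) (e : R) : 0 < e -> exists2 e', 0 < e' &
  e' <= e /\ (choice.pickle i)%:R * e' < 1.
Proof.
move=> e0; set n := (choice.pickle i)%:R : R; have n0 : 0 <= n by exact: ler0n.
exists (Num.min e (n + 1)^-1); first by rewrite lt_min e0 invr_gt0 ltr_wpDl.
split; first by rewrite ge_min lexx.
apply: (@le_lt_trans _ _ (n * (n + 1)^-1)).
  by rewrite ler_wpM2l// ge_min lexx orbT.
by rewrite ltr_pdivrMr ?ltr_wpDl// mul1r ltrDl.
Qed.

Let seq_space_complete (F : set_system (seq_space R)) :
  ProperFilter F -> cauchy F -> cvg F.
Proof.
move=> FF /cauchyP Fc.
have Fi i : exists l : R, x i @[x --> F] --> l.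
  suff /cauchy_cvg/cvg_ex : cauchy ((fun x : seq_space R => x i) @ F) by [].
  apply: cauchy_exP => e e0.
  have [e' e'0 [e'e ie']] := pick_lt1 i e0.
  have [x Fx] := Fc _ e'0; exists (x i).
  suff : F [set y | pseudometric_structure.ball (x i) e (y i)] by [].
  apply: filterS Fx => y /(seq_ballE _ _ _).1/(_ i ie') xy.
  by rewrite -ball_normE/= (lt_le_trans xy).
have [l Fl] := choice Fi.
apply/cvg_ex; exists (l : seq_space R); apply/cvg_ballP => e e0.
have e20 : 0 < e / 2 by rewrite divr_gt0.
have [x Fx] := Fc _ e20.
have xl i : (choice.pickle i)%:R * (e / 2) < 1 -> `|x i - l i| <= e / 2.
  move=> ie; apply/ler_addgt0Pr => d d0.
  have /cvg_ballP/(_ _ d0) Fd := Fl i.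
  have [y [yl xy]] := filter_ex (filterI Fd Fx).
  rewrite -(subrKA (y i)) (le_trans (ler_normD _ _))// lerD//.
    by apply/ltW; exact: ((seq_ballE _ _ _).1 xy i ie).
  by move: yl; rewrite /= -ball_normE/= distrC => /ltW.
apply: filterS Fx => y xy; apply/seq_ballE => i ie.
have ie2 : (choice.pickle i)%:R * (e / 2) < 1.
  apply: le_lt_trans ie; rewrite ler_wpM2l//; lra.
have xyi := (seq_ballE _ _ _).1 xy i ie2.
rewrite -(subrKA (x i)) (le_lt_trans (ler_normD _ _))// [ltRHS]splitr.
by rewrite ler_ltD// distrC xl.
Qed.

HB.instance Definition _ := Uniform_isComplete.Build (seq_space R) seq_space_complete.

Let seq_space_hausdorff : hausdorff_space (seq_space R).
Proof.
rewrite ball_hausdorff => x y xy.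
have [i xyi] : exists i, x i != y i.
  apply: contrapT => h; move/eqP: xy; apply; apply/funext => i.
  by apply/eqP; apply: contra_notT h => ?; exists i.
have e0 : 0 < `|x i - y i| / 2 by rewrite divr_gt0// normr_gt0 subr_eq0.
have [e e'0 [ee ie]] := pick_lt1 i e0.
exists (PosNum e'0, PosNum e'0) => /=; apply/eqP/seteqP; split=> // z [xz yz].
have := (seq_ballE _ _ _).1 xz i ie; have := (seq_ballE _ _ _).1 yz i ie.
have := ler_normD (x i - z i) (z i - y i); rewrite subrKA [`|z i - _|]distrC.
by lra.
Qed.

Let rat_point (s : seq rat) : seq_space R := fun i => ratr (nth 0 s (choice.pickle i)).

Let rat_point_dense (x : seq_space R) (e : R) : 0 < e ->
  exists s, pseudometric_structure.ball x e (rat_point s).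
Proof.
move=> e0.
have /choice[q qP] : forall i, exists q : rat, `|x i - ratr q| < e.
  move=> i.
  have /rat_in_itvoo[q] : x i - e < x i + e by lra.
  by rewrite in_itv/= => /andP[? ?]; exists q; rewrite ltr_norml; apply/andP; split; lra.
pose N := Num.truncn e^-1.
exists (mkseq (fun n => odflt 0 (omap q (choice.unpickle n))) N.+1).
apply/seq_ballE => i ie; rewrite /rat_point nth_mkseq; first by rewrite choice.pickleK/= qP.
have e'0 : 0 <= e^-1 by rewrite invr_ge0 ltW.
by rewrite ltnS /N (truncn_ge_nat _ e'0) -[leRHS]div1r ler_pdivlMr// ltW.
Qed.

Let rat_points : set (seq_space R) := range rat_point.

Let measurable_seq_ball (x : seq_space R) (e : R) :
  measurable (pseudometric_structure.ball x e : set (Zseq R)).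
Proof.
rewrite (_ : pseudometric_structure.ball x e = \bigcap_(n : nat)
    [set y : Zseq R | forall i : int, choice.pickle i = n -> n%:R * e < 1 -> `|x i - y i| < e]).
  apply: bigcap_measurable => // n _.
  have [ne|ne] := boolP (n%:R * e < 1); last first.
    rewrite (_ : [set y | _] = setT)//; apply/seteqP; split=> y //= _ i _.
  have [[i iP]|nex] := pselect (exists i : int, choice.pickle i = n); last first.
    by rewrite (_ : [set y | _] = setT)//; apply/seteqP; split=> y //= _ i ip; case: nex; exists i.
  rewrite (_ : [set y | _] = (fun y : Zseq R => y i) @^-1` `]x i - e, x i + e[).
    rewrite -[X in measurable X]setTI.
    exact: (@measurable_coord _ _ (fun _ : int => R : measurableType _)).
  apply/seteqP; split=> y /=; rewrite in_itv/=.
    by move=> /(_ i iP isT); rewrite ltr_norml => /andP[? ?]; apply/andP; split; lra.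
  move=> /andP[? ?] j; rewrite -iP => /(pcan_inj choice.pickleK) -> _.
  by rewrite ltr_norml; apply/andP; split; lra.
apply/seteqP; split=> y.
  by move=> /(seq_ballE _ _ _).1 h n _ i /= <-; exact: h.
by move=> h; apply/seq_ballE => i ie; exact: (h (choice.pickle i) I i).
Qed.

(** An open set is the countable union of the balls it contains with centre a rational sequence,
    eventually 0 along the enumeration of the indices, and radius [1/(m+1)]. *)
Let open_measurable (U : set (seq_space R)) : open U -> measurable (U : set (Zseq R)).
Proof.
move=> oU; pose s n : seq rat := odflt [::] (choice.unpickle n).
rewrite (_ : U = \bigcup_n \bigcup_m
    (if `[< pseudometric_structure.ball (rat_point (s n)) m.+1%:R^-1 `<=` U >]
     then pseudometric_structure.ball (rat_point (s n)) m.+1%:R^-1 else set0)).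
  apply: bigcup_measurable => n _; apply: bigcup_measurable => m _.
  by case: ifP => // _; exact: measurable_seq_ball.
apply/seteqP; split=> x; last by move=> [n _ [m _]]; case: ifP => // /asboolP; apply.
move: oU; rewrite openE => /[apply] /nbhs_ballP[e /= e0 eU].
have [m me] : exists m : nat, m.+1%:R^-1 < e / 2 :> R.
  by have := @ltr_add_invr R 0 (e / 2); rewrite divr_gt0// => /(_ isT)[m]; rewrite add0r; exists m.
have m0 : 0 < m.+1%:R^-1 :> R by rewrite invr_gt0.
have [t xt] := rat_point_dense x m0.
exists (choice.pickle t) => //; exists m => //; rewrite /s choice.pickleK/=.
rewrite asboolT; first exact: ball_sym.
move=> y ty; apply: eU; apply: (@le_ball _ _ _ (m.+1%:R^-1 + m.+1%:R^-1)).
  by rewrite [leRHS]splitr lerD// ltW.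
exact: ball_triangle ty.
Qed.

Lemma standard_borel_Zseq : standard_borel R (Zseq R).
Proof.
exists (seq_space R), id; split.
- exact: seq_space_hausdorff.
- exists rat_points; split.
    apply: (@card_le_trans _ _ _ [set: seq rat]); first exact: card_image_le.
    exact: countableP.
  move=> U [x Ux] oU; move: oU; rewrite openE => /(_ _ Ux)/nbhs_ballP[e /= e0 eU].
  have [s xs] := rat_point_dense x e0.
  by exists (rat_point s); split; [exact: eU|exists s].
- by exists id.
move=> A; rewrite image_id; split.
  apply: smallest_sub; first exact: smallest_sigma_algebra.
  move=> _ [i [B [mB ->]]].
  have mi : measurable_fun setT
      ((fun x => x i) : g_sigma_algebraType (@open (seq_space R)) -> R).
    apply: (measurability _ (RGenInftyO.measurableE R)) => // _ [_ [t ->] <-].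
    rewrite setTI; apply: sub_sigma_algebra; rewrite openE => x /=.
    rewrite in_itv/= => xt; have e0 : 0 < t - x i by rewrite subr_gt0.
    have [e e'0 [ee ie]] := pick_lt1 i e0.
    apply/nbhs_ballP; exists e => // y /(seq_ballE _ _ _).1/(_ i ie).
    by rewrite /= in_itv/= ltr_norml => /andP[? ?]; lra.
  by have := mi measurableT B mB; rewrite setTI.
apply: smallest_sub; first exact: sigma_algebra_measurable.
exact: open_measurable.
Qed.

End sequence_space_complete.

(** * Measurable coding of countably many reals by one real *)

Section ternary_code.
Context {R : realType}.

(* phi drops the first digit of a ternary expansion with digits 0 and 2.      *)
Let phi (t : R) : R := 3 * t - (if 1 / 2 <= t then 2 else 0).
Let digit m (t : R) : bool := 1 / 2 <= iter m phi t.

Let psum (b : nat -> bool) (N : nat) : R :=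
  \sum_(m < N) (if b m then 2 else 0) / 3 ^+ m.+1.
Let tern b := limn (psum b).

Let psum_nd b : nondecreasing_seq (psum b).
Proof.
apply/nondecreasing_seqP => N; rewrite [leRHS]big_ord_recr/= lerDl.
by rewrite divr_ge0 ?exprn_ge0//; case: (b N).
Qed.

Let psum_le b N : psum b N <= 1 - (3 ^+ N)^-1.
Proof.
elim: N => [|N IH]; first by rewrite /psum big_ord0 expr0 invr1 subrr.
rewrite [leLHS]big_ord_recr/= exprS.
have e0 : (3 ^+ N : R) != 0 by rewrite expf_neq0// pnatr_eq0.
have : (if b N then 2 else 0) / (3 * 3 ^+ N) <= 2 / (3 * 3 ^+ N) :> R.
  by rewrite ler_wpM2r ?invr_ge0 ?mulr_ge0 ?exprn_ge0//; case: (b N).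
have -> : 1 - (3 * 3 ^+ N)^-1 = 1 - (3 ^+ N)^-1 + 2 / (3 * 3 ^+ N) :> R by field.
exact: lerD.
Qed.

Let psum01 b N : 0 <= psum b N <= 1.
Proof.
apply/andP; split; first by apply: sumr_ge0 => m _; rewrite divr_ge0 ?exprn_ge0//; case: (b m).
by apply: le_trans (psum_le b N) _; rewrite gerBl invr_ge0 exprn_ge0.
Qed.

Let psum_cvg b : psum b N @[N --> \oo] --> tern b.
Proof.
apply: nondecreasing_is_cvgn; first exact: psum_nd.
by exists 1 => _ [N _ <-]; have /andP[] := psum01 b N.
Qed.

Let tern01 b : 0 <= tern b <= 1.
Proof.
apply/andP; split.
  apply: limr_ge; first exact: psum_cvg.
  by apply: nearW => N; have /andP[] := psum01 b N.
apply: limr_le; first exact: psum_cvg.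
by apply: nearW => N; have /andP[] := psum01 b N.
Qed.

Let tern_rec b : tern b = ((if b 0 then 2 else 0) + tern (fun m => b m.+1)) / 3.
Proof.
have h : psum b N.+1 @[N --> \oo] --> tern b by rewrite cvg_shiftS; exact: psum_cvg.
have e N : psum b N.+1 = ((if b 0 then 2 else 0) + psum (fun m => b m.+1) N) / 3.
  rewrite /psum big_ord_recl/= mulrDl expr1; congr (_ + _).
  by rewrite big_distrl/=; apply: eq_bigr => m _; rewrite exprSr invfM mulrA.
have h' : psum b N.+1 @[N --> \oo] -->
    ((if b 0 then 2 else 0) + tern (fun m => b m.+1)) / 3.
  under eq_fun do rewrite e.
  apply: cvgM; last exact: cvg_cst.
  by apply: cvgD; [exact: cvg_cst|exact: psum_cvg].
by rewrite -(cvg_lim (@Rhausdorff R) h) (cvg_lim (@Rhausdorff R) h').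
Qed.

(** The digits after the first contribute at most 1/3, so the value avoids the middle third and 1/2
    separates the two cases. *)
Let half_tern b : (1 / 2 <= tern b) = b 0.
Proof.
have := tern01 (fun m => b m.+1); rewrite (tern_rec b).
by case: (b 0) => /andP[? ?]; [|apply/negbTE; rewrite -ltNge]; lra.
Qed.

Let phi_tern b : phi (tern b) = tern (fun m => b m.+1).
Proof. by rewrite /phi half_tern (tern_rec b); case: (b 0); field. Qed.

Let digit_tern b m : digit m (tern b) = b m.
Proof.
rewrite /digit; elim: m b => [|m IH] b; first exact: half_tern.
by rewrite iterSr phi_tern IH.
Qed.

Let mphi : measurable_fun setT phi.
Proof.
apply: measurable_funB; first exact: measurable_funM.
by apply: measurable_fun_ifT => //; exact: measurable_fun_ler.
Qed.

Let mdigit m : measurable_fun setT (digit m).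
Proof. by apply: measurable_fun_ler => //; exact: measurable_iter. Qed.

Let qn (m : nat) : nat * rat := odflt (0%N, 0%Q) (choice.unpickle m).

(* The Dedekind cuts of all the terms of x, interleaved in a single sequence. *)
Let bits (x : nat -> R) m : bool := ratr (qn m).2 < x (qn m).1.

Let seq_enc (x : nat -> R) : R := tern (bits x).

(** A rational recorded below the n-th term contributes itself, any other digit contributes [-oo];
    the supremum over [m] recovers the term from its Dedekind cut. *)
Let dterm n m (t : R) : \bar R :=
  if ((qn m).1 == n) && digit m t then (ratr (qn m).2)%:E else -oo%E.

Let seq_dec (t : R) (n : nat) : R := fine (esups (fun m => dterm n m t) 0).

Let seq_encK x n : seq_dec (seq_enc x) n = x n.
Proof.
rewrite /seq_dec /esups/=; apply: EFin_inj.
have dE m : dterm n m (seq_enc x) =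
    if ((qn m).1 == n) && (ratr (qn m).2 < x n) then (ratr (qn m).2)%:E else -oo%E.
  by rewrite /dterm digit_tern /bits; case: eqP => //= ->.
suff -> : ereal_sup (sdrop (fun m => dterm n m (seq_enc x)) 0) = (x n)%:E by [].
apply/eqP; rewrite eq_le; apply/andP; split.
  apply: ub_ereal_sup => _ [m _ <-]; rewrite dE; case: ifP => [/andP[_ ?]|_].
    by rewrite lee_fin ltW.
  exact: leNye.
apply/lee_subgt0Pr => e e0; have /rat_in_itvoo[q] : x n - e < x n by rewrite gtrBl.
rewrite in_itv/= => /andP[q1 q2].
apply: (@le_trans _ _ (ratr q)%:E); first by rewrite -EFinB lee_fin ltW.
apply: ereal_sup_ubound; exists (choice.pickle (n, q)) => //.
by rewrite dE /qn choice.pickleK/= eqxx q2.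
Qed.

Let mseq_dec n : measurable_fun setT (seq_dec ^~ n).
Proof.
apply: (measurableT_comp (fine_measurable measurableT)).
apply: measurable_fun_esups => m; rewrite /dterm.
by case: eqP => _ /=; [apply: measurable_fun_ifT => //; exact: mdigit|exact: measurable_cst].
Qed.

Let mseq_enc d (Z : measurableType d) (g : nat -> Z -> R) :
  (forall n, measurable_fun setT (g n)) -> measurable_fun setT (fun z => seq_enc (g ^~ z)).
Proof.
move=> mg.
apply: (measurable_fun_cvg (h := fun N z => psum (bits (g ^~ z)) N)); last first.
  by move=> z _; exact: psum_cvg.
move=> N; apply: measurable_sum => m; apply: measurable_funM; last exact: measurable_cst.
by apply: measurable_fun_ifT => //; exact: measurable_fun_ltr.
Qed.

(** Provides the code and decoder demanded by [bimeasure_extension] for any space that its countably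
    many real coordinates determine measurably. *)
Lemma countable_coordinates_code d (Z : measurableType d) (I : countType)
    (g : I -> Z -> R) (r : (I -> R) -> Z) :
  (forall i, measurable_fun setT (g i)) -> (forall z, r (g ^~ z) = z) ->
  (forall h : R -> I -> R, (forall i, measurable_fun setT (h ^~ i)) ->
    measurable_fun setT (fun t => r (h t))) ->
  exists (enc : Z -> R) (dec : R -> Z), [/\ measurable_fun setT enc,
    measurable_fun setT dec, cancel enc dec & forall z, 0 <= enc z <= 1].
Proof.
move=> mg rg mr.
pose g' (n : nat) (z : Z) : R := if choice.unpickle n is Some i then g i z else 0.
have mg' n : measurable_fun setT (g' n) by rewrite /g'; case: choice.unpickle.
exists (fun z => seq_enc (g' ^~ z)), (fun t => r (fun i => seq_dec t (choice.pickle i))).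
split; [exact: mseq_enc|by apply: mr => i; exact: mseq_dec| |by move=> z; exact: tern01].
move=> z; rewrite -[RHS]rg; congr r; apply/funext => i.
by rewrite seq_encK /g' choice.pickleK.
Qed.

End ternary_code.

Lemma dprod_Zseq_code (R : realType) (I : finType) :
  exists (enc : dprod (fun _ : I => Zseq R) -> R) (dec : R -> dprod (fun _ : I => Zseq R)),
  [/\ measurable_fun setT enc, measurable_fun setT dec, cancel enc dec &
      forall z, 0 <= enc z <= 1].
Proof.
apply: (@countable_coordinates_code R _ (dprod (fun _ : I => Zseq R)) (I * int)%type
  (fun p z => z p.1 p.2)
  (fun x i j => x (i, j))) => //.
- move=> [i j] /=.
  exact: (measurableT_comp (@measurable_coord _ _ (fun _ : int => R : measurableType _) j)
    (@measurable_coord _ _ (fun _ : I => Zseq R) i)).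
- move=> h mh; apply: measurable_fun_dprod => i; apply: measurable_fun_dprod => j.
  exact: mh.
Qed.

(** * Disjointness *)

Section joinings_of_powers.
Context {R : realType} d d' (X : measurableType d) (Y : measurableType d')
  (mu : probability X R) (nu : probability Y R).
Implicit Types (T : automorphism mu) (S : automorphism nu)
  (lam : probability (X * Y)%type R).

Lemma joining_exp T S lam n : joining T S lam ->
  joining (aut_exp T n) (aut_exp S n) lam.
Proof.
move=> [lX lY lI]; split=> //.
have -> : pair_map (aut_exp T n) (aut_exp S n) = iter n (pair_map T S).
  by apply/funext => z; rewrite iter_pair_map /pair_map !aut_exp_iter.
apply: iter_preserving lI.
by apply: measurable_pair_map; exact: measurable_aut_fun.
Qed.

Lemma joining_V T S lam : joining T S lam -> joining (aut_V T) (aut_V S) lam.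
Proof.
move=> [lX lY lI]; split=> // A mA.
have mV : measurable_fun setT (pair_map (aut_V T) (aut_V S)).
  by apply: measurable_pair_map; exact: measurable_aut_fun.
have mVA : measurable (pair_map (aut_V T) (aut_V S) @^-1` A).
  by rewrite -[X in measurable X]setTI; exact: mV.
rewrite /pushforward -lI//; congr (lam _).
by apply/seteqP; split=> -[x y]; rewrite /pair_map/= !aut_funK.
Qed.

Lemma joining_expz T S lam m : joining T S lam ->
  joining (aut_expz T m) (aut_expz S m) lam.
Proof.
by case: m => n j; [exact: joining_exp|apply: (@joining_exp (aut_V T)); exact: joining_V].
Qed.

Lemma joining_product T S : joining T S (mu \x nu)%E.
Proof.
split.
- move=> A mA; rewrite /pushforward -setXT.
  by rewrite [LHS]product_measure1E// [X in (_ * X)%E]probability_setT mule1.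
- move=> B mB; rewrite /pushforward -setTX.
  by rewrite [LHS]product_measure1E// [X in (X * _)%E]probability_setT mul1e.
by apply: pair_map_preserving; [exact: measurable_aut_fun|exact: aut_preserving|
  exact: measurable_aut_fun|exact: aut_preserving].
Qed.

Lemma joining_eq_meas T S lam lam' : eq_meas lam lam' -> joining T S lam' ->
  joining T S lam.
Proof.
move=> e [lX lY lI]; split=> A mA.
- rewrite -lX//; apply: e; rewrite -[X in measurable X]setTI; exact: measurable_fst.
- rewrite -lY//; apply: e; rewrite -[X in measurable X]setTI; exact: measurable_snd.
rewrite e// -lI//; apply: e; rewrite -[X in measurable X]setTI.
by apply: measurable_pair_map mA => //; exact: measurable_aut_fun.
Qed.

End joinings_of_powers.

Section shift_powers.
Context {R : realType} (Q : probability (Zseq R) R) (sQ : stationary Q).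

Lemma shift_expzE m (x : Zseq R) : aut_expz (shift_aut sQ) m x = fun n => x (n + m).
Proof.
have e n (x' : Zseq R) : aut_exp (shift_aut sQ) n x' = fun i => x' (i + n%:Z).
  elim: n => [|n IH] /=; apply/funext => i; first by rewrite addr0.
  by rewrite IH /Zshift -addrA; congr (x' (i + _)); rewrite -natr1 addrC.
have eV n (x' : Zseq R) : aut_exp (aut_V (shift_aut sQ)) n x' = fun i => x' (i - n%:Z).
  elim: n => [|n IH] /=; apply/funext => i; first by rewrite subr0.
  by rewrite IH /Zunshift -addrA; congr (x' (i + _)); rewrite intS opprD.
by case: m => n; [exact: e|rewrite /aut_expz eV NegzE].
Qed.

Lemma ergodic_dprod_shift (I : finType) m : m != 0 ->
  (forall a, mlinear a -> wmix Q (@Zshift R) a) ->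
  ergodic (dprod_measure (fun _ : I => Q))
    (dprod_aut (fun _ : I => aut_expz (shift_aut sQ) m)).
Proof.
move=> m0 wQ.
have it n (z : dprod (fun _ : I => Zseq R)) :
    iter n (dprod_map (fun _ : I => @Zshift R)) z = dprod_map (fun _ => iter n (@Zshift R)) z.
  by elim: n => // n IH; rewrite iterS IH.
case: m m0 => n n0.
  have -> : (dprod_aut (fun _ : I => aut_expz (shift_aut sQ) n) : _ -> _) =
      iter n (dprod_map (fun _ : I => @Zshift R)).
    apply/funext => z; rewrite it; apply: functional_extensionality_dep => i.
    exact: aut_exp_iter.
  by apply: dprod_ergodic => //; rewrite lt0n.
apply: (@ergodic_inverse _ _ _ _ (iter n.+1 (dprod_map (fun _ : I => @Zshift R)))).
  move=> z; rewrite it; apply: functional_extensionality_dep => i.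
  exact: (aut_exp_inverse (shift_aut sQ) n.+1).
exact: dprod_ergodic.
Qed.

End shift_powers.

(** [f + 1] lies in [0, 2] and is rounded down to a multiple of [e] by counting the levels it
    passes. Only finite combinations of indicators can be fed to [ergodic_joining_above]. *)
Lemma simple_minorant {R : realType} d (Y : measurableType d) (f : Y -> R) (e : R) :
  measurable_fun setT f -> (forall y, `|f y| <= 1) -> 0 < e ->
  exists l : seq (R * set Y), (forall p, p \in l -> measurable p.2) /\
    forall y, \sum_(p <- l) p.1 * \1_(p.2) y <= f y <= \sum_(p <- l) p.1 * \1_(p.2) y + e.
Proof.
move=> mf f1 e0.
pose B (n : nat) := [set y | n.+1%:R * e <= f y + 1].
have mB n : measurable (B n).
  rewrite (_ : B n = (fun y => f y + 1) @^-1` `[n.+1%:R * e, +oo[).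
    rewrite -[X in measurable X]setTI; apply: measurable_funD => //.
  by apply/seteqP; split=> y /=; rewrite in_itv/= andbT.
pose N := Num.truncn (2 / e).
exists ((-1, setT) :: [seq (e, B n) | n <- iota 0 N]); split.
  by move=> p; rewrite inE => /orP[/eqP->|/mapP[n _ ->]]; [exact: measurableT|exact: mB].
move=> y; rewrite big_cons/= indicT mulr1 big_map/=.
have f2 : 0 <= f y + 1 <= 2 by have := f1 y; rewrite ler_norml => /andP[? ?]; apply/andP; split; lra.
suff h M : f y + 1 <= M.+1%:R * e ->
    let s := \sum_(n <- iota 0 M) e * \1_(B n) y in s <= f y + 1 <= s + e.
  have /h/= : f y + 1 <= N.+1%:R * e.
    rewrite -ler_pdivrMr//; apply: ltW; apply: le_lt_trans (truncnS_gt (2 / e)).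
    by apply: ler_wpM2r; [rewrite invr_ge0 ltW|case/andP: f2].
  by move=> /andP[? ?]; apply/andP; split; lra.
elim: M => [|M IH].
  by rewrite /= big_nil mul1r; case/andP: f2 => -> _ /=; rewrite add0r.
have -> : iota 0 M.+1 = iota 0 M ++ [:: M] by rewrite -addn1 iotaD.
rewrite big_cat/= big_seq1 => h.
have [hM|hM] := leP (M.+1%:R * e) (f y + 1); last first.
  rewrite indicE memNset ?mulr0 ?addr0; first exact: IH (ltW hM).
  by rewrite /B/=; apply/negP; rewrite -ltNge.
rewrite indicE mem_set// mulr1.
have -> : \sum_(n <- iota 0 M) e * \1_(B n) y = M%:R * e.
  rewrite (eq_big_seq (fun=> e)); first by rewrite big_const_seq count_predT size_iota iter_addr_0 mulr_natl.
  move=> n; rewrite mem_iota add0n => /andP[_ nM]; rewrite indicE mem_set ?mulr1//.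
  by apply: le_trans hM; apply: ler_wpM2r; [exact: ltW|rewrite ler_nat ltnS ltnW].
by move: hM h; rewrite -!natr1 !mulrDl !mul1r => ? ?; apply/andP; split; lra.
Qed.

(** * Influence of a few coordinates on the sum *)

Section trigonometric_bounds.
Context {R : realType}.

Lemma norm_sinD_le (x y : R) : `|sin (x + y)| <= `|sin x| + `|sin y|.
Proof.
rewrite sinD (le_trans (ler_normD _ _))// !normrM lerD//.
  by rewrite ler_piMr// ler_norml cos_geN1 cos_le1.
by rewrite ler_piMl// ler_norml cos_geN1 cos_le1.
Qed.

Lemma norm_sin_sum_le (I : finType) (J : {set I}) (x : I -> R) :
  `|sin (\sum_(i in J) x i)| <= \sum_(i in J) `|sin (x i)|.
Proof.
apply: (big_ind2 (fun s t => `|sin s| <= t)) => //; first by rewrite sin0 normr0.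
by move=> s1 t1 s2 t2 h1 h2; rewrite (le_trans (norm_sinD_le _ _))// lerD.
Qed.

(** Follows from [cos (u + w) - cos w = -2 sin (u/2) sin (w + u/2)]. The bound ignores multiples of
    2 pi in [u], as needed since a charfun controls [a] only modulo 2 pi. *)
Lemma norm_cosB_le (u w : R) : `|cos (u + w) - cos w| <= 2 * `|sin (u / 2)|.
Proof.
set h := u / 2; set v := w + h.
have -> : u + w = v + h by rewrite /v /h; field.
have -> : cos w = cos (v - h) by rewrite /v addrK.
rewrite cosB cosD (_ : _ - _ = - (2 * sin h * sin v)); last by ring.
rewrite normrN !normrM ger0_norm// ler_piMr ?mulr_ge0//.
by rewrite ler_norml sin_geN1 sin_le1.
Qed.

Lemma sqr_sin_half (x : R) : sin (x / 2) ^+ 2 = (1 - cos x) / 2.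
Proof.
have -> : cos x = cos (x / 2) ^+ 2 - sin (x / 2) ^+ 2.
  by rewrite {1}(_ : x = x / 2 + x / 2); [rewrite cosD !expr2|field].
by have := cos2Dsin2 (x / 2); lra.
Qed.

End trigonometric_bounds.

(* With alpha the argument of the characteristic function, a - alpha is       *)
(* concentrated near 2 pi Z when its modulus is close to 1.                   *)
Lemma charfun_recentre {R : realType} d (W : measurableType d) (Q : probability W R)
    (a : W -> R) (eta : R) : measurable_fun setT a -> 0 <= eta ->
  (1 - sqn (charfun Q a)) / 2 <= eta ^+ 2 ->
  exists alpha : R, \int[Q]_y `|sin ((a y - alpha) / 2)| <= eta.
Proof.
move=> ma eta0 he; have [alpha Qa _] := polar (charfun Q a).
exists alpha; set rho := Num.sqrt _ in Qa.
have s1 := sqn_charfun_le1 Q ma; have s0 := sqn_ge0 (charfun Q a).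
have mb : measurable_fun setT (fun y => (a y - alpha) / 2).
  by apply: measurable_funM => //; exact: measurable_funB.
have bs := bmf_sin mb; have bn := bmf_norm bs.
rewrite -(@ler_pXn2r _ 2)// ?nnegrE//; last by apply: Rint_ge0.
apply: le_trans (Rint_sqr_le Q bn) _; apply: le_trans he.
have mc : measurable_fun setT (fun y => a y - alpha) by exact: measurable_funB.
have bc := bmf_cos mc; have b1 := bmf_cst W (1 : R).
rewrite (@eq_Rint _ _ _ _ _ (fun y => 2^-1 * (1 - cos (a y - alpha)))); last first.
  by move=> y; rewrite -normrX ger0_norm ?sqr_ge0// sqr_sin_half mulrC.
rewrite RintZ ?RintB ?Rint_cst//; last exact: bmfB.
have Re_Q : complex.Re (charfun Q a) = rho * cos alpha by rewrite Qa.
have Im_Q : complex.Im (charfun Q a) = rho * sin alpha by rewrite Qa.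
rewrite (Rint_cosD Q (- alpha) ma) Re_Q Im_Q cosN sinN mulrN opprK.
have -> : rho * cos alpha * cos alpha + rho * sin alpha * sin alpha = rho.
  by rewrite -!mulrA -mulrDr -!expr2 cos2Dsin2 mulr1.
rewrite [2^-1 * _]mulrC ler_wpM2r// lerD2l lerN2.
have r0 : 0 <= rho by exact: sqrtr_ge0.
have r2 : rho ^+ 2 = sqn (charfun Q a) by rewrite sqr_sqrtr.
rewrite -r2 expr2 ler_piMl//.
by rewrite -(@ler_pXn2r _ 2)// ?nnegrE// r2 expr1n.
Qed.

Lemma dprod_measure_coord {R : realType} (I : finType) d (Y : forall i : I, measurableType (d i))
    (nu : forall i, probability (Y i) R) i :
  eq_meas (pushforward (dprod_measure nu) (fun z : dprod Y => z i)) (nu i).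
Proof.
move=> B mB; pose C := dfwith (fun j => setT) i B : forall j, set (Y j).
have mC j : measurable (C j).
  rewrite /C; have [<-|ij] := eqVneq i j; first by rewrite dfwithin.
  by rewrite dfwithout.
rewrite /pushforward (_ : _ @^-1` B = box C); last first.
  apply/seteqP; split=> z /=.
    move=> Bz j; rewrite /C; have [<-|ij] := eqVneq i j; first by rewrite dfwithin.
    by rewrite dfwithout.
  by move=> /(_ i); rewrite /C dfwithin.
rewrite dprod_measure_box// (bigD1 i)//= big1 => [|j ji].
  by rewrite mulr1 /C dfwithin fineK// fin_num_measure.
by rewrite /C dfwithout 1?eq_sym// probability_setT.
Qed.

Lemma measurable_complement dX (X : measurableType dX) (I : finType) d
    (Y : forall i : I, measurableType (d i)) (J : {set I}) :
  measurable_fun setT (@complement _ X _ _ Y J).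
Proof.
apply: measurable_fun_dprod => i.
exact: (measurableT_comp (@measurable_coord _ _ Y (val i)) (@measurable_snd _ _ X (dprod Y))).
Qed.

Section partial_independence.
Context {R : realType} dX (X : measurableType dX) (mu : probability X R).
Context (I : finType) (Q : probability (Zseq R) R) (J : {set I}).
Let Z := dprod (fun _ : I => Zseq R).
Variable L : probability (X * Z)%type R.
Hypotheses (LX : eq_meas (pushforward L fst) mu)
  (LZ : eq_meas (pushforward L snd) (dprod_measure (fun _ : I => Q))).
Hypothesis LJ : eq_meas (pushforward L (fun p => (marginal J p, complement J p)))
  (distribution L (marginal J) \x
   dprod_measure (fun _ : {i | i \notin J} => Q))%E.

Let indep (A : set X) (g : dprod (fun _ : {i | i \notin J} => Zseq R) -> R) :
  measurable A -> bmf g ->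
  \int[L]_p (\1_A p.1 * g (complement J p)) =
  fine (mu A) * \int[dprod_measure (fun _ : {i | i \notin J} => Q)]_y g y.
Proof.
move=> mA bg.
have bA := bmf_indic (R := R) mA.
have mPhi : measurable_fun setT (fun p : X * Z => (marginal J p, complement J p)).
  by apply: measurable_fun_pair; [exact: measurable_marginal|exact: measurable_complement].
have bA1 : bmf (fun q : X * dprod (fun _ : {i | i \in J} => Zseq R) => \1_A q.1 : R).
  by apply: bmf_comp bA.
have bF := bmfM (bmf_comp (@measurable_fst _ _ _
  (dprod (fun _ : {i | i \notin J} => Zseq R))) bA1) (bmf_comp measurable_snd bg).
rewrite (Rint_pushforward mPhi LJ bF)/=.
rewrite (Rint_prodM _ _ bA1 bg); congr (_ * _).
by rewrite (Rint_distribution _ _ bA1)/= (Rint_pushforward measurable_fst LX bA) Rint_indic.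
Qed.

(** Replacing [a] by the constant [alpha] on the coordinates in [J] changes each of the two
    integrals by at most [2 #|J| eta], and what remains depends only on coordinates independent of
    [X]. *)
Lemma partial_independence_estimate (A : set X) (a : Zseq R -> R) (r eta : R) :
  measurable A -> mlinear a -> 0 <= eta -> (1 - sqn (charfun Q a)) / 2 <= eta ^+ 2 ->
  `|\int[L]_p (\1_A p.1 * cos (a (sumI p.2) + r)) -
    fine (mu A) * \int[L]_p cos (a (sumI p.2) + r)| <= 4 * (#|J|%:R * eta).
Proof.
move=> mA La eta0 he; have ma := mlinear_measurable La.
have [alpha Qa] := charfun_recentre ma eta0 he.
pose t (y : Zseq R) := `|sin ((a y - alpha) / 2)|.
have bt : bmf t.
  apply/bmf_norm/bmf_sin/measurable_funM => //; exact: measurable_funB.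
(* Extension by 0 to the indices in [J], so that the sum over the complement is indexed by [I] and
   not by a subtype. *)
pose ext (y : dprod (fun _ : {i | i \notin J} => Zseq R)) (i : I) : R :=
  if insub i is Some j then a (y j) else 0.
have mext i : measurable_fun setT (ext ^~ i).
  rewrite /ext; case: insub => [j|]; last exact: measurable_cst.
  apply: (measurableT_comp ma).
  exact: (@measurable_coord _ _ (fun _ : {i | i \notin J} => Zseq R) j).
pose g y := cos (\sum_(i | i \notin J) ext y i + (\sum_(i in J) alpha + r)).
have bg : bmf g.
  apply/bmf_cos/measurable_funD => //.
  rewrite [X in measurable_fun _ X](_ : _ =
    fun y => \sum_i (if i \notin J then ext y i else 0)).
    by apply: measurable_sum => i; case: (i \notin J).
  by apply/funext => y; rewrite big_mkcond.
pose f (p : X * Z) := cos (a (sumI p.2) + r).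
have bf : bmf f.
  apply/bmf_cos/measurable_funD => //; apply: (measurableT_comp ma).
  exact: (measurableT_comp (@measurable_sumI _ _) measurable_snd).
have bgc : bmf (fun p : X * Z => g (complement J p)).
  by apply: bmf_comp bg; exact: measurable_complement.
have fg p : `|f p - g (complement J p)| <= 2 * \sum_(i in J) t (p.2 i).
  rewrite /f /g (mlinear_sum _ _ La) (bigID (mem J))/=.
  pose U := \sum_(i in J) (a (p.2 i) - alpha).
  pose W := \sum_(i | i \notin J) a (p.2 i) + (\sum_(i in J) alpha + r).
  have -> : \sum_(i | i \notin J) ext (complement J p) i = \sum_(i | i \notin J) a (p.2 i).
    by apply: eq_bigr => i iJ; rewrite /ext insubT.
  rewrite (_ : _ + _ + r = U + W); last by rewrite /U /W sumrB; ring.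
  apply: le_trans (norm_cosB_le U W) _; rewrite ler_pM2l//.
  by rewrite /U mulr_suml; exact: norm_sin_sum_le.
have bti i : bmf (fun p : X * Z => t (p.2 i)).
  apply: (bmf_comp _ bt).
  exact: (measurableT_comp (@measurable_coord _ _ (fun _ : I => Zseq R) i) measurable_snd).
have Et i : \int[L]_p t (p.2 i) <= eta.
  have mi := @measurable_coord _ _ (fun _ : I => Zseq R) i.
  rewrite (Rint_pushforward measurable_snd LZ (bmf_comp mi bt)).
  by rewrite (Rint_pushforward mi (dprod_measure_coord (fun _ : I => Q) (i := i)) bt).
have enumE (p : X * Z) : \sum_(i in J) t (p.2 i) = \sum_(i <- enum J) t (p.2 i).
  by rewrite big_enum.
have bS : bmf (fun p : X * Z => \sum_(i <- enum J) t (p.2 i)) by exact: bmf_sum.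
have bT : bmf (fun p : X * Z => 2 * \sum_(i in J) t (p.2 i)).
  rewrite (_ : (fun _ => _) = fun p : X * Z => 2 * \sum_(i <- enum J) t (p.2 i)).
    exact: bmfZ.
  by apply/funext => p; rewrite enumE.
have ET : \int[L]_p (2 * \sum_(i in J) t (p.2 i)) <= 2 * (#|J|%:R * eta).
  under eq_Rint do rewrite enumE.
  rewrite RintZ// Rint_sum// ler_pM2l// big_enum/= -sum1_card natr_sum mulr_suml.
  by apply: ler_sum => i _; rewrite mul1r.
have bA1 : bmf (fun p : X * Z => \1_A p.1 : R) by exact: bmf_comp (bmf_indic mA).
have A01 (p : X * Z) : 0 <= (\1_A p.1 : R) <= 1.
  by rewrite indicE; case: (_ \in _); rewrite ?lexx ?ler01.
have diff h : bmf h -> (forall p, 0 <= h p <= 1) ->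
    `|\int[L]_p (h p * f p) - \int[L]_p (h p * g (complement J p))| <= 2 * (#|J|%:R * eta).
  move=> bh h01; rewrite -RintB; [|exact: bmfM|exact: bmfM].
  apply: le_trans ET; have bd := bmfB (bmfM bh bf) (bmfM bh bgc).
  apply: (le_trans (norm_Rint L bd)); apply: (le_Rint L (bmf_norm bd) bT).
  move=> p; rewrite -mulrBr normrM; apply: le_trans (fg p).
  by have /andP[h0 h1] := h01 p; rewrite ger0_norm// ler_piMl.
have d1 := diff _ bA1 A01.
have i1 : 0 <= (1 : R) <= 1 by rewrite ler01 lexx.
have e1 (h : X * Z -> R) : \int[L]_p (1 * h p) = \int[L]_p h p.
  by apply: eq_Rint => p; rewrite mul1r.
have := diff _ (bmf_cst _ 1) (fun=> i1); rewrite !e1 => d2.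
move: d1; rewrite (indep mA bg).
have := indep measurableT bg; rewrite indicT e1 probability_setT mul1r => <- d1.
have A0 : 0 <= fine (mu A) <= 1.
  by rewrite fine_ge0//= -lee_fin fineK ?fin_num_measure//; exact: probability_le1.
rewrite -(subrKA (fine (mu A) * \int[L]_p g (complement J p))).
rewrite (le_trans (ler_normD _ _))// (_ : 4 * _ = 2 * (#|J|%:R * eta) + 2 * (#|J|%:R * eta)); last by ring.
rewrite lerD//; case/andP: A0 => A0 A1.
by rewrite -mulrBr normrM ger0_norm// distrC (le_trans _ d2)// ler_piMl.
Qed.

End partial_independence.

Lemma onem_le_inv_sub1 {R : realType} (x : R) : 0 < x -> 1 - x <= x^-1 - 1.
Proof.
move=> x0; rewrite -subr_ge0 (_ : _ - _ = (1 - x) ^+ 2 / x).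
  by rewrite divr_ge0 ?sqr_ge0// ltW.
by field; rewrite gt_eqF.
Qed.

Lemma Rint_simple_rect {R : realType} d d' (X : measurableType d) (W : measurableType d')
    (M : probability (X * W)%type R) (A : set X) (l : seq (R * set W)) :
  measurable A -> (forall p, p \in l -> measurable p.2) ->
  bmf (fun z : X * W => \1_A z.1 * \sum_(p <- l) p.1 * \1_(p.2) z.2) /\
  \int[M]_z (\1_A z.1 * \sum_(p <- l) p.1 * \1_(p.2) z.2) =
  \sum_(p <- l) p.1 * fine (M (A `*` p.2)).
Proof.
move=> mA; elim: l => [|[c B] l IH] ml.
  have E : (fun z : X * W => \1_A z.1 * \sum_(p <- [::]) p.1 * \1_(p.2 : set W) z.2) = fun=> 0 :> R.
    by apply/funext => z; rewrite big_nil mulr0.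
  by rewrite E big_nil Rint_cst; split=> //; exact: bmf_cst.
have mB : measurable B by apply: (ml (c, B)); rewrite inE eqxx.
have [|bl El] := IH; first by move=> p pl; apply: ml; rewrite inE pl orbT.
have bAB := bmfZ c (bmf_indic (R := R) (measurableX mA mB)).
have E : (fun z : X * W => \1_A z.1 * \sum_(p <- (c, B) :: l) p.1 * \1_(p.2) z.2) =
    fun z => c * \1_(A `*` B) z + \1_A z.1 * \sum_(p <- l) p.1 * \1_(p.2) z.2 :> R.
  apply/funext => z; rewrite big_cons mulrDr/= mulrCA; congr (_ * _ + _).
  by rewrite !indicE in_setX -natrM mulnb.
rewrite E; split; first exact: bmfD.
rewrite RintD// El big_cons/= RintZ ?Rint_indic//; last exact: bmf_indic (measurableX mA mB).
exact: measurableX.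
Qed.

Section disjointness.
Context {R : realType} (n : nat) (n_ge1 : (1 <= n)%N)
  (d : measure_display) (X : measurableType d)
  (mu : probability X R) (T : automorphism mu)
  (m : int) (m_neq0 : m != 0) (JP_Tm : JP n (aut_expz T m))
  (P : probability (Zseq R) R) (P_stat : stationary P)
  (P_erg : ergodic P (@Zshift R)) (P_ID : infinitely_divisible P).
Variable lam : probability (X * Zseq R)%type R.
Hypothesis jlam : joining T (shift_aut P_stat) lam.

(** Only an inequality can be reached directly, since the ergodic joining put in the place of [lam]
    agrees with it only up to an increase of the linear form. *)
Let joining_cos_le (A : set X) (a : Zseq R -> R) (r : R) : measurable A -> mlinear a ->
  \int[lam]_p (\1_A p.1 * cos (a p.2 + r)) <= fine (mu A) * \int[P]_y cos (a y + r).
Proof.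
move=> mA La; have ma := mlinear_measurable La.
apply/ler_addgt0Pr => e e0.
have n0 : 0 < n%:R :> R by rewrite ltr0n.
(* Half of the error [e] pays for the [n] dependent coordinates, the other half for the simple
   minorant. *)
have [eta eta0 eta_e] : exists2 eta : R, 0 < eta & 4 * (n%:R * eta) = e / 2.
  exists (e / (8 * n%:R)); first by rewrite divr_gt0// mulr_gt0.
  by field; rewrite gt_eqF.
have eta2 : 0 < 2 * eta ^+ 2 by rewrite mulr_gt0// exprn_gt0.
pose b := (sqn (charfun P a))^-1.
have b0 : 0 < b by rewrite invr_gt0 sqn_gt0// ID_charfun_neq0.
(* Large enough for the JP property, and for [inv_sub1_le] to give a k-th root [Q] of [P] with
   [(1 - |phi_Q(a)|^2) / 2 <= eta^2]. *)
pose k := (n + Num.truncn ((b - 1) / (2 * eta ^+ 2))).+1.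
have nk : (n < k)%N by rewrite /k ltnS leq_addr.
have k0 : (0 < k)%N by [].
have bk : (b - 1) / (2 * eta ^+ 2) <= k%:R.
  apply/ltW/(lt_le_trans (truncnS_gt _)); rewrite ler_nat /k.
  by rewrite ltnS leq_addl.
move: k nk k0 bk => k nk k0 bk.
have [Q PQ] := P_ID k0.
have sQ : stationary Q.
  by apply: (root_stationary k0 _ P_stat PQ) => c Lc; exact: ID_charfun_neq0.
have wQ c : mlinear c -> wmix Q (@Zshift R) c.
  by move=> Lc; exact: (root_wmix P_stat P_erg P_ID k0 PQ Lc).
pose S : automorphism Q := aut_expz (shift_aut sQ) m.
pose Z := dprod (fun _ : 'I_k => Zseq R).
have PQI : eq_meas P (convolution_power Q #|'I_k|) by rewrite card_ord.
have sumS (z : Z) : sumI (dprod_aut (fun _ : 'I_k => S) z) =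
    aut_expz (shift_aut P_stat) m (sumI z).
  rewrite shift_expzE; apply/funext => i; apply: eq_bigr => j _.
  by rewrite /= /dprod_map /S shift_expzE.
have ergS : ergodic (dprod_measure (fun _ : 'I_k => Q)) (dprod_aut (fun _ : 'I_k => S)).
  exact: ergodic_dprod_shift.
have [c [dec [mc mdec cK c01]]] := dprod_Zseq_code R 'I_k.
have mI := @measurable_sumI R 'I_k.
have [L' jL' L'E] := joining_lift mI (sumI_preserving PQI) sumS
  (joining_expz m jlam) mc mdec cK c01.
have [ergT JPT] := JP_Tm.
pose f (y : Zseq R) := cos (a y + r).
have bf : bmf f by apply/bmf_cos/measurable_funD.
have f1 y : `|f y| <= 1 by rewrite ler_norml cos_geN1 cos_le1.
have e20 : 0 < e / 2 by rewrite divr_gt0.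
have [l [ml lf]] := simple_minorant (proj1 bf) f1 e20.
(* The linear form to be maximized: the integral over [A] of the simple minorant of [f], pulled back
   by the sum of the coordinates. *)
pose l' := [seq (p.1, (A, @sumI R 'I_k @^-1` p.2)) | p <- l] : seq (R * (set X * set Z)).
have [|L [jL ergL] lL] := ergodic_joining_above (l := l') ergT ergS mc mdec cK c01 jL'.
  move=> _ /mapP[p /ml mp ->] /=; split=> //.
  by rewrite -[X in measurable X]setTI; exact: mI.
have [J J_n LJ] := JPT k nk _ (fun=> Zseq R) (fun=> Q) (fun=> S)
  (fun=> standard_borel_Zseq) (fun=> @wmix_weakly_mixing _ _ sQ _ m_neq0 wQ) L (conj jL ergL).
have [LX LZ _] := jL.
have he : (1 - sqn (charfun Q a)) / 2 <= eta ^+ 2.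
  set x := sqn (charfun Q a).
  have x0 : 0 < x by rewrite sqn_gt0// (root_charfun_neq0 P_ID k0 PQ).
  have xk : x ^+ k = b^-1 by rewrite /x -sqnX (charfun_root PQ La) /b invrK.
  have := inv_sub1_le x0 xk b0.
  have x1 := onem_le_inv_sub1 x0.
  rewrite -(mulr_natr (x^-1 - 1)) => h.
  have kR : 0 < k%:R :> R by rewrite ltr0n.
  have h2 : (1 - x) * k%:R <= b - 1 by apply: le_trans h; apply: ler_wpM2r => //; exact: ltW.
  move: bk; rewrite (ler_pdivrMr _ _ eta2) => h3.
  rewrite ler_pdivrMr// -(@ler_pM2r _ k%:R)//.
  by apply: le_trans (le_trans h2 h3) _; rewrite le_eqVlt; apply/orP; left; apply/eqP; ring.
have est := partial_independence_estimate LX LZ LJ r mA La (ltW eta0) he.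
have fP : \int[L]_p f (sumI p.2) = \int[P]_y f y.
  rewrite (Rint_pushforward measurable_snd LZ (bmf_comp mI bf)).
  exact: (Rint_pushforward mI (sumI_preserving PQI) bf).
have bA1 dW (W : measurableType dW) : bmf (fun p : X * W => \1_A p.1 : R).
  exact: (bmf_comp measurable_fst (bmf_indic mA)).
have A01 x : 0 <= (\1_A x : R) <= 1.
  by rewrite indicE; case: (_ \in _); rewrite ?lexx ?ler01.
have [bs Es] := Rint_simple_rect lam mA ml.
pose ls := [seq (p.1, @sumI R 'I_k @^-1` p.2) | p <- l] : seq (R * set Z).
have mls p : p \in ls -> measurable p.2.
  move=> /mapP[q /ml mq ->]; rewrite -[X in measurable X]setTI; exact: mI.
have [bs' Es'] := Rint_simple_rect L mA mls.
have e4 : 4 * (#|J|%:R * eta) = e / 2 by rewrite J_n.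
apply: (@le_trans _ _ (\int[lam]_z (\1_A z.1 * \sum_(p <- l) p.1 * \1_(p.2) z.2) + e / 2)).
  have be := bmf_cst (X * Zseq R)%type (e / 2).
  rewrite -(Rint_cst lam (e / 2)) -RintD//.
  apply: le_Rint; [|exact: bmfD|].
    exact: (bmfM (bA1 _ _) (bmf_comp measurable_snd bf)).
  move=> z; have /andP[_ h] := lf z.2; have /andP[A0 A1] := A01 z.1.
  apply: (le_trans (ler_wpM2l A0 h)); rewrite mulrDr lerD2l ler_piMl//; exact: ltW.
have le_est : \int[L]_p (\1_A p.1 * f (sumI p.2)) <=
    fine (mu A) * \int[P]_y f y + e / 2.
  rewrite -fP -lerBlDl -e4; apply: le_trans est; exact: ler_norm.
have le_L : \int[L]_z (\1_A z.1 * \sum_(p <- ls) p.1 * \1_(p.2) z.2) <=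
    \int[L]_p (\1_A p.1 * f (sumI p.2)).
  apply: le_Rint => //.
    exact: (bmfM (bA1 _ _) (bmf_comp measurable_snd (bmf_comp mI bf))).
  move=> z; have /andP[A0 A1] := A01 z.1; apply: ler_wpM2l => //.
  have /andP[h _] := lf (sumI z.2); apply: le_trans h.
  by rewrite big_map le_eqVlt; apply/orP; left; apply/eqP; apply: eq_bigr => p _.
rewrite [in leRHS](splitr e) addrA lerD2r; apply: le_trans (le_trans le_L le_est).
rewrite Es Es' big_map; move: lL; rewrite !big_map /=; apply: le_trans.
rewrite le_eqVlt; apply/orP; left; apply/eqP; apply: eq_big_seq => p /ml mp.
by rewrite L'E.
Qed.

(** Adding [pi] to the phase changes the sign of the cosine and so reverses the inequality. *)
Let joining_cos (A : set X) (a : Zseq R -> R) (r : R) : measurable A -> mlinear a ->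
  \int[lam]_p (\1_A p.1 * cos (a p.2 + r)) = fine (mu A) * \int[P]_y cos (a y + r).
Proof.
move=> mA La; have ma := mlinear_measurable La.
apply/eqP; rewrite eq_le joining_cos_le//=.
have bf : bmf (fun y : Zseq R => cos (a y + r)) by apply/bmf_cos/measurable_funD.
have bA1 : bmf (fun p : X * Zseq R => \1_A p.1 * cos (a p.2 + r)).
  apply: bmfM; first exact: (bmf_comp measurable_fst (bmf_indic mA)).
  exact: (bmf_comp measurable_snd bf).
have cosDpi y : cos (a y + (r + pi)) = - cos (a y + r) by rewrite addrA cosDpi.
have e : \int[lam]_p (\1_A p.1 * cos (a p.2 + (r + pi))) =
    - \int[lam]_p (\1_A p.1 * cos (a p.2 + r)).
  by rewrite -(RintN _ bA1); apply: eq_Rint => p; rewrite cosDpi mulrN.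
have := joining_cos_le (r + pi) mA La.
rewrite e (@eq_Rint _ _ _ P _ (fun y => - cos (a y + r)) cosDpi) (RintN _ bf).
by rewrite mulrN lerN2.
Qed.

(** For fixed [A], the second marginal of [lam] restricted to [A] and the multiple [mu A] of [P]
    have the same Fourier transform, hence coincide; this settles all rectangles. *)
Lemma joining_eq_product : eq_meas lam (mu \x P)%E.
Proof.
have [lX lY _] := jlam.
pose muP : probability (X * Zseq R)%type R := (mu \x P)%E.
apply: (@rectangles_unique _ _ _ _ _ lam muP) => A B mA mB.
have muPE : muP (A `*` B) = (fine (mu A) * fine (P B))%:E.
  by rewrite [LHS]product_measure1E// EFinM !fineK ?fin_num_measure.
refine (etrans _ (esym muPE)).
have bA1 : bmf (fun p : X * Zseq R => \1_A p.1 : R).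
  exact: (bmf_comp measurable_fst (bmf_indic mA)).
have bB1 : bmf (fun p : X * Zseq R => \1_B p.2 : R).
  exact: (bmf_comp measurable_snd (bmf_indic mB)).
have cosE a r : mlinear a -> \int[lam]_p (\1_A p.1 * cos (a p.2 + r)) =
    \int[P]_y (fine (mu A) * cos (a y + r)).
  move=> La; rewrite joining_cos// RintZ//.
  by apply/bmf_cos/measurable_funD => //; exact: mlinear_measurable.
have := charfun_unique_weighted bA1 (bmf_cst _ (fine (mu A))) measurable_snd
  (@measurable_id _ (Zseq R) setT) (@mlinear0 R) mlinearD mlinearZ mlinear_measurable mlinear_gen cosE mB.
rewrite RintZ ?Rint_indic//; last exact: bmf_indic.
move=> <-; rewrite -[LHS]fineK ?fin_num_measure//; last exact: measurableX.
rewrite -Rint_indic; last exact: measurableX.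
by congr (_%:E); apply: eq_Rint => -[x y]; rewrite !indicE in_setX -natrM mulnb.
Qed.

End disjointness.

Theorem corollary6p4 (R : realType) (n : nat) (n_ge1 : (1 <= n)%N)
  (d : measure_display) (X : measurableType d) (X_borel : standard_borel R X)
  (mu : probability X R) (T : automorphism mu)
  (m : int) (m_neq0 : m != 0) (JP_Tm : JP n (aut_expz T m))
  (P : probability (Zseq R) R) (P_stat : stationary P)
  (P_erg : ergodic P (@Zshift R)) (P_ID : infinitely_divisible P) :
  disjoint_aut T (shift_aut P_stat).
Proof.
move=> lam; split=> [jlam|e].
  exact: (joining_eq_product n_ge1 m_neq0 JP_Tm P_erg P_ID jlam).
exact: joining_eq_meas e (joining_product T (shift_aut P_stat)).
Qed.
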